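(* Let $\alpha>0$, let $m=m(n)$ be positive integers with $m/n\to\alpha$ as $n\to+\infty$, and let $\{P_n\}_{n\ge1}$ be probability laws on $\mathbf{R}$ with zero mean, finite moments of all orders and $M_2(P_n)>0$, such that for every $k\ge1$ the limit $$A_k:=\lim_{n\to+\infty}\frac{M_k(P_n)}{n^{k/2-1}M_2(P_n)^{k/2}}$$ exists and is finite. Write $\mathcal{A}=(A_k)_{k\ge1}$. For each $n$ let $X_n=(X_n(i,j))_{1\le i\le n,\,1\le j\le m}$ be a random $n\times m$ matrix with i.i.d. entries of law $P_n$, and let $W_n=\frac{1}{nM_2(P_n)}X_nX_n^T$. Suppose that for some $\gamma>0$, $A_k=O(\gamma^k)$ as $k\to+\infty$. Then there exists a probability law $\mu_{\mathcal{A},\alpha}$, depending only on $\mathcal{A}$ and $\alpha$, such that $\mu_{W_n}$ converges weakly to $\mu_{\mathcal{A},\alpha}$ in probability: for all $\varepsilon>0$ and all bounded continuous $f:\mathbf{R}\to\mathbf{R}$, $$\mathbf{P}\left(\left|\int_{\mathbf{R}}f\,\mathrm{d}\mu_{W_n}-\int_{\mathbf{R}}f\,\mathrm{d}\mu_{\mathcal{A},\alpha}\right|>\varepsilon\right)\underset{n\to+\infty}{\longrightarrow}0.$$ Moreover, $\mu_{\mathcal{A},\alpha}$ is characterized by its sequence of moments: for all $k\ge1$, $$M_k(\mu_{\mathcal{A},\alpha})=\sum_{a=1}^{k}\sum_{l=1}^{a}\alpha^l\sum_{\substack{\mathbf{b}=(b_1,\ldots,b_a)\\ b_1\ge b_2\ge\cdots\ge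 b_a\ge2\\ b_1+\cdots+b_a=2k}}|\mathcal{W}_k(a,a+1,l,\mathbf{b})|\prod_{i=1}^{a}A_{b_i}.$$
   Context: $M_k(\mu)=\int x^k\,\mathrm{d}\mu$ denotes the $k$-th moment. For a real symmetric $n\times n$ matrix $W$, $\mu_W=\frac1n\sum_{\lambda\in\mathrm{Spec}(W)}\delta_\lambda$ (eigenvalues counted with multiplicity) is its spectral measure. Words. A labeled graph is a finite graph $\mathrm{G}=(\mathrm{V},\mathrm{E})$ with a bijection from $\mathrm{V}$ to $\{1,\ldots,|\mathrm{V}|\}$. A word on a labeled graph is a finite sequence of labels in which any two consecutive labels are labels of adjacent vertices; it is closed if its first and last labels coincide. Two words $i_1,\ldots,i_p$ and $i_1',\ldots,i_p'$ of the same length, on labeled graphs with the same number of vertices, are equivalent if there is a bijection $\sigma$ of $\{1,\ldots,|\mathrm{V}|\}$ with $\sigma(i_j)=i_j'$ for all $j$. In a rooted planar tree, a vertex is odd if it is at odd distance from the root, and an edge is called odd if its endpoint farther from the root is an odd vertex (so edges incident to the root are odd). Hence the number of odd edges equals the number of odd vertices. $\mathcal{W}_k(a,a+1,l,\mathbf{b})$ is a set of representatives of the equivalence classes of closed words with $2k$ steps (i.e. $2k+1$ letters), starting (and ending) at the root, on labeled rooted planar trees having $a$ edges (hence $a+1$ vertices), exactly $l$ of which are odd edges, such that the edges of the tree can be enumerated $e_1,\ldots,e_a$ so that $e_i$ is traversed (in either direction) exactly $b_i$ times by the word, for all $1\le i\le a$. *)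

(* Defs.v *)
From HB Require Import structures.
From mathcomp Require Import all_boot all_order all_algebra.
From mathcomp Require Import all_classical all_reals all_analysis.
From mathcomp Require Import perm polyrcf.

Set Implicit Arguments.
Unset Strict Implicit.
Unset Printing Implicit Defensive.

Import Order.TTheory GRing.Theory Num.Theory.
Import numFieldNormedType.Exports.

Local Open Scope classical_set_scope.
Local Open Scope ring_scope.

Definition moment (R : realType) (mu : probability (measurableTypeR R) R)
    (k : nat) : R :=
  \int[mu]_x (x ^+ k).

(* To be required alongside statements on [moment], which is a total function
   with a junk value when the integral does not exist. *)
Definition finite_moments (R : realType)
    (mu : probability (measurableTypeR R) R) : Prop :=
  forall k, mu.-integrable setT (fun x => (x ^+ k)%:E).

(* The eigenvalues, repeated according to multiplicity. When W is symmetric,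
   its characteristic polynomial splits over R and this list has n elements. *)
Definition spectrum (R : realType) (n : nat) (W : 'M[R]_n) : seq R :=
  flatten [seq nseq (mup x (char_poly W)) x | x <- rootsR (char_poly W)].

Definition spectral_measure (R : realType) (n : nat) (W : 'M[R]_n) :
    {measure set (measurableTypeR R) -> \bar R} :=
  mscale (n%:R^-1)%:nng
    (msum (fun i => \d_((spectrum W)`_i : measurableTypeR R))
          (size (spectrum W))).

Definition mutually_independent (R : realType) (d : measure_display)
    (T : measurableType d) (Pr : probability T R) (I : finType)
    (X : I -> {RV Pr >-> measurableTypeR R}) : Prop :=
  forall (J : {set I}) (B : I -> set (measurableTypeR R)),
    (forall i, measurable (B i)) ->
    Pr (\bigcap_(i in [set` J]) (X i @^-1` B i)) =
      (\prod_(i in J) Pr (X i @^-1` B i))%E.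

Definition has_law (R : realType) (d : measure_display)
    (T : measurableType d) (Pr : probability T R)
    (X : {RV Pr >-> measurableTypeR R})
    (mu : probability (measurableTypeR R) R) : Prop :=
  forall B, measurable B -> distribution Pr X B = mu B.

Definition random_matrix (R : realType) (d : measure_display)
    (T : measurableType d) (Pr : probability T R) (n m : nat)
    (X : 'I_n * 'I_m -> {RV Pr >-> measurableTypeR R}) (w : T) : 'M[R]_(n, m) :=
  \matrix_(i, j) X (i, j) w.

(* Rooted planar trees with vertices labelled in L: the children of a vertex
   are ordered. *)
Inductive ptree (L : Type) : Type := PNode of L & seq (ptree L).

Definition root_label (L : Type) (t : ptree L) : L :=
  let: PNode x _ := t in x.

Fixpoint vertices (L : Type) (t : ptree L) : seq L :=
  let: PNode x ts := t in x :: flatten [seq vertices u | u <- ts].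

(* Each edge appears once, as (parent, child), paired with the distance from
   the child to the root of the whole tree; h is the distance from that root to
   the root of the subtree t. *)
Fixpoint edges_from (L : Type) (h : nat) (t : ptree L) : seq ((L * L) * nat) :=
  let: PNode x ts := t in
  [seq ((x, root_label u), h.+1) | u <- ts]
    ++ flatten [seq edges_from h.+1 u | u <- ts].

Definition edges (L : Type) (t : ptree L) : seq (L * L) :=
  [seq e.1 | e <- edges_from 0 t].

Definition nb_odd_edges (L : Type) (t : ptree L) : nat :=
  count (fun e => odd e.2) (edges_from 0 t).

Definition adjacent (L : eqType) (t : ptree L) : rel L :=
  fun x y => ((x, y) \in edges t) || ((y, x) \in edges t).

Definition traversals (L : eqType) (w : seq L) (e : L * L) : nat :=
  count (fun s => (s == e) || (s == (e.2, e.1))) (zip w (behead w)).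

(* The labels 1, ..., a + 1 are represented by 'I_a.+1. *)
Definition is_labeling (a : nat) (t : ptree 'I_a.+1) : bool :=
  perm_eq (vertices t) (enum 'I_a.+1).

Definition word (k a : nat) : Type := (k.*2).+1.-tuple 'I_a.+1.

Definition admissible_word (k a l : nat) (b : seq nat) (w : word k a) : Prop :=
  exists t : ptree 'I_a.+1,
    [/\ is_labeling t,
        nb_odd_edges t = l,
        sorted (adjacent t) w,
        tnth w ord0 = root_label t /\ tnth w ord_max = root_label t
      & exists es : seq ('I_a.+1 * 'I_a.+1),
          perm_eq es (edges t) /\ [seq traversals w e | e <- es] = b].

Definition word_equiv (k a : nat) : rel (word k a) :=
  fun w w' => [exists s : {perm 'I_a.+1}, [forall j, s (tnth w j) == tnth w' j]].

Definition admissible_words (k a l : nat) (b : seq nat) :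
    {set (k.*2).+1.-tuple 'I_a.+1} :=
  [set w | `[< admissible_word l b w >] ]%SET.

(* One word in each class; the label set having a + 1 elements, the parameter
   "number of vertices" is not repeated. *)
Definition word_representatives (k a l : nat) (b : seq nat) :
    {set (k.*2).+1.-tuple 'I_a.+1} :=
  let D := admissible_words k a l b in
  transversal (equivalence_partition (@word_equiv k a) D) D.

Definition admissible_mult (k : nat) (b : seq nat) : bool :=
  [&& sorted geq b, all (leq 2) b & sumn b == k.*2].

(* Bounding each b_i by 2k is no restriction, as their sum is 2k. *)
Definition limit_moment (R : realType) (A : nat -> R) (alpha : R) (k : nat) :
    R :=
  \sum_(1 <= a < k.+1) \sum_(1 <= l < a.+1) alpha ^+ l *
    \sum_(b : a.-tuple 'I_(k.*2).+1 | admissible_mult k [seq val i | i <- b])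
      #|word_representatives k a l [seq val i | i <- b]|%:R *
      \prod_(i < a) A (tnth b i).

(* Main.v *)
(** Method of moments. The trace of (X X^T)^k is a sum over the closed walks of
    length 2k on the complete bipartite graph between rows and columns. After
    normalisation, a walk using a distinct edges, the edge e being traversed
    b_e times, has mean n^(-1-a) times the product of ratios converging to
    A_(b_e). A walk on p vertices can be placed in about n^r m^c ways, with
    r + c = p <= a + 1, so only the walks with p = a + 1, that is, the walks
    covering a tree, survive in the limit; there the c column vertices are the
    odd ones and bring the factor alpha^c. Dividing by (a + 1)! the sum over
    labelled words amounts to counting equivalence classes, since a word using
    all the labels has a trivial stabiliser.

    The covariance of two walks vanishes unless they share an edge, in which
    case their union is connected and one factor n is lost; hence the empirical
    moments converge in mean square. As A_k = O(gamma^k), the limit moments are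
    at most a geometric sequence times k!, so they determine a law: functions f
    integrating every polynomial equally against both laws are stable under
    multiplication by sin (s (x - a)), hence by polynomials in it, which
    approximate the indicators of half-lines. Finally a limit along an
    ultrafilter of empirical measures whose moments converge is a law with
    the limit moments; this gives both the existence of the limit law and the
    convergence of the integrals of bounded continuous functions. *)
Require Import Defs.
From HB Require Import structures.
From mathcomp Require Import all_boot all_order all_algebra all_fingroup finmap.
From mathcomp Require Import all_classical all_reals all_analysis.
From mathcomp Require Import measurable_realfun.
From mathcomp Require Import polyrcf complex spectral.
From mathcomp Require Import zify ring lra.

Set Implicit Arguments.
Unset Strict Implicit.
Unset Printing Implicit Defensive.

Import Order.TTheory GRing.Theory Num.Theory.
Import numFieldNormedType.Exports.

(* all_analysis exports another constant of that name. *)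
Local Notation adjacent := Defs.adjacent.

(** * Heights in planar trees *)

(** Trees occur only in the definition of admissible words. A walk has at most one more letter than
    it has distinct steps, with equality exactly when it covers a tree; the test [tree_word]
    therefore replaces the tree, and the same count decides which walks survive in the trace. For
    this, every step is stored with its even-position end first. In a tree this identifies the two
    directions of an edge; in the trace of a power of X X^T it is the pair (row, column) of an
    entry. The single list [links] thus serves both sides.

    On the analytic side, everything after the trace estimates concerns finite lists of reals:
    [moment_method] gives one K and one delta valid for all lists, which are then applied to the
    spectrum of each outcome. The eigenvalues are defined as roots of a polynomial, so even the
    measurability of the events has to be derived from traces. Finally, the law must be named before
    the matrices are given: it is chosen from its moment sequence alone, and the matrices only show
    that such a law exists. *)

Lemma ptree_ind_all (L : Type) (Q : ptree L -> Prop) :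
  (forall x ts, (forall u, List.In u ts -> Q u) -> Q (PNode x ts)) ->
  forall t, Q t.
Proof.
move=> H; fix IH 1; case=> x ts; apply: H.
elim: ts => [v []|u ts IHts v /= [<-|]]; [exact: IH | exact: IHts].
Qed.

Lemma eq_map_In (I T : Type) (f g : I -> T) (s : seq I) :
  (forall u, List.In u s -> f u = g u) -> map f s = map g s.
Proof.
elim: s => [|u s IH] //= H; rewrite H; last by left.
by rewrite IH // => v vs; apply: H; right.
Qed.

Lemma mem_flatten_In (I : Type) (T : eqType) (f : I -> seq T) s x :
  x \in flatten (map f s) <-> exists2 u, List.In u s & x \in f u.
Proof.
elim: s => [|u s IH] /=; first by split=> // -[].
rewrite mem_cat; split.
  case/orP=> [xu|/IH[v vs xv]]; [by exists u => //; left | by exists v => //; right].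
case=> v [<- ->//|vs xv]; apply/orP; right; apply/IH; by exists v.
Qed.

Lemma mem_map_In (I : Type) (T : eqType) (f : I -> T) s x :
  x \in map f s -> exists2 u, List.In u s & x = f u.
Proof.
elim: s => [|u s IH] //=; rewrite inE => /orP[/eqP ->|/IH[v vs ->]].
  by exists u => //; left.
by exists v => //; right.
Qed.

Lemma perm_swap_head (T : eqType) (x y : T) s : perm_eq [:: x, y & s] [:: y, x & s].
Proof. by apply/seq.permP => p /=; rewrite addnCA. Qed.

Lemma perm_cat_cons (T : eqType) (x : T) s1 s2 :
  perm_eq (s1 ++ x :: s2) (x :: s1 ++ s2).
Proof. by apply/seq.permP => p; rewrite /= !count_cat /= addnCA. Qed.

Section Heights.
Variable L : eqType.
Implicit Types (t u : ptree L) (x y : L) (h g : nat).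

Fixpoint vertices_from h t : seq (L * nat) :=
  let: PNode x ts := t in
  (x, h) :: flatten [seq vertices_from h.+1 u | u <- ts].

Lemma vertices_from_fst h t : unzip1 (vertices_from h t) = vertices t.
Proof.
elim/ptree_ind_all: t h => x ts IH h /=; congr (_ :: _).
rewrite /unzip1 map_flatten -map_comp; congr flatten.
by apply: eq_map_In => u us; rewrite /= -[RHS](IH u us h.+1).
Qed.

Lemma vertices_from_root h t : vertices_from h t = (root_label t, h) :: behead (vertices_from h t).
Proof. by case: t. Qed.

(** Every vertex but the root is the far end of exactly one edge, so edges can be counted through
    vertices. *)
Lemma edges_from_vertices h t :
  perm_eq [seq (e.1.2, e.2) | e <- edges_from h t] (behead (vertices_from h t)).
Proof.
elim/ptree_ind_all: t h => x ts IH h /=.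
rewrite map_cat -map_comp /comp /= map_flatten -map_comp.
elim: ts IH => [|u ts IHts] //= IH.
rewrite [vertices_from h.+1 u]vertices_from_root /= perm_cons perm_catCA.
apply: perm_cat; first by apply: IH; left.
by apply: IHts => v vs; apply: IH; right.
Qed.

Lemma edges_from_height h t e g : (e, g) \in edges_from h t ->
  exists2 g', g = g'.+1 & (e.1, g') \in vertices_from h t.
Proof.
elim/ptree_ind_all: t h => x ts IH h /=; rewrite mem_cat.
case/orP=> [/mem_map_In[u _ [-> ->]]|]; first by exists h; rewrite ?inE ?eqxx.
case/mem_flatten_In=> u us /(IH u us)[g' -> H]; exists g' => //.
by rewrite inE; apply/orP; right; apply/mem_flatten_In; exists u.
Qed.

(** The lists [vertices] and [vertices_from] run in parallel, so the position of a label gives its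
    distance to the root; labels outside the tree get 0. *)
Definition height t x := nth 0 (unzip2 (vertices_from 0 t)) (index x (vertices t)).

Lemma heightE t x h : uniq (vertices t) -> (x, h) \in vertices_from 0 t -> height t x = h.
Proof.
rewrite /height -(vertices_from_fst 0 t).
elim: (vertices_from 0 t) => [|[y g] s IH] //= /andP[ys us].
rewrite inE => /orP[/eqP[-> ->]|xs]; first by rewrite eqxx.
case: eqP => [yx|_]; last exact: IH.
by move: ys; rewrite yx; case/negP; apply/mapP; exists (x, h).
Qed.

Lemma height_root t : height t (root_label t) = 0.
Proof. by case: t => x ts; rewrite /height /= eqxx. Qed.

Lemma height_vertices t x : uniq (vertices t) -> x \in vertices t ->
  (x, height t x) \in vertices_from 0 t.
Proof.
move=> ut; rewrite -(vertices_from_fst 0 t) => /mapP[[y g] ys /= ->].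
by rewrite (heightE ut ys).
Qed.

Lemma edges_from_child t x y g : ((x, y), g) \in edges_from 0 t -> (y, g) \in vertices_from 0 t.
Proof.
move=> eg; have : (y, g) \in [seq (e.1.2, e.2) | e <- edges_from 0 t].
  by apply/mapP; exists ((x, y), g).
by rewrite (perm_mem (edges_from_vertices 0 t)) => /mem_behead.
Qed.

Lemma edge_height t x y : uniq (vertices t) -> (x, y) \in edges t ->
  height t y = (height t x).+1.
Proof.
move=> ut /mapP[[e g] eg /= eE]; subst e.
have [g' gE /= xg] := edges_from_height eg; rewrite (heightE ut xg) -gE.
by apply: heightE => //; exact: edges_from_child eg.
Qed.

Lemma edge_vertices t x y : (x, y) \in edges t -> (x \in vertices t) && (y \in vertices t).
Proof.
move=> /mapP[[e g] eg /= eE]; subst e.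
have [g' gE /= xg] := edges_from_height eg.
rewrite -(vertices_from_fst 0 t); apply/andP; split.
  by apply/mapP; exists (x, g').
by apply/mapP; exists (y, g) => //; exact: edges_from_child eg.
Qed.

Lemma edges_heads t : perm_eq (unzip2 (edges t)) (behead (vertices t)).
Proof.
rewrite /edges /unzip2 -map_comp -(vertices_from_fst 0 t) vertices_from_root /=.
have /(perm_map fst) := edges_from_vertices 0 t.
by rewrite -map_comp.
Qed.

Lemma size_edges t : size (edges t) = (size (vertices t)).-1.
Proof. by rewrite -size_behead -(perm_size (edges_heads t)) [RHS]size_map. Qed.

Lemma vertices_root t : vertices t = root_label t :: behead (vertices t).
Proof. by case: t. Qed.

Lemma uniq_heads t : uniq (vertices t) -> uniq (unzip2 (edges t)).
Proof. by rewrite (perm_uniq (edges_heads t)) vertices_root => /andP[]. Qed.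

Lemma uniq_edges t : uniq (vertices t) -> uniq (edges t).
Proof. by move/uniq_heads; exact: map_uniq. Qed.

Lemma edges_parent t x x' y : uniq (vertices t) ->
  (x, y) \in edges t -> (x', y) \in edges t -> x = x'.
Proof.
move/uniq_heads; elim: (edges t) => [|[p q] s IH] //= /andP[qs us].
rewrite !inE !xpair_eqE.
have nq z : (z, q) \notin s.
  by apply: contra qs => zs; apply/mapP; exists (z, q).
case: (eqVneq y q) => [->|_]; last by rewrite !andbF /=; exact: IH.
by rewrite !andbT !(negbTE (nq _)) !orbF => /eqP -> /eqP ->.
Qed.

(** Edges correspond to their far ends, and the root, left out by this correspondence, has the even
    height 0. *)
Lemma nb_odd_edgesE t : uniq (vertices t) ->
  nb_odd_edges t = count (fun x => odd (height t x)) (vertices t).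
Proof.
move=> ut; rewrite /nb_odd_edges.
have -> : count (fun e => odd e.2) (edges_from 0 t)
        = count (fun v => odd v.2) [seq (e.1.2, e.2) | e <- edges_from 0 t].
  by rewrite count_map.
rewrite (seq.permP (edges_from_vertices 0 t)).
have -> : count (fun v => odd v.2) (behead (vertices_from 0 t))
        = count (fun v => odd v.2) (vertices_from 0 t).
  by rewrite [in RHS]vertices_from_root.
rewrite -[in RHS](vertices_from_fst 0 t) count_map; apply: eq_in_count.
by move=> [x g] /(heightE ut) /= ->.
Qed.

Fixpoint add_leaf x y t : ptree L :=
  let: PNode z ts := t in
  if z == x then PNode z (PNode y [::] :: ts)
  else PNode z [seq add_leaf x y u | u <- ts].

Lemma root_add_leaf x y t : root_label (add_leaf x y t) = root_label t.
Proof. by case: t => z ts /=; case: ifP. Qed.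

Lemma add_leaf_id x y t : x \notin vertices t -> add_leaf x y t = t.
Proof.
elim/ptree_ind_all: t => z ts IH /=; rewrite inE negb_or eq_sym.
case/andP=> /negbTE -> xts; congr PNode; rewrite -[RHS]map_id; apply: eq_map_In.
move=> u us; apply: IH => //; apply: contra xts => xu.
by apply/mem_flatten_In; exists u.
Qed.

(** As the labels are distinct, [x] lies in one subtree only, and the recursive calls on the other
    ones change nothing. *)
Lemma add_leaf_perm h x y g t : uniq (vertices t) -> (x, g) \in vertices_from h t ->
  perm_eq (edges_from h (add_leaf x y t)) (((x, y), g.+1) :: edges_from h t)
  /\ perm_eq (vertices_from h (add_leaf x y t)) ((y, g.+1) :: vertices_from h t).
Proof.
elim/ptree_ind_all: t h => z ts IH h /= /andP[zts uts]; rewrite inE.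
case: (eqVneq z x) => [zx|zx].
  subst z; case/orP=> [/eqP[->]|xg] /=.
    split; first by [].
    exact: perm_swap_head.
  case/negP: zts; move/mem_flatten_In: xg => [u us xu].
  apply/mem_flatten_In; exists u => //; rewrite -(vertices_from_fst h.+1 u).
  by apply/mapP; exists (x, g).
case/orP=> [/eqP[xz]|xg]; first by rewrite xz eqxx in zx.
have E : perm_eq (flatten [seq edges_from h.+1 u | u <- [seq add_leaf x y u | u <- ts]])
           (((x, y), g.+1) :: flatten [seq edges_from h.+1 u | u <- ts])
      /\ perm_eq (flatten [seq vertices_from h.+1 u | u <- [seq add_leaf x y u | u <- ts]])
           ((y, g.+1) :: flatten [seq vertices_from h.+1 u | u <- ts]).
  elim: ts {zts} IH uts xg => [|u ts IHts] //= IH.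
  rewrite cat_uniq => /and3P[uu uuts uts]; rewrite mem_cat.
  case/boolP: ((x, g) \in vertices_from h.+1 u) => [xu _|xnu /= xts].
    have xvu : x \in vertices u.
      by rewrite -(vertices_from_fst h.+1 u); apply/mapP; exists (x, g).
    have [IH1 IH2] := IH u (or_introl erefl) h.+1 uu xu.
    have -> : [seq add_leaf x y u | u <- ts] = ts.
      rewrite -[RHS]map_id; apply: eq_map_In => v vs; apply: add_leaf_id.
      apply: contra uuts => xv; apply/hasP; exists x => //.
      by apply/mem_flatten_In; exists v.
    by split; rewrite -cat_cons perm_cat2r.
  have [|IH1 IH2] := IHts _ uts xts; first by move=> v vs; apply: IH; right.
  have -> : add_leaf x y u = u.
    apply: add_leaf_id; apply: contra uuts => xu; apply/hasP; exists x => //.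
    move/mem_flatten_In: xts => [v vs xv]; apply/mem_flatten_In; exists v => //.
    by rewrite -(vertices_from_fst h.+1 v); apply/mapP; exists (x, g).
  by split; apply: (perm_trans _ (perm_cat_cons _ _ _)); rewrite perm_cat2l.
case: E => E1 E2 /=; split; last first.
  by apply: (perm_trans _ (perm_swap_head _ _ _)); rewrite perm_cons.
rewrite -map_comp (@eq_map _ _ _ (fun u => ((z, root_label u), h.+1))); last first.
  by move=> u; rewrite /= root_add_leaf.
by apply: (perm_trans _ (perm_cat_cons _ _ _)); rewrite perm_cat2l.
Qed.

End Heights.

(** * Walks and the edges they use *)

Section Links.
Variable L : eqType.
Implicit Types (x y : L) (s w : seq L) (b : bool) (e : L * L) (es : seq (L * L)).

(* Each step is recorded with its even-position end first; b is the parity of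
   the position of x. *)
Fixpoint steps b x s : seq (L * L) :=
  if s is y :: s' then (if b then (y, x) else (x, y)) :: steps (~~ b) y s' else [::].

Definition links w := if w is x :: s then steps false x s else [::].

Lemma size_steps b x s : size (steps b x s) = size s.
Proof. by elim: s b x => //= y s IH b x; rewrite IH. Qed.

Lemma size_links w : size (links w) = (size w).-1.
Proof. by case: w => //= x s; rewrite size_steps. Qed.

Lemma steps_cat b x s1 s2 :
  steps b x (s1 ++ s2) = steps b x s1 ++ steps (b (+) odd (size s1)) (last x s1) s2.
Proof.
elim: s1 b x => [|y s1 IH] b x /=; first by rewrite addbF.
by rewrite IH; case: b; case: (odd _).
Qed.

Lemma steps_rcons b x s y : steps b x (rcons s y) =
  rcons (steps b x s) (if b (+) odd (size s) then (y, last x s) else (last x s, y)).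
Proof. by rewrite -cats1 steps_cat /= cats1. Qed.

Lemma traversals_links w e : traversals w e
  = count (fun p => (p == e) || (p == (e.2, e.1))) (links w).
Proof.
case: w => [|x s] //; rewrite /traversals /=.
elim: s false x => [|y s IH] b x //=; rewrite (IH (~~ b)); congr addn.
case: e {IH} => e1 e2; case: b => //=; rewrite !xpair_eqE.
by do 4!case: (_ == _).
Qed.

Definition ends es : seq L := unzip1 es ++ unzip2 es.

Lemma mem_ends es x : (x \in ends es) = has (fun e => (x == e.1) || (x == e.2)) es.
Proof.
rewrite mem_cat; elim: es => [|e es IH] //=; rewrite !inE -IH.
by rewrite orbACA.
Qed.

Lemma ends_steps b x s y :
  (y == x) || (y \in ends (steps b x s)) = (y \in x :: s).
Proof.
rewrite mem_ends in_cons; elim: s b x => [|z s IH] b x; first by rewrite orbF.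
have := IH (~~ b) z; rewrite in_cons /= => <-.
by case: b => /=; case: (y == x); case: (y == z).
Qed.

Lemma mem_links w y : 1 < size w -> (y \in ends (links w)) = (y \in w).
Proof.
case: w => [|x [|z s]] // _; rewrite -(ends_steps false) /links mem_ends /=.
by case: (y == x).
Qed.

(* The edges of es can be added one at a time to the vertex set S, each one
   having an end among the vertices already present. *)
Fixpoint attached (S : seq L) es : bool :=
  if es is e :: es' then
    ((e.1 \in S) || (e.2 \in S)) && attached (e.1 :: e.2 :: S) es'
  else true.

Lemma attached_sub (S S' : seq L) es : {subset S <= S'} -> attached S es -> attached S' es.
Proof.
elim: es S S' => [|e es IH] S S' sSS' //= /andP[H1 H2]; apply/andP; split.
  by case/orP: H1 => /sSS' ->; rewrite ?orbT.
apply: IH H2 => z; rewrite !inE => /or3P[->|->|/sSS' ->] //; rewrite ?orbT //.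
Qed.

Lemma attached_steps b x s : attached [:: x] (steps b x s).
Proof.
elim: s b x => [|y s IH] b x //=; apply/andP; split.
  by case: b; rewrite /= !inE eqxx ?orbT.
apply: attached_sub (IH (~~ b) y) => z; rewrite inE => /eqP ->.
by case: b; rewrite /= !inE eqxx ?orbT.
Qed.

Lemma attached_cat S es1 es2 :
  attached S (es1 ++ es2) = attached S es1 && attached (ends es1 ++ S) es2.
Proof.
elim: es1 S => [|e es1 IH] S //=; rewrite IH andbA; congr andb.
apply/idP/idP; apply: attached_sub => z;
  rewrite !(mem_cat, inE); do !case: (_ \in _) => //=; do !case: (_ == _) => //=.
Qed.

Lemma size_undup_eq_mem (T : eqType) (s1 s2 : seq T) : s1 =i s2 ->
  size (undup s1) = size (undup s2).
Proof.
move=> H; apply/eqP; rewrite -uniq_size_uniq ?undup_uniq //.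
by move=> z; rewrite !mem_undup H.
Qed.

Lemma size_undup_cons (T : eqType) (z : T) (s : seq T) :
  size (undup (z :: s)) = (z \notin s) + size (undup s).
Proof. by rewrite /=; case: (z \in s). Qed.

Lemma size_undup_sub (T : eqType) (s1 s2 : seq T) : {subset s1 <= s2} ->
  size (undup s1) <= size (undup s2).
Proof.
by move=> H; apply: uniq_leq_size (undup_uniq _) _ => z; rewrite !mem_undup; exact: H.
Qed.

(* A new edge brings at most one new vertex. *)
Lemma attached_count S es E0 : attached S es ->
  (forall e, e \in E0 -> (e.1 \in S) && (e.2 \in S)) ->
  size (undup (ends es ++ S)) + size (undup E0) <= size (undup S) + size (undup (es ++ E0)).
Proof.
elim: es S E0 => [|e es IH] S E0; first by [].
case/andP=> eS at' E0S; have {IH} := IH [:: e.1, e.2 & S] (e :: E0) at'.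
have -> : size (undup (ends es ++ [:: e.1, e.2 & S])) = size (undup (ends (e :: es) ++ S)).
  apply: size_undup_eq_mem => z; rewrite mem_cat mem_ends mem_cat mem_ends !in_cons /=.
  by case: (has _ _); case: (z \in S); case: (z == e.1); case: (z == e.2).
have -> : size (undup (es ++ e :: E0)) = size (undup (e :: es ++ E0)).
  apply: size_undup_eq_mem => z; rewrite mem_cat !in_cons mem_cat.
  by case: (z \in es); case: (z \in E0); case: (z == e).
rewrite cat_cons (size_undup_cons e E0) => H.
have {}H : size (undup (ends (e :: es) ++ S)) + ((e \notin E0) + size (undup E0)) <=
    size (undup [:: e.1, e.2 & S]) + size (undup (e :: es ++ E0)).
  apply: H => e'; rewrite in_cons => /orP[/eqP ->|/E0S /andP[H1 H2]].
    by rewrite !in_cons !eqxx !orbT.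
  by rewrite !in_cons H1 H2 !orbT.
suff : size (undup [:: e.1, e.2 & S]) <= (e \notin E0) + size (undup S) by lia.
case: (boolP (e \in E0)) => [/E0S/andP[H1 H2]|_].
  by rewrite !size_undup_cons !in_cons H1 H2 orbT.
rewrite !size_undup_cons in_cons; case/orP: eS => ->; rewrite ?orbT //=.
  by case: (_ \notin _); lia.
by case: (_ || _); lia.
Qed.

(** The steps of a walk, taken in order, are attached to its first letter: this is the bound on the
    vertices of a connected graph by its edges. *)
Lemma size_letters x s : size (undup (x :: s)) <= (size (undup (links (x :: s)))).+1.
Proof.
have := attached_count (attached_steps false x s) (E0 := [::]).
rewrite cats0 addn0 /= => H; apply: leq_trans (H _) => //.
rewrite -/(size (undup (x :: s))) -/(undup (x :: s)); apply: size_undup_sub => z.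
by rewrite -(ends_steps false) mem_cat mem_seq1 orbC.
Qed.

End Links.

Lemma links_map (L L' : eqType) (f : L -> L') w :
  links (map f w) = map (fun e => (f e.1, f e.2)) (links w).
Proof.
case: w => //= x s; elim: s false x => //= y s IH b x; rewrite IH.
by case: b.
Qed.

(** * Closed words covering a tree *)

Lemma eq_size_filter_undup (T : eqType) (Q : pred T) (s s' : seq T) : uniq s ->
  (forall x, (x \in s') = (x \in s) && Q x) -> size (undup s') = count Q s.
Proof.
move=> us H; rewrite -size_filter -(undup_id (filter_uniq Q us)).
by apply: size_undup_eq_mem => x; rewrite mem_filter H andbC.
Qed.

Section TreeWords.
Variables (L : eqType) (t : ptree L).
Hypothesis ut : uniq (vertices t).
Implicit Types (x y : L) (s : seq L).

(** A walk from the root is at even height at even positions, so [links] records an edge in this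
    order whichever way it is crossed, and distinct links count edges of the tree. *)
Definition orient (e : L * L) := if odd (height t e.1) then (e.2, e.1) else e.

Lemma adjacent_height x y : adjacent t x y ->
  height t y = (height t x).+1 \/ height t x = (height t y).+1.
Proof. by case/orP=> /(edge_height ut); [left | right]. Qed.

Lemma adjacent_odd x y : adjacent t x y -> odd (height t y) = ~~ odd (height t x).
Proof. by case/adjacent_height => ->; rewrite /= ?negbK. Qed.

Lemma steps_parity x s e : path (adjacent t) x s ->
  e \in steps (odd (height t x)) x s ->
  [/\ ~~ odd (height t e.1), odd (height t e.2) & adjacent t e.1 e.2].
Proof.
elim: s x => [|y s IH] x //= /andP[xy ys]; rewrite in_cons.
case/orP=> [/eqP ->|].
  have := adjacent_odd xy; case: ifP => /= [ox|/negbT ox] oy.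
    by rewrite ox oy /=; split => //; rewrite /adjacent orbC.
  by rewrite oy ox.
by rewrite -(adjacent_odd xy); exact: IH.
Qed.

(** [d] holds for the steps away from the root, which raise the height by one, the others lowering
    it by one. On a closed walk the two kinds are thus equally many. *)
Lemma path_balance y u : path (adjacent t) y u ->
  let d := fun y z => (y, z) \in edges t in
  height t y + count id (pairmap d y u) = height t (last y u) + count negb (pairmap d y u).
Proof.
move=> + d; elim: u y => [|z u IH] y //= /andP[yz zu]; have := IH z zu.
case: (boolP (d y z)) => [e|ne] /=.
  by rewrite (edge_height ut e); lia.
case/orP: yz => [e|e]; first by rewrite /d e in ne.
by rewrite (edge_height ut e); lia.
Qed.

Variables (x : L) (s : seq L).
Hypotheses (rx : root_label t = x) (xs : path (adjacent t) x s).
Let w := x :: s.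

Lemma links_parity e : e \in links w ->
  [/\ ~~ odd (height t e.1), odd (height t e.2) & adjacent t e.1 e.2].
Proof.
by move=> ew; apply: (steps_parity xs); rewrite -rx height_root rx.
Qed.

Lemma orient_edgeP e e' : e \in edges t -> e' \in links w ->
  (e' == orient e) = (e' == e) || (e' == (e.2, e.1)).
Proof.
case: e e' => p q [p' q'] epq /links_parity[/= ep oq _].
have := edge_height ut epq; rewrite /orient /= => hq.
case: ifP => op; apply/idP/idP.
- by move=> ->; rewrite orbT.
- case/orP=> // /eqP[pp qq]; by rewrite pp op in ep.
- by move=> ->.
- case/orP=> // /eqP[pp qq]; move: ep; by rewrite pp hq /= op.
Qed.

Lemma orient_mem e : e \in links w -> exists2 e', e' \in edges t & e = orient e'.
Proof.
move=> ew; have [p1 p2 /orP[H|H]] := links_parity ew.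
  by exists e; rewrite /orient ?(negbTE p1) //; case: (e) H.
by exists (e.2, e.1) => //; rewrite /orient /= p2; case: (e).
Qed.

Lemma orient_inj : {in edges t &, injective orient}.
Proof.
move=> [p q] [p' q'] e e'; rewrite /orient /=.
have h := edge_height ut e; have h' := edge_height ut e'.
case: ifP => op; case: ifP => op' [].
- by move=> -> ->.
- by move=> qp pq; move: h h'; rewrite qp pq => -> /eqP; rewrite -addn2 -[X in X == _]addn0 eqn_add2l.
- by move=> qp pq; move: h h'; rewrite qp pq => -> /eqP; rewrite -addn2 -[X in X == _]addn0 eqn_add2l.
- by move=> -> ->.
Qed.

Lemma traversals_orient e : e \in edges t -> traversals w e = count_mem (orient e) (links w).
Proof.
move=> et; rewrite traversals_links; apply: eq_in_count => e' e'w /=.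
by rewrite orient_edgeP.
Qed.

Hypothesis trav : forall e, e \in edges t -> 0 < traversals w e.

(** Once every edge is crossed, the edges of the tree can be read off the word alone. *)
Lemma perm_orient : perm_eq (map orient (edges t)) (undup (links w)).
Proof.
apply: uniq_perm; rewrite ?undup_uniq //.
  by rewrite map_inj_in_uniq ?uniq_edges //; exact: orient_inj.
move=> e; rewrite mem_undup; apply/idP/idP.
  case/mapP=> e' e't ->; have := trav e't.
  by rewrite traversals_orient // -has_count has_pred1.
by case/orient_mem => e' e't ->; apply: map_f.
Qed.

Lemma size_tree_links : size (undup (links w)) = (size (vertices t)).-1.
Proof. by rewrite -(perm_size perm_orient) size_map size_edges. Qed.

Lemma perm_traversals : perm_eq [seq traversals w e | e <- edges t]
  [seq count_mem e (links w) | e <- undup (links w)].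
Proof.
apply: perm_trans (perm_map _ perm_orient); rewrite -[X in perm_eq _ X]map_comp.
suff /eq_in_map -> : {in edges t, traversals w =1
  (fun e => count_mem e (links w)) \o orient} by [].
by move=> e et /=; rewrite traversals_orient.
Qed.

Lemma mem_tree_word y : (y \in w) = (y \in vertices t).
Proof.
apply/idP/idP.
  rewrite -(ends_steps false) mem_ends => /orP[/eqP ->|/hasP[e]].
    by rewrite vertices_root rx in_cons eqxx.
  move/(links_parity)=> [_ _]; case/orP=> /edge_vertices /andP[H1 H2] /orP[] /eqP -> //.
rewrite vertices_root in_cons => /orP[/eqP ->|]; first by rewrite rx /w in_cons eqxx.
rewrite -(perm_mem (edges_heads t)) => /mapP[e et ->].
have := trav et; rewrite traversals_links -has_count => /hasP[e' e'w].
rewrite -(ends_steps false) mem_ends => H; apply/orP; right; apply/hasP; exists e' => //.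
by case/orP: H => /eqP -> /=; rewrite eqxx ?orbT.
Qed.

(** The second components of the links are the letters at odd positions, hence the vertices at odd
    height. *)
Lemma odd_letters_tree : nb_odd_edges t = size (undup (unzip2 (links w))).
Proof.
rewrite nb_odd_edgesE //; apply/esym; apply: eq_size_filter_undup => // y.
apply/idP/idP.
  case/mapP=> e ew ->; have [_ -> /orP[]/edge_vertices/andP[H1 H2]] := links_parity ew.
    by rewrite H2.
  by rewrite H1.
case/andP; rewrite -mem_tree_word -(ends_steps false) => yw oy.
have : y \in ends (links w).
  case/orP: yw => // /eqP yx; move: oy; by rewrite yx -rx height_root.
rewrite mem_cat => /orP[/mapP[e /links_parity[eo _ _] yE]|//].
by rewrite -yE oy in eo.
Qed.

Lemma disjoint_letters y : y \in unzip1 (links w) -> y \notin unzip2 (links w).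
Proof.
move=> /mapP[e /links_parity[H _ _] ->]; apply: contra H.
by move=> /mapP[e' /links_parity[_ H _] ->].
Qed.

End TreeWords.

Section BuildTree.
Variable L : eqType.

(** The converse of [size_tree_links]. Letters are added one at a time: under the equality, a letter
    seen before comes through a link seen before, and a new letter is hung as a leaf below the
    preceding one. *)
Lemma build_tree (x : L) (s : seq L) :
  (size (undup (links (x :: s)))).+1 = size (undup (x :: s)) ->
  exists t : ptree L, [/\ root_label t = x, uniq (vertices t), vertices t =i x :: s,
    path (adjacent t) x s
    & forall e, e \in edges t -> 0 < traversals (x :: s) e].
Proof.
elim/last_ind: s => [|s y IH] H.
  by exists (PNode x [::]); split => // z; rewrite /= inE.
set e := if false (+) odd (size s) then (y, last x s) else (last x s, y).
have lE : links (x :: rcons s y) = rcons (links (x :: s)) e by rewrite /= steps_rcons.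
have travE e' : traversals (x :: rcons s y) e' =
    traversals (x :: s) e' + ((e == e') || (e == (e'.2, e'.1))).
  by rewrite !traversals_links lE -cats1 count_cat /= addn0.
have E1 : size (undup (links (x :: rcons s y))) =
    (e \notin links (x :: s)) + size (undup (links (x :: s))).
  rewrite lE -size_undup_cons; apply: size_undup_eq_mem => z.
  by rewrite mem_rcons.
have E2 : size (undup (x :: rcons s y)) = (y \notin x :: s) + size (undup (x :: s)).
  rewrite -size_undup_cons; apply: size_undup_eq_mem => z.
  by rewrite -rcons_cons mem_rcons.
have Hle := size_letters x s.
have ye : e \in links (x :: s) -> y \in x :: s.
  move=> ew; rewrite -(ends_steps false) mem_ends; apply/orP; right.
  by apply/hasP; exists e => //; rewrite /e; case: ifP => _ /=; rewrite eqxx ?orbT.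
(* The equality passes to the prefix: by [size_letters], a new link without a new letter would break
   it. *)
have Hs : (size (undup (links (x :: s)))).+1 = size (undup (x :: s)).
  move: H Hle; rewrite E1 E2.
  move: (size (undup (links _))) (size (undup (x :: s))) => p q.
  by case: (boolP (e \in _)) => [/ye -> |_]; case: (y \notin x :: s); lia.
have lxs : last x s \in x :: s by exact: mem_last.
have [t [tr tu tv tp tt]] := IH Hs.
case: (boolP (y \in x :: s)) => yw.
  have ew : e \in links (x :: s).
    by move: H; rewrite E1 E2 yw -Hs; case: (e \in _) => //; lia.
  exists t; split => //.
  - by move=> z; rewrite tv -rcons_cons mem_rcons [in RHS]in_cons; case: eqP => // ->.
  - rewrite rcons_path tp /=; have [_ _] := links_parity tu tr tp ew.
    by rewrite /e; case: ifP => _ //=; rewrite /adjacent orbC.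
  - by move=> e' /tt H'; rewrite travE ltn_addr.
have yt : y \notin vertices t by rewrite tv.
have lt : last x s \in vertices t by rewrite tv.
have [He Hv] := add_leaf_perm y tu (height_vertices tu lt).
have Hv' : perm_eq (vertices (add_leaf (last x s) y t)) (y :: vertices t).
  by have := perm_map fst Hv; rewrite /= -!/(unzip1 _) !vertices_from_fst.
have He' : perm_eq (edges (add_leaf (last x s) y t)) ((last x s, y) :: edges t).
  by have := perm_map fst He.
exists (add_leaf (last x s) y t); split.
- by rewrite root_add_leaf.
- by rewrite (perm_uniq Hv') /= yt tu.
- move=> z; rewrite (perm_mem Hv') in_cons tv -rcons_cons mem_rcons in_cons.
  by [].
- rewrite rcons_path; apply/andP; split.
    apply: sub_path tp => p q; rewrite /adjacent !(perm_mem He') !in_cons.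
    by case/orP=> ->; rewrite !orbT.
  by rewrite /adjacent (perm_mem He') in_cons eqxx.
- move=> e'; rewrite (perm_mem He') in_cons travE => /orP[/eqP ->|/tt H']; last exact: ltn_addr.
  by rewrite /e; case: ifP => _ /=; rewrite !eqxx ?orbT addn1.
Qed.

End BuildTree.

Section TreeWord.
Variables k a : nat.
Implicit Types (w : word k a) (l : nat) (b : seq nat).

Definition multiplicities (L : eqType) (w : seq L) : seq nat :=
  [seq count_mem e (links w) | e <- undup (links w)].

Definition odd_letters (L : eqType) (w : seq L) : nat := size (undup (unzip2 (links w))).

Definition closed_word (L : eqType) (w : seq L) : bool :=
  if w is x :: s then last x s == x else false.

(** The case of equality in [size_letters], all labels being used; it stands for the existence of a
    tree in [admissible_word]. *)
Definition tree_word w : bool :=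
  [&& closed_word w, size (undup w) == a.+1 & size (undup (links w)) == a].

Lemma word_tnth w x s : tval w = x :: s -> tnth w ord0 = x /\ tnth w ord_max = last x s.
Proof.
move=> wE; have sz := size_tuple w; rewrite wE /= in sz; case: sz => sz.
by rewrite !(tnth_nth x) wE /=; split => //; rewrite -sz -[RHS](nth_last x (x :: s)).
Qed.

Lemma vertices_labeling (t : ptree 'I_a.+1) :
  is_labeling t -> uniq (vertices t) /\ (forall x, x \in vertices t).
Proof.
move=> H; split; first by rewrite (perm_uniq H) enum_uniq.
by move=> x; rewrite (perm_mem H) mem_enum.
Qed.

Lemma closed_wordP w x s : tval w = x :: s -> closed_word w = (tnth w ord_max == x).
Proof. by move=> wE; have [_ ->] := word_tnth wE; rewrite wE. Qed.

Lemma perm_map_ex (T T' : eqType) (f : T -> T') (s : seq T) (b : seq T') :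
  perm_eq b (map f s) -> exists es, perm_eq es s /\ map f es = b.
Proof.
case: s => [|x0 s].
  by move/perm_nilP => ->; exists [::].
move=> H; have /(perm_iotaP (f x0)) := H; rewrite size_map => -[I HI bE].
exists [seq nth x0 (x0 :: s) i | i <- I]; split.
  by apply/(perm_iotaP x0); exists I.
rewrite bE -map_comp; apply/eq_in_map => i iI.
by apply/esym/nth_map; move: iI; rewrite (perm_mem HI) mem_iota.
Qed.

(** Eliminates the tree. The enumeration of the edges along which [b] is read becomes a permutation
    of the multiplicities; the positive entries of [b] say that every edge is crossed, so that the
    word determines the edges. *)
Lemma admissible_wordP l b w : all (leq 1) b ->
  admissible_word l b w <->
  [/\ tree_word w, odd_letters w = l & perm_eq b (multiplicities w)].
Proof.
move=> b1; case wE : (tval w) => [|x s].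
  by have := size_tuple w; rewrite wE.
have [w0 wl] := word_tnth wE.
split.
  case=> t [lt lE ad [r0 rl] [es [pes tes]]].
  have [ut vt] := vertices_labeling lt.
  have rx : root_label t = x by rewrite -w0 r0.
  have px : path (adjacent t) x s by move: ad; rewrite wE.
  have tr e : e \in edges t -> 0 < traversals (x :: s) e.
    rewrite -(perm_mem pes) => ee; have /allP := b1; apply.
    by rewrite -tes wE; apply: map_f.
  split.
  - apply/and3P; split.
    + by rewrite (closed_wordP wE) rl rx.
    + rewrite wE (@size_undup_eq_mem _ _ (vertices t)); last exact: mem_tree_word.
      by rewrite (undup_id ut) (perm_size lt) size_enum_ord.
    + rewrite wE (size_tree_links ut rx px tr) (perm_size lt).
      by rewrite size_enum_ord.
  - by rewrite /odd_letters ?wE -(odd_letters_tree ut rx px tr).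
  - rewrite /multiplicities ?wE -tes wE.
    exact: perm_trans (perm_map _ pes) (perm_traversals ut rx px tr).
case=> /and3P[cw sw lw] ol pb.
have [|t [rt ut vt pt tt]] := @build_tree _ x s.
  by move: sw lw; rewrite wE => /eqP -> /eqP ->.
exists t; split.
- apply: uniq_perm; rewrite ?enum_uniq // => z; rewrite mem_enum inE vt.
  have /eqP sz := sw; rewrite wE in sz.
  have H1 : {subset undup (x :: s) <= enum 'I_a.+1} by move=> y; rewrite mem_enum.
  have [|_ H2] := uniq_min_size (undup_uniq (x :: s)) H1; first by rewrite size_enum_ord sz.
  by rewrite -mem_undup H2 mem_enum.
- by rewrite -ol /odd_letters ?wE (odd_letters_tree ut rt pt tt).
- by rewrite wE.
- by rewrite w0 wl rt; move: cw; rewrite wE /= => /eqP ->.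
have pb' : perm_eq b [seq traversals (x :: s) e | e <- edges t].
  apply: perm_trans pb _; rewrite perm_sym /multiplicities ?wE.
  exact: (perm_traversals ut rt pt tt).
have [es [p1 p2]] := perm_map_ex pb'.
by exists es; rewrite wE.
Qed.

Lemma multiplicities_gt0 w : all (leq 1) (multiplicities w).
Proof.
apply/allP => c /mapP[e ew ->]; rewrite -has_count has_pred1.
by rewrite mem_undup in ew.
Qed.

Lemma sumn_count_undup (T : eqType) (s : seq T) :
  sumn [seq count_mem e s | e <- undup s] = size s.
Proof.
rewrite -sum1_size sumnE big_map.
rewrite -[RHS](perm_big _ (perm_count_undup s)) /=.
rewrite big_flatten big_map; apply: eq_bigr => e _.
by rewrite big_nseq iter_addn_0 mul1n.
Qed.

Lemma sumn_multiplicities w : sumn (multiplicities w) = k.*2.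
Proof. by rewrite sumn_count_undup size_links size_tuple. Qed.

End TreeWord.

Section Representatives.
Variables k a : nat.
Implicit Types (w : word k a) (s : {perm 'I_a.+1}).

Lemma word_equivP w w' :
  reflect (exists s, w' = map_tuple s w) (word_equiv w w').
Proof.
apply: (iffP existsP) => -[s H]; exists s.
  by apply: eq_from_tnth => j; rewrite tnth_map; apply/esym/eqP; exact: (forallP H).
by apply/forallP => j; rewrite H tnth_map.
Qed.

Lemma word_equiv_equivalence : equivalence_rel (@word_equiv k a).
Proof.
have refl w : word_equiv w w.
  by apply/existsP; exists 1%g; apply/forallP => j; rewrite perm1.
have sym w w' : word_equiv w w' -> word_equiv w' w.
  case/existsP=> s /forallP H; apply/existsP; exists s^-1%g; apply/forallP => j.
  by rewrite -(eqP (H j)) permK.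
have trans w1 w2 w3 : word_equiv w1 w2 -> word_equiv w2 w3 -> word_equiv w1 w3.
  case/existsP=> s /forallP H; case/existsP=> s' /forallP H'; apply/existsP; exists (s * s')%g.
  by apply/forallP => j; rewrite permM (eqP (H j)).
move=> w1 w2 w3; split => // E; apply/idP/idP; first by apply: trans; exact: sym.
exact: trans.
Qed.

Lemma all_letters w : size (undup w) = a.+1 -> forall x, x \in tval w.
Proof.
move=> sw x; have H1 : {subset undup w <= enum 'I_a.+1} by move=> y; rewrite mem_enum.
have [|_ H2] := uniq_min_size (undup_uniq w) H1; first by rewrite size_enum_ord sw.
by rewrite -mem_undup H2 mem_enum.
Qed.

(* A word using all the labels is fixed by no nontrivial permutation of them. *)
Lemma card_representatives (D : {set (k.*2).+1.-tuple 'I_a.+1}) :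
  (forall w, w \in D -> size (undup w) = a.+1) ->
  (forall w s, w \in D -> map_tuple s w \in D) ->
  #|transversal (equivalence_partition (@word_equiv k a) D) D| * (a.+1)`! = #|D|.
Proof.
move=> Dsurj Dclosed.
have eqR : {in D & &, equivalence_rel (@word_equiv k a)}.
  by move=> w1 w2 w3 _ _ _; exact: word_equiv_equivalence.
have part := equivalence_partitionP eqR.
rewrite (card_transversal (transversalP part)).
rewrite -(card_uniform_partition _ part) // => A.
case/imsetP => w wD ->.
have -> : [set y in D | word_equiv w y] =
    [set map_tuple s w | s : {perm 'I_a.+1}].
  apply/setP => y; rewrite inE; apply/andP/imsetP.
    by case=> _ /word_equivP[s ->]; exists s.
  by case=> s _ ->; split; [exact: Dclosed | apply/word_equivP; exists s].
rewrite card_imset.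
  exact: card_Sn.
move=> s s' /(congr1 val) /= /eq_in_map H; apply/permP => x; apply: H.
by apply: all_letters; exact: Dsurj.
Qed.

End Representatives.

Section CountTreeWords.
Variables k a : nat.

(** A step away from the root, coded [true], has its new label supplied by [ls]; a step to the
    parent, coded [false], consumes no label. *)
Fixpoint decode (L : Type) (parent : L -> L) (x : L) (bs : seq bool) (ls : seq L) : seq L :=
  if bs is b :: bs' then
    if b then (if ls is l :: ls' then l :: decode parent l bs' ls' else [::])
    else parent x :: decode parent (parent x) bs' ls
  else [::].

Lemma decode_path (L : eqType) (t : ptree L) (parent : L -> L) (x : L) s :
  (forall y z, (y, z) \in edges t -> parent z = y) ->
  path (adjacent t) x s ->
  let bs := pairmap (fun y z => (y, z) \in edges t) x s in
  decode parent x bs (mask bs s) = s.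
Proof.
move=> Hp /=; elim: s x => [|y s IH] x //= /andP[xy ys].
case: (boolP ((x, y) \in edges t)) => [e|ne]; first by rewrite /= IH.
have yx : parent x = y by apply: Hp; case/orP: xy => // e; rewrite e in ne.
by rewrite /= yx IH.
Qed.

(* A closed walk goes down the tree at half of its steps, and is determined by
   the parent map, the up-down pattern and the labels reached going down. *)
Lemma tree_word_code (w : word k a) : tree_word w ->
  exists c : 'I_a.+1 * {ffun 'I_a.+1 -> 'I_a.+1} * (k.*2).-tuple bool * k.-tuple 'I_a.+1,
    tval w = c.1.1.1 :: decode c.1.1.2 c.1.1.1 c.1.2 c.2.
Proof.
move=> wt; case wE : (tval w) => [|x s]; first by have := size_tuple w; rewrite wE.
have sz : size s = k.*2 by have := size_tuple w; rewrite wE /= => -[].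
case/and3P: wt; rewrite wE => cw /eqP sw /eqP lw.
have [|t [rt ut vt pt tt]] := @build_tree _ x s; first by rewrite sw lw.
pose bs := pairmap (fun y z => (y, z) \in edges t) x s.
have szb : size bs == k.*2 by rewrite size_pairmap sz.
have szl : size (mask bs s) == k.
  rewrite size_mask ?size_pairmap //.
  have /= := path_balance ut pt; rewrite -/bs (eqP (cw : last x s == x)) => /eqP.
  rewrite eqn_add2l => /eqP H; have := count_predC id bs.
  rewrite (eqP szb) (@eq_count _ (predC id) negb) // -H addnn => /double_inj ->.
  by [].
pose parent := [ffun z => odflt z [pick y | (y, z) \in edges t]].
have Hp y z : (y, z) \in edges t -> parent z = y.
  move=> e; rewrite ffunE; case: pickP => [y' e'|/(_ y)]; last by rewrite e.
  exact: edges_parent ut e' e.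
by exists (x, parent, Tuple szb, Tuple szl); rewrite /= (decode_path Hp pt).
Qed.

(** The factors count the first letters, parent maps, up-down patterns and labels reached going
    down. Having k such labels and not 2k keeps the limit moments within a geometric factor of k!,
    the growth that determinacy uses. *)
Lemma card_tree_words :
  #|[set w : (k.*2).+1.-tuple 'I_a.+1 | tree_word w]|
    <= a.+1 * a.+1 ^ a.+1 * 2 ^ k.*2 * a.+1 ^ k.
Proof.
pose C := ('I_a.+1 * {ffun 'I_a.+1 -> 'I_a.+1} * (k.*2).-tuple bool * k.-tuple 'I_a.+1)%type.
pose f (c : C) := c.1.1.1 :: decode c.1.1.2 c.1.1.1 c.1.2 c.2.
have -> : a.+1 * a.+1 ^ a.+1 * 2 ^ k.*2 * a.+1 ^ k = #|{: C}|.
  by rewrite !card_prod card_ffun !card_tuple card_ord card_bool.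
pose g (c : C) := odflt [tuple of nseq (k.*2).+1 ord0] (insub (f c)).
apply: leq_trans (leq_image_card g {: C}).
apply: subset_leq_card; apply/fintype.subsetP => w; rewrite inE => /tree_word_code[c cE].
by apply/fintype.imageP; exists c => //; rewrite /g -[f c]cE valK.
Qed.

End CountTreeWords.

Local Open Scope classical_set_scope.
Local Open Scope ring_scope.

(** * The limit moments as sums over labelled words *)

Lemma odd_letters_bounds k a (w : word k a) : (0 < k)%N -> tree_word w ->
  (0 < odd_letters w <= a)%N.
Proof.
move=> k0 tw.
have [|_ ] := @admissible_wordP k a (odd_letters w) (multiplicities w) w.
  exact: multiplicities_gt0.
case=> // t [lt nE _ _ _]; apply/andP; split; last first.
  rewrite -nE /nb_odd_edges (leq_trans (count_size _ _)) //.
  have [ut _] := vertices_labeling lt.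
  by rewrite -(size_map fst) -/(edges t) size_edges (perm_size lt) size_enum_ord.
have : (0 < size (unzip2 (links w)))%N by rewrite size_map size_links size_tuple /= double_gt0.
rewrite /odd_letters; case: (unzip2 _) => [|x s] // _.
by rewrite -has_predT; apply/hasP; exists x; rewrite // mem_undup mem_head.
Qed.

Lemma closed_word_map (L L' : eqType) (f : L -> L') (w : seq L) : injective f ->
  closed_word (map f w) = closed_word w.
Proof. by move=> fi; case: w => //= x s; rewrite last_map inj_eq. Qed.

Lemma multiplicities_map (L L' : eqType) (f : L -> L') (w : seq L) : injective f ->
  multiplicities (map f w) = multiplicities w.
Proof.
move=> fi; rewrite /multiplicities links_map.
have gi : injective (fun e : L * L => (f e.1, f e.2)).
  by move=> [x y] [x' y'] /= [/fi -> /fi ->].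
rewrite undup_map_inj // -map_comp; apply/eq_in_map => e _ /=.
by rewrite count_map; apply: eq_count => e' /=; rewrite (inj_eq gi).
Qed.

Lemma odd_letters_map (L L' : eqType) (f : L -> L') (w : seq L) : injective f ->
  odd_letters (map f w) = odd_letters w.
Proof.
move=> fi; rewrite /odd_letters links_map /unzip2 -map_comp.
rewrite (_ : map _ _ = map f (unzip2 (links w))); last by rewrite -map_comp.
by rewrite undup_map_inj // size_map.
Qed.

Lemma tree_word_map k a (s : {perm 'I_a.+1}) (w : word k a) :
  tree_word (map_tuple s w : word k a) = tree_word w.
Proof.
rewrite /tree_word /= (closed_word_map _ (@perm_inj _ s)).
rewrite (undup_map_inj (@perm_inj _ s)) size_map links_map undup_map_inj ?size_map //.
by move=> [x y] [x' y'] /= [/perm_inj -> /perm_inj ->].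
Qed.

Lemma mem_admissible_words k a l b (w : word k a) : all (leq 1) b ->
  (w \in admissible_words k a l b) =
  [&& tree_word w, odd_letters w == l & perm_eq b (multiplicities w)].
Proof.
move=> b1; rewrite inE; apply/asboolP/and3P => [/(admissible_wordP _ _ b1)|].
  by case=> -> -> ->.
by case=> H1 /eqP H2 H3; apply/(admissible_wordP _ _ b1).
Qed.

Lemma card_word_representatives k a l b : all (leq 1) b ->
  (#|word_representatives k a l b| * (a.+1)`! = #|admissible_words k a l b|)%N.
Proof.
move=> b1; apply: card_representatives => [w|w s]; rewrite !mem_admissible_words //.
  by case/and3P=> /and3P[_ /eqP].
by rewrite tree_word_map /= odd_letters_map ?multiplicities_map //; exact: perm_inj.
Qed.

Section LimitMoment.
Variable R : realType.
Implicit Types (A : nat -> R) (alpha : R) (k a : nat).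

(** Only one non-increasing [b] rearranges the multiplicities, namely their sort. If some edge is
    crossed once there is none, the entries of [b] being at least 2, but then the right-hand side
    contains the factor [A 1], which is 0. *)
Lemma sum_admissible_mult (A : nat -> R) k a (w : word k a) : A 1%N = 0 -> tree_word w ->
  \sum_(b : a.-tuple 'I_(k.*2).+1 | admissible_mult k [seq val i | i <- b])
     (perm_eq [seq val i | i <- b] (multiplicities w))%:R * \prod_(i < a) A (tnth b i)
  = \prod_(c <- multiplicities w) A c.
Proof.
move=> A1 tw; set m := multiplicities w.
have prodE (b : a.-tuple 'I_(k.*2).+1) : \prod_(i < a) A (tnth b i) =
    \prod_(c <- [seq val i | i <- b]) A c.
  by rewrite big_map big_tuple.
case: (boolP (all (leq 2) m)) => [m2|]; last first.
  case/allPn=> c cm c2; rewrite (big_rem c) //= (_ : c = 1%N) ?A1 ?mul0r; last first.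
    have := allP (multiplicities_gt0 w) c cm; move: c2; lia.
  apply: big1 => b /and3P[_ b2 _].
  case: (boolP (perm_eq _ _)) => [pb|_]; last by rewrite mul0r.
  by move: c2; rewrite -(perm_mem pb) in cm; rewrite (allP b2 c cm).
have sm : size m = a by move: tw => /and3P[_ _ /eqP]; rewrite size_map.
have mk : all (fun c => (c < (k.*2).+1)%N) m.
  apply/allP => c cm; rewrite ltnS -(sumn_multiplicities w).
  by rewrite (perm_sumn (perm_to_rem cm)) /= leq_addr.
have sz : size [seq inord c : 'I_(k.*2).+1 | c <- sort geq m] == a.
  by rewrite size_map size_sort sm.
have bE : [seq val i | i <- Tuple sz] = sort geq m.
  rewrite /= -map_comp -[RHS]map_id; apply/eq_in_map => c.
  by rewrite mem_sort => cm /=; rewrite inordK //; exact: (allP mk).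
rewrite (bigD1 (Tuple sz)) /=; last first.
  rewrite /admissible_mult bE; apply/and3P; split.
  - by apply: sort_sorted => x y; rewrite /geq /= leq_total.
  - by rewrite all_sort.
  - by rewrite (perm_sumn (permEl (perm_sort _ _))) sumn_multiplicities.
rewrite prodE bE perm_sort perm_refl mul1r (perm_big _ (permEl (perm_sort geq m))).
rewrite [X in _ + X]big1 ?addr0 // => b /andP[/and3P[sb _ _] bne].
case: (boolP (perm_eq _ _)) => [pb|_]; last by rewrite mul0r.
case/negP: bne; apply/eqP/val_inj/(inj_map val_inj); rewrite [RHS]bE.
apply: (@sorted_eq _ geq) => //.
- by move=> x y z /= H1 H2; exact: leq_trans H2 H1.
- by move=> x y; rewrite /geq /= => /anti_leq.
- by apply: sort_sorted => x y; rewrite /geq /= leq_total.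
- by apply: perm_trans pb _; rewrite perm_sym perm_sort.
Qed.

(** The form in which the moments come out of the trace expansion. Grouping the labelled words by
    odd letters and multiplicities recovers the sums over [l] and [b]. *)
Lemma limit_momentE A alpha k : (0 < k)%N -> A 1%N = 0 ->
  limit_moment A alpha k = \sum_(1 <= a < k.+1) ((a.+1)`!%:R)^-1 *
    \sum_(w : (k.*2).+1.-tuple 'I_a.+1 | tree_word w)
       alpha ^+ odd_letters w * \prod_(c <- multiplicities w) A c.
Proof.
move=> k0 A1; apply: eq_bigr => a _; rewrite mulr_sumr.
have f0 : (a.+1)`!%:R != 0 :> R by rewrite pnatr_eq0 -lt0n fact_gt0.
transitivity (\sum_(1 <= l < a.+1)
   \sum_(w : (k.*2).+1.-tuple 'I_a.+1 | tree_word w)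
     ((a.+1)`!%:R)^-1 * ((odd_letters w == l)%:R * alpha ^+ l *
   \sum_(b : a.-tuple 'I_(k.*2).+1 | admissible_mult k [seq val i | i <- b])
     (perm_eq [seq val i | i <- b] (multiplicities w))%:R * \prod_(i < a) A (tnth b i))).
  apply: eq_bigr => l _; under [RHS]eq_bigr do rewrite mulr_sumr mulr_sumr.
  rewrite exchange_big /= mulr_sumr; apply: eq_bigr => b bk.
  have b1 : all (leq 1) [seq val i | i <- b].
    by case/and3P: bk => _ b2 _; apply: sub_all b2 => x /=; exact: ltnW.
  have -> : #|word_representatives k a l [seq val i | i <- b]|%:R =
      ((a.+1)`!%:R)^-1 * #|admissible_words k a l [seq val i | i <- b]|%:R :> R.
    by rewrite -card_word_representatives // natrM mulrC mulfK.
  set q := \prod_(i < a) _; set D := admissible_words _ _ _ _.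
  transitivity (\sum_(w in D) ((a.+1)`!%:R)^-1 * (alpha ^+ l * q)).
    by rewrite sumr_const -mulr_natr; ring.
  rewrite big_mkcond [in RHS]big_mkcond; apply: eq_bigr => w _.
  rewrite mem_admissible_words //; case: (tree_word w) => //=.
  by case: eqP => /= _; case: (perm_eq _ _) => /=; rewrite ?mul0r ?mulr0 // !mul1r.
rewrite exchange_big /=; apply: eq_bigr => w tw.
rewrite -mulr_sumr; congr (_ * _).
rewrite (eq_bigr (fun l => (odd_letters w == l)%:R * alpha ^+ l *
  \prod_(c <- multiplicities w) A c)); last first.
  by move=> l _; congr (_ * _); exact: sum_admissible_mult.
rewrite -mulr_suml; congr (_ * _).
have /andP[h1 h2] := odd_letters_bounds k0 tw.
rewrite (bigD1_seq (odd_letters w)) ?mem_index_iota ?iota_uniq ?h1 ?ltnS //=.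
rewrite eqxx mul1r big1 ?addr0 // => l; rewrite eq_sym => /negbTE ->.
by rewrite mul0r.
Qed.

End LimitMoment.

(** * Growth of the limit moments *)

Lemma expn_le_ffact m n : (m ^ n <= (m + n) ^_ n)%N.
Proof.
elim: n => [|n IH]; first by rewrite expn0 ffactn0.
rewrite expnS addnS ffactSS leq_mul //; by lia.
Qed.

Lemma bin_le_exp2 m n : ('C(m, n) <= 2 ^ m)%N.
Proof.
case: (leqP n m) => nm; last by rewrite bin_small.
rewrite -[2%N]/(1 + 1)%N expnDn.
rewrite (bigD1 (Ordinal (nm : (n < m.+1)%N))) //= !exp1n !muln1.
exact: leq_addr.
Qed.

(** The falling product 2n (2n-1) ... (n+1) is at least n^n and equals C(2n, n) n!, where C(2n, n)
    <= 4^n. *)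
Lemma expnn_le_fact n : (n ^ n <= 4 ^ n * n`!)%N.
Proof.
apply: leq_trans (expn_le_ffact n n) _.
rewrite -bin_ffact leq_mul2r (_ : 4 = 2 ^ 2)%N // -expnM.
by apply/orP; right; rewrite mul2n addnn; exact: bin_le_exp2.
Qed.

Section Growth.
Variable R : realType.
Implicit Types (A : nat -> R) (alpha gamma : R) (k a : nat).

Lemma prod_multiplicities_le A C0 gamma k a (w : word k a) : 1 <= C0 -> 0 < gamma ->
  (forall c, (0 < c)%N -> `|A c| <= C0 * gamma ^+ c) ->
  `|\prod_(c <- multiplicities w) A c| <=
    C0 ^+ size (multiplicities w) * gamma ^+ k.*2.
Proof.
move=> C1 g0 HA; rewrite -[in gamma ^+ _](sumn_multiplicities w).
elim: (multiplicities w) (multiplicities_gt0 w) => [|c m IH] /=.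
  by rewrite big_nil normr1 !expr0 mulr1.
case/andP=> c0 m0; rewrite big_cons normrM exprS exprD mulrACA.
by apply: ler_pM => //; [exact: HA | exact: IH].
Qed.

(** The constant 64 = 2 * 4 * 4 * 2 collects the bounds 2^(k+1) of a + 1, 4^(k+1) (a+1)! of
    (a+1)^(a+1), and 4^(k+1) 2^(k+1) k! of (a+1)^k; the factor 4^k counts the up-down patterns. *)
Lemma card_tree_words_le k a : (0 < a <= k)%N ->
  #|[set w : (k.*2).+1.-tuple 'I_a.+1 | tree_word w]%SET|%:R / (a.+1)`!%:R
    <= (2 * 64 ^ k.+1 * 4 ^ k)%N%:R * k`!%:R :> R.
Proof.
case/andP=> a0 ak; rewrite ler_pdivrMr ?ltr0n ?fact_gt0 // -!natrM ler_nat.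
apply: leq_trans (card_tree_words k a) _.
have H1 : (a.+1 <= 2 ^ k.+1)%N by apply: leq_trans (ltn_expl _ (ltnSn 1)); rewrite ltnS; lia.
have H2 : (a.+1 ^ a.+1 <= 4 ^ k.+1 * (a.+1)`!)%N.
  by apply: leq_trans (expnn_le_fact _) _; rewrite leq_mul2r leq_pexp2l ?orbT.
have H3 : (a.+1 ^ k <= 4 ^ k.+1 * 2 ^ k.+1 * k`!)%N.
  apply: (@leq_trans (k.+1 ^ k.+1)%N).
    by apply: (@leq_trans (k.+1 ^ k)%N); rewrite ?leq_exp2r ?leq_pexp2l ?leqnSn //; lia.
  apply: leq_trans (expnn_le_fact _) _.
  rewrite -mulnA leq_mul2l factS leq_mul2r; apply/orP; right; apply/orP; right.
  exact/ltnW/ltn_expl.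
rewrite -[(k.*2)%N]mul2n expnM (_ : 2 ^ 2 = 4)%N //.
have -> : (2 * 64 ^ k.+1 * 4 ^ k * k`! * (a.+1)`! = 2 ^ k.+1 * (4 ^ k.+1 * (a.+1)`!) * (4 ^ k) *
   (4 ^ k.+1 * 2 ^ k.+1 * k`!) * 2)%N.
  rewrite (_ : 64 = 2 * 4 * 4 * 2)%N // !expnMn; by ring.
apply: leq_trans (leq_pmulr _ _) => //.
by rewrite !leq_mul.
Qed.

Lemma limit_moment_growth A alpha gamma C0 : 0 < alpha -> 0 < gamma -> 1 <= C0 ->
  A 1%N = 0 -> (forall c, (0 < c)%N -> `|A c| <= C0 * gamma ^+ c) ->
  exists C : R, 0 < C /\
    forall k, (0 < k)%N -> `|limit_moment A alpha k| <= 128 * C ^+ k * k`!%:R.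
Proof.
move=> al0 g0 C1 A1 HA; pose K := Num.max 1 alpha * C0 * gamma ^+ 2.
have M1 : 1 <= Num.max 1 alpha by rewrite le_max lexx.
have C00 : 0 < C0 := lt_le_trans ltr01 C1.
have K0 : 0 < K by rewrite !mulr_gt0 ?exprn_gt0 //; exact: lt_le_trans ltr01 M1.
(* K^k bounds the contribution of one word, 64 and 4 come from the count of words, and 2 from k <=
   2^k, k being the number of values of a. *)
exists (2 * 64 * 4 * K); split; first by rewrite mulr_gt0 // !mulr_gt0 // ltr0n.
move=> k k0; rewrite limit_momentE //.
have bw a (w : word k a) : (0 < a <= k)%N -> tree_word w ->
    `|alpha ^+ odd_letters w * \prod_(c <- multiplicities w) A c| <= K ^+ k.
  case/andP=> a0 ak tw; have /andP[h1 h2] := odd_letters_bounds k0 tw.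
  have sm : size (multiplicities w) = a by move: tw => /and3P[_ _ /eqP]; rewrite size_map.
  rewrite normrM /K 2!exprMn -exprM mul2n; apply: (@le_trans _ _
    (Num.max 1 alpha ^+ k * (C0 ^+ size (multiplicities w) * gamma ^+ k.*2))).
    apply: ler_pM => //; last exact: prod_multiplicities_le.
    rewrite ger0_norm; last by rewrite exprn_ge0 // ltW.
    apply: (@le_trans _ _ (Num.max 1 alpha ^+ odd_letters w)).
      by apply: lerXn2r; rewrite ?nnegrE ?le_max ?lexx ?orbT ?ler01 // ltW.
    by rewrite ler_weXn2l // (leq_trans h2).
  rewrite -mulrA ler_pM2l ?exprn_gt0 ?(lt_le_trans ltr01 M1) //.
  by rewrite ler_pM2r ?exprn_gt0 // ler_weXn2l // sm.
apply: le_trans (ler_norm_sum _ _ _) _.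
apply: (@le_trans _ _ (\sum_(1 <= a < k.+1) ((2 * 64 ^ k.+1 * 4 ^ k)%N%:R * k`!%:R * K ^+ k))).
  rewrite big_nat [leRHS]big_nat; apply: ler_sum => a /andP[a1 ak].
  have ak' : (0 < a <= k)%N by rewrite a1.
  rewrite normrM ger0_norm ?invr_ge0 ?ler0n //.
  apply: (@le_trans _ _ (((a.+1)`!%:R)^-1 *
     (#|[set w : (k.*2).+1.-tuple 'I_a.+1 | tree_word w]%SET|%:R * K ^+ k))).
    rewrite ler_pM2l ?invr_gt0 ?ltr0n ?fact_gt0 //.
    apply: le_trans (ler_norm_sum _ _ _) _.
    rewrite mulr_natl -sumr_const big_mkcond [leRHS]big_mkcond; apply: ler_sum => w _.
    by rewrite inE; case: ifP => // tw; exact: bw.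
  rewrite mulrA ler_pM2r ?exprn_gt0 // mulrC; exact: card_tree_words_le.
rewrite sumr_const_nat subSS subn0 -[leLHS]mulr_natr.
have kk : k%:R <= 2 ^+ k :> R by rewrite -natrX ler_nat ltnW // ltn_expl.
clear bw; clearbody K.
rewrite !natrM !natrX exprS 3!exprMn.
set p := 2 ^+ k in kk *; set q := 64 ^+ k; set r := 4 ^+ k; set s := K ^+ k; set u := k`!%:R.
rewrite [leRHS](_ : _ = 2 * (64 * q) * r * u * s * p); last by ring.
by rewrite ler_wpM2l // !mulr_ge0 ?exprn_ge0 // ltW.
Qed.

End Growth.

(** * Determinacy of the moment problem *)

Lemma cvg_EFinR (R : realType) (I : Type) (F : set_system I) (f : I -> R) (a : R) :
  Filter F -> f x @[x --> F] --> a -> (f x)%:E @[x --> F] --> a%:E.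
Proof. by move=> FF fa; apply: cvg_EFin => //; apply: nearW. Qed.

Section RintegralLimits.
Context d (T : measurableType d) (R : realType).

Lemma fine_probability_setT (P : probability T R) : fine (P setT) = 1.
Proof. by rewrite -[RHS]/(fine 1%:E); congr fine; exact: probability_setT. Qed.

Lemma fatou_bound (mu : {measure set T -> \bar R}) (f_ : nat -> T -> R) (f : T -> R) (M : R) :
  (forall n, measurable_fun setT (f_ n)) -> (forall n x, 0 <= f_ n x) ->
  (forall x, f_ n x @[n --> \oo] --> f x) ->
  (forall n, (\int[mu]_x (f_ n x)%:E <= M%:E)%E) -> (\int[mu]_x (f x)%:E <= M%:E)%E.
Proof.
move=> mf f0 fcv fM.
have mf' n : measurable_fun setT (EFin \o f_ n) by exact/measurable_EFinP.
have f0' n x : setT x -> (0 <= (f_ n x)%:E)%E by rewrite lee_fin.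
have := @fatou _ _ _ mu setT measurableT (fun n x => (f_ n x)%:E) mf' f0'.
have -> : (fun x => limn_einf (fun n => (f_ n x)%:E)) = (fun x => (f x)%:E).
  apply/funext => x; have fx : (f_ n x)%:E @[n --> \oo] --> (f x)%:E.
    exact: cvg_EFinR.
  by rewrite is_cvg_limn_einfE; [ exact: (cvg_lim _ fx) | apply/cvg_ex; exists (f x)%:E].
move=> H; apply: le_trans H _.
have H2 : (limn_esup (fun n => \int[mu]_x (f_ n x)%:E) <= M%:E)%E.
  rewrite limn_esup_lim; apply: lime_le; first exact: is_cvg_esups.
  by apply: nearW => n; apply: ge_ereal_sup => _ [m _ <-]; exact: fM.
exact: le_trans (limn_einf_sup _) H2.
Qed.

Lemma Rintegral_dct (mu : {measure set T -> \bar R}) (f_ : nat -> T -> R) (f g : T -> R) :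
  (forall n, measurable_fun setT (f_ n)) -> (forall x, f_ n x @[n --> \oo] --> f x) ->
  mu.-integrable setT (EFin \o g) -> (forall n x, `|f_ n x| <= g x) ->
  \int[mu]_x f_ n x @[n --> \oo] --> \int[mu]_x f x.
Proof.
move=> mf fcv ig fg.
have mfl : measurable_fun setT f by apply: measurable_fun_cvg mf _ => x _; exact: fcv.
have [|||||fi _ H] := @dominated_convergence _ _ _ mu setT measurableT
   (fun n x => (f_ n x)%:E) (EFin \o f) (EFin \o g).
- by move=> n; exact/measurable_EFinP.
- exact/measurable_EFinP.
- by apply: aeW => x _; exact: cvg_EFinR.
- exact: ig.
- by apply: aeW => x n _; rewrite lee_fin.
apply: fine_cvg; rewrite /Rintegral fineK //.
exact: integrable_fin_num.
Qed.

Lemma bounded_integrable (P : probability T R) (f : T -> R) (M : R) :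
  measurable_fun setT f -> (forall x, `|f x| <= M) -> P.-integrable setT (EFin \o f).
Proof.
move=> mf fM; apply: measurable_bounded_integrable => //.
  by rewrite ltey_eq fin_num_measure.
exists M; split; first exact: num_real.
by move=> N MN x _; apply: le_trans (fM x) (ltW MN).
Qed.

Lemma le_integrableR (mu : {measure set T -> \bar R}) (f g : T -> R) :
  measurable_fun setT f -> (forall x, `|f x| <= g x) ->
  mu.-integrable setT (EFin \o g) -> mu.-integrable setT (EFin \o f).
Proof.
move=> mf fg; apply: le_integrable => //; first exact/measurable_EFinP.
by move=> x _; rewrite /= lee_fin (le_trans (fg x)) // ler_norm.
Qed.

Lemma Rintegral_sum (mu : {measure set T -> \bar R}) (I : Type) (s : seq I) (f : I -> T -> R) :
  (forall i, mu.-integrable setT (EFin \o f i)) ->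
  mu.-integrable setT (EFin \o (fun x => \sum_(i <- s) f i x)) /\
  \int[mu]_x (\sum_(i <- s) f i x) = \sum_(i <- s) \int[mu]_x f i x.
Proof.
move=> fi; elim: s => [|i s [IH1 IH2]].
  rewrite (_ : (fun x => _) = cst 0); last by apply/funext => x; rewrite big_nil.
  split; first exact: integrable0.
  by rewrite big_nil Rintegral_cst // mul0r.
rewrite (_ : (fun x => _) = (fun x => f i x + \sum_(i <- s) f i x)); last first.
  by apply/funext => x; rewrite big_cons.
split; last by rewrite RintegralD // big_cons IH2.
exact: (integrableD measurableT (fi i) IH1).
Qed.

End RintegralLimits.

Section Determinacy.
Variable R : realType.
Local Notation mR := (measurableTypeR R).

Lemma expR_ge_Xn (y : R) n : 0 <= y -> y ^+ n / n`!%:R <= expR y.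
Proof.
case: n => [|n] y0; first by rewrite expr0 divr1 -expR0 ler_expR.
by apply: le_trans (expR_ge1Dxn n y0); rewrite lerDr.
Qed.

(** Uniform in n, hence a dominating function when the Taylor polynomials of the sine are
    integrated. *)
Lemma norm_series_sin_coeff (y : R) n : `|series (sin_coeff y) n| <= expR `|y|.
Proof.
apply: le_trans (_ : series (exp_coeff `|y|) n <= _).
  apply: le_trans (ler_norm_sum _ _ _) _; apply: ler_sum => i _.
  rewrite /exp_coeff /sin_coeff /= !normrM normfV !normr_nat !normrX normrN normr1 expr1n mulr1.
  by case: odd; [rewrite mul1r| rewrite !mul0r divr_ge0].
apply: nondecreasing_cvgn_le; last exact: is_cvg_series_exp_coeff.
by apply: nondecreasing_series => i _ _; exact: exp_coeff_ge0.
Qed.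

Definition sin_poly n : {poly R} :=
  \sum_(0 <= i < n) ((odd i)%:R * (-1) ^+ i.-1./2 / i`!%:R) *: 'X^i.

Lemma sin_polyE n y : (sin_poly n).[y] = series (sin_coeff y) n.
Proof.
rewrite /sin_poly horner_sum; apply: eq_bigr => i _.
by rewrite hornerZ hornerXn /sin_coeff /= mulrAC.
Qed.

Lemma cvg_sin_poly y : (sin_poly n).[y] @[n --> \oo] --> sin y.
Proof.
under eq_fun do rewrite sin_polyE; rewrite unlock.
exact: is_cvg_series_sin_coeff.
Qed.

Lemma horner_le_expR (q : {poly R}) (s : R) : 0 < s ->
  exists2 K, 0 <= K & forall x, `|q.[x]| <= K * expR (s * `|x|).
Proof.
move=> s0; exists (\sum_(i < size q) `|q`_i| * (i`!%:R / s ^+ i)).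
  by apply: sumr_ge0 => i _; rewrite mulr_ge0 // divr_ge0 ?exprn_ge0 // ltW.
move=> x; rewrite horner_coef mulr_suml; apply: le_trans (ler_norm_sum _ _ _) _.
apply: ler_sum => i _; rewrite normrM -mulrA ler_wpM2l // normrX.
have H := @expR_ge_Xn (s * `|x|) i (mulr_ge0 (ltW s0) (normr_ge0 x)).
apply: le_trans (_ : i`!%:R / s ^+ i * ((s * `|x|) ^+ i / i`!%:R) <= _).
  rewrite exprMn le_eqVlt; apply/orP; left; apply/eqP; field.
  by rewrite pnatr_eq0 -lt0n fact_gt0 /= expf_neq0 // gt_eqF.
by rewrite ler_wpM2l // divr_ge0 ?exprn_ge0 // ltW.
Qed.

Lemma measurable_horner (q : {poly R}) : measurable_fun setT (horner q : mR -> mR).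
Proof. by apply: continuous_measurable_fun; exact: continuous_horner. Qed.

(** The partial sums of the series of e^(sx) + e^(-sx) have even powers only, so they are
    nonnegative. As s C <= 1/2, their integrals stay below a geometric sum, and Fatou's lemma passes
    to the limit, which dominates e^(s|x|). *)
Lemma exp_integrable (mu : probability mR R) (B C s : R) :
  finite_moments mu -> 0 <= B -> 0 <= C -> 0 <= s -> s * C <= 2^-1 ->
  (forall k, moment mu k <= B * C ^+ k * k`!%:R) ->
  mu.-integrable setT (EFin \o (fun x => expR (s * `|x|))).
Proof.
move=> fm B0 C0 s0 sC HB.
have me (c : R) : measurable_fun setT (fun x : mR => expR (c * x)).
  by apply: measurableT_comp; [exact: measurable_expR | exact: mulrl_measurable].
pose c i : R := (1 + (-1) ^+ i) * s ^+ i / i`!%:R.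
have c0 i : 0 <= c i.
  rewrite /c -mulrA mulr_ge0 ?divr_ge0 ?exprn_ge0 //.
  by rewrite -signr_odd; case: odd; rewrite ?expr1 ?expr0 ?subrr // addr_ge0.
have c2 i : c i * moment mu i <= 2 * B * 2^-1 ^+ i.
  apply: le_trans (_ : c i * (B * C ^+ i * i`!%:R) <= _); first by rewrite ler_wpM2l.
  have -> : c i * (B * C ^+ i * i`!%:R) = (1 + (-1) ^+ i) * (B * (s * C) ^+ i).
    rewrite /c exprMn; field; by rewrite pnatr_eq0 -lt0n fact_gt0.
  rewrite -mulrA; apply: ler_pM.
  - by rewrite -signr_odd; case: odd; rewrite ?expr1 ?expr0 ?subrr // addr_ge0.
  - by rewrite mulr_ge0 // exprn_ge0 // mulr_ge0.
  - by rewrite -signr_odd; case: odd; rewrite ?expr1 ?expr0 ?subrr // lexx.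
  - by rewrite ler_wpM2l // lerXn2r // nnegrE ?mulr_ge0 // invr_ge0.
pose f_ n (x : mR) := \sum_(0 <= i < n) c i * x ^+ i.
have ci i : mu.-integrable setT (EFin \o (fun x : mR => c i * x ^+ i)).
  have -> : EFin \o (fun x : mR => c i * x ^+ i) = (fun x => (c i)%:E * (x ^+ i)%:E)%E.
    by apply/funext => x; rewrite /= EFinM.
  exact: integrableZl (fm i).
have fE n x : f_ n x = series (exp_coeff (s * x)) n + series (exp_coeff (- (s * x))) n.
  rewrite /f_ /series /= -big_split; apply: eq_bigr => i _.
  by rewrite /exp_coeff /= /c (exprNn (s * x)) exprMn; ring.
have f0 n x : 0 <= f_ n x.
  apply: sumr_ge0 => i _; rewrite /c -signr_odd.
  case: (boolP (odd i)) => oi; first by rewrite expr1 subrr !mul0r.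
  apply: mulr_ge0; last by rewrite exprn_even_ge0.
  by rewrite expr0 divr_ge0 // mulr_ge0 ?addr_ge0 ?exprn_ge0.
have H : (\int[mu]_x (expR (s * x) + expR (- (s * x)))%:E <= (4 * B)%:E)%E.
  apply: (@fatou_bound _ _ _ mu f_ _ (4 * B)) => //.
  - by move=> n; apply: measurable_sum => i; apply: measurable_funM.
  - move=> x; under eq_fun do rewrite fE.
    exact: (cvgD (is_cvg_series_exp_coeff _) (is_cvg_series_exp_coeff _)).
  - move=> n; have [i1 i2] := Rintegral_sum (index_iota 0 n) ci.
    rewrite -[leLHS]fineK; last exact: integrable_fin_num.
    rewrite lee_fin [leLHS]i2.
    apply: le_trans (_ : \sum_(0 <= i < n) 2 * B * 2^-1 ^+ i <= _).
      apply: ler_sum => i _; rewrite RintegralZl //; [exact: c2 | exact: fm].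
    rewrite -mulr_sumr big_mkord (_ : 4 * B = 2 * B * 2); last by ring.
    have := subrX1 (2^-1 : R) n; set S := \sum_(i < n) _ => HS.
    have pn : 0 <= (2^-1 : R) ^+ n by rewrite exprn_ge0 // invr_ge0.
    have S2 : S <= 2 by lra.
    by rewrite ler_wpM2l // mulr_ge0.
apply: (@le_integrableR _ _ _ mu _ (fun x => expR (s * x) + expR (- (s * x)))).
- apply: measurableT_comp; first exact: measurable_expR.
  apply: measurable_funM => //; exact: measurableT_comp.
- move=> x; rewrite ger0_norm ?expR_ge0 //.
  by case: (ger0P x) => _; rewrite ?mulrN ?lerDl ?lerDr expR_ge0.
apply/integrableP; split.
  apply/measurable_EFinP; apply: measurable_funD; first exact: me.
  by under eq_fun do rewrite -mulNr; exact: me.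
apply: le_lt_trans (ltry (4 * B)); apply: le_trans H.
rewrite le_eqVlt; apply/orP; left; apply/eqP; apply: eq_integral => x _.
by rewrite gee0_abs // lee_fin addr_ge0 ?expR_ge0.
Qed.

End Determinacy.

Lemma probability_rays_unique (R : realType) (mu nu : probability (measurableTypeR R) R) :
  (forall a, mu `]a, +oo[%classic = nu `]a, +oo[%classic) ->
  forall B, measurable B -> nu B = mu B.
Proof.
move=> H B mB.
have mG : measurable = <<s @RGenOInfty.G R >> :> set (set (measurableTypeR R)).
  exact: RGenOInfty.measurableE.
have GI : setI_closed (@RGenOInfty.G R).
  move=> _ _ [x ->] [y ->]; exists (Num.max x y); apply/seteqP; split => z /=;
    rewrite !in_itv /= !andbT gt_max; first by case=> -> ->.
  by case/andP.
have Gg (k : nat) : @RGenOInfty.G R `](- k%:R), +oo[%classic by exists (- k%:R).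
have cover : \bigcup_(k : nat) `](- k%:R : R), +oo[%classic = setT.
  apply/seteqP; split => // x _; exists (Num.truncn `|x|).+1 => //=.
  rewrite in_itv /= andbT ltrNl; apply: le_lt_trans (ler_norm _) _.
  by rewrite normrN; exact: truncnS_gt.
apply: (@measure_unique _ R (measurableTypeR R) _ _ mG GI Gg cover nu mu) => //.
- by move=> _ [x ->]; exact/esym/H.
- by move=> k; rewrite ltey_eq fin_num_measure.
Qed.

(** * Polynomials converging to a step *)

Section PowerStep.
Variable R : realType.
Implicit Types (u v : R) (n : nat).

Lemma bernoulli_le (x : R) n : 0 <= x <= 1 -> 1 - n%:R * x <= (1 - x) ^+ n.
Proof.
case/andP=> x0 x1; elim: n => [|n IH]; first by rewrite mul0r subr0.
rewrite exprS; apply: le_trans (_ : (1 - x) * (1 - n%:R * x) <= _).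
  rewrite -natr1; have : 0 <= n%:R * (x * x) by rewrite !mulr_ge0.
  by lra.
by rewrite ler_wpM2l // subr_ge0.
Qed.

Lemma bernoulli_ge (x : R) n : 0 <= x -> 1 + n%:R * x <= (1 + x) ^+ n.
Proof.
move=> x0; elim: n => [|n IH]; first by rewrite mul0r addr0.
rewrite exprS; apply: le_trans (_ : (1 + x) * (1 + n%:R * x) <= _).
  rewrite -natr1; have : 0 <= n%:R * (x * x) by rewrite !mulr_ge0.
  by lra.
by rewrite ler_wpM2l // addr_ge0.
Qed.

(* The Brosowski-Deutsch polynomials: on [0, 1] they approach the indicator of
   v < 1/2. *)
Definition power_step n v : R := (1 - v ^+ n) ^+ (2 ^ n).

Lemma power_step_bounds n v : 0 <= v <= 1 -> 0 <= power_step n v <= 1.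
Proof.
case/andP=> v0 v1; have /andP[p0 p1] : 0 <= v ^+ n <= 1 by rewrite exprn_ge0 //= exprn_ile1.
by rewrite /power_step exprn_ge0 ?subr_ge0 //= exprn_ile1 // ?subr_ge0 // gerBl.
Qed.

(** Bernoulli's inequality bounds it below by 1 - 2^n v^n. *)
Lemma power_step_lt v : 0 <= v < 2^-1 -> power_step n v @[n --> \oo] --> (1 : R).
Proof.
case/andP=> v0 v2.
apply: (@squeeze_cvgr _ _ _ _ (fun n => 1 - (2 * v) ^+ n) (fun=> 1)).
- apply: nearW => n; have v1 : v <= 1 by lra.
  have [|_ ->] := andP (@power_step_bounds n v _); first by rewrite v0.
  rewrite andbT exprMn -natrX; apply: bernoulli_le.
  by rewrite exprn_ge0 //= exprn_ile1.
- rewrite -[X in _ --> X]subr0; apply: cvgB; first exact: cvg_cst.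
  by apply: cvg_expr; rewrite ger0_norm ?mulr_ge0 //; lra.
- exact: cvg_cst.
Qed.

(** The product with (1 + v^n)^(2^n), which is at least (2v)^n by Bernoulli, is (1 - v^(2n))^(2^n),
    at most 1. *)
Lemma power_step_gt v : 2^-1 < v <= 1 -> power_step n v @[n --> \oo] --> (0 : R).
Proof.
case/andP=> v2 v1; have v0 : 0 < v by lra.
apply: (@squeeze_cvgr _ _ _ _ (fun=> 0) (fun n => ((2 * v)^-1) ^+ n)).
- apply: nearW => n.
  have [|-> _] := andP (@power_step_bounds n v _); first by rewrite (ltW v0).
  rewrite /= exprVn -div1r ler_pdivlMr ?exprn_gt0 ?mulr_gt0 //.
  apply: le_trans (_ : power_step n v * (1 + v ^+ n) ^+ (2 ^ n) <= _).
    rewrite ler_wpM2l //.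
      by have [|-> _] := andP (@power_step_bounds n v _); first by rewrite (ltW v0).
    apply: le_trans (bernoulli_ge _ _); last by rewrite exprn_ge0 // ltW.
    by rewrite exprMn natrX lerDr.
  rewrite /power_step -exprMn -subr_sqr expr1n exprn_ile1 //.
    by rewrite subr_ge0 exprn_ile1 ?exprn_ge0 ?exprn_ile1 // ltW.
  by rewrite gerBl exprn_ge0 // exprn_ge0 // ltW.
- exact: cvg_cst.
- apply: cvg_expr; rewrite ger0_norm ?invr_ge0 ?mulr_ge0 ?(ltW v0) //.
  by rewrite invf_lt1 ?mulr_gt0 //; lra.
Qed.

(** The sequence increases since (1 - p/2)^2 >= 1 - p. Its limit is kept as an unspecified value [c]
    at the jump, which a later shift of the jump removes. *)
Lemma power_step_half : exists c : R, 0 <= c <= 1 /\ power_step n 2^-1 @[n --> \oo] --> c.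
Proof.
have bd n : 0 <= power_step n 2^-1 <= 1 by apply: power_step_bounds; lra.
have nd : nondecreasing_seq (fun n => power_step n 2^-1).
  apply/nondecreasing_seqP => n; rewrite /power_step expnS exprM.
  have /andP[p0 p1] : 0 <= (2^-1 : R) ^+ n <= 1 by rewrite exprn_ge0 //= exprn_ile1 //; lra.
  rewrite lerXn2r // ?nnegrE ?subr_ge0 // ?sqr_ge0 // (exprS (2^-1 : R) n) expr2.
  move: (2^-1 ^+ n : R) p0 p1 => p p0 p1; have : 0 <= p * p by rewrite mulr_ge0.
  by lra.
have ub : has_ubound (range (fun n => power_step n 2^-1)).
  by exists 1 => _ [n _ <-]; have /andP[] := bd n.
have cv := nondecreasing_cvgn nd ub.
exists (sup (range (fun n => power_step n 2^-1))); split => //.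
apply/andP; split.
  apply: le_trans (_ : power_step 0 2^-1 <= _); first by have /andP[] := bd 0.
  by apply: ub_le_sup => //; exists 0.
by apply: ge_sup; [exists (power_step 0 2^-1); exists 0 | move=> _ [n _ <-]; have /andP[] := bd n].
Qed.

Definition half_step (c y : R) : R := if 0 < y then 1 else if y == 0 then c else 0.

Lemma power_step_cvg c u : power_step n 2^-1 @[n --> \oo] --> c -> -1 <= u <= 1 ->
  power_step n ((1 - u) / 2) @[n --> \oo] --> half_step c u.
Proof.
move=> cc /andP[u1 u2]; rewrite /half_step; case: (ltrgt0P u) => u0.
- by apply: power_step_lt; lra.
- by apply: power_step_gt; lra.
- by rewrite u0 subr0 div1r.
Qed.

(** For n large the argument lies between -pi and pi, where the sine has the sign of its argument.
    This undoes the periodicity. *)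
Lemma half_step_sin_cvg c y s : 0 < s ->
  half_step c (sin (s / n.+1%:R * y)) @[n --> \oo] --> half_step c y.
Proof.
move=> s0; have [->|y0] := eqVneq y 0.
  by under eq_fun do rewrite mulr0 sin0; exact: cvg_cst.
have E : \forall n \near \oo, s / n.+1%:R * `|y| < pi.
  have : (n.+1%:R : R)^-1 * (s * `|y|) @[n --> \oo] --> 0 * (s * `|y|).
    by apply: cvgMl; exact: cvg_harmonic.
  rewrite mul0r => /cvgr_lt /(_ pi (pi_gt0 R)); apply: filterS => n.
  by rewrite mulrCA mulrA.
apply: cvg_near_cst; apply: filterS E => n En.
have sn0 : 0 < s / n.+1%:R by rewrite divr_gt0.
rewrite /half_step; case: (ltrgt0P y) (y0) => // yy _.
  by rewrite sin_gt0_pi // mulr_gt0 //= -(gtr0_norm yy).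
have : sin (s / n.+1%:R * y) < 0.
  rewrite -oppr_gt0 -sinN -mulrN sin_gt0_pi // mulr_gt0 ?oppr_gt0 //=.
  by rewrite -(ltr0_norm yy).
by move=> sl; rewrite ltNge (ltW sl) /= lt_eqF.
Qed.

(** The jump at 1/(n+1) tends to 0 from the right, so the point 0 ends up on the side of value 0 and
    [c] disappears. *)
Lemma half_step_shift_cvg c x :
  half_step c (x - n.+1%:R^-1) @[n --> \oo] --> ((0 < x)%R%:R : R).
Proof.
case: (ltP 0 x) => x0 /=; last first.
  apply: cvg_near_cst; apply: nearW => n.
  have : x - n.+1%:R^-1 < 0 by rewrite subr_lt0 (le_lt_trans x0) // invr_gt0.
  by move=> sl; rewrite /half_step ltNge (ltW sl) /= lt_eqF.
have E : \forall n \near \oo, n.+1%:R^-1 < x :> R.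
  by move: x0; apply: cvgr_lt; exact: cvg_harmonic.
by apply: cvg_near_cst; apply: filterS E => n En; rewrite /half_step subr_gt0 En.
Qed.

End PowerStep.

Section Determinacy.
Variables (R : realType) (mu nu : probability (measurableTypeR R) R) (s0 : R).
Local Notation mR := (measurableTypeR R).
Hypotheses (s00 : 0 < s0).
Hypotheses (fmu : finite_moments mu) (fnu : finite_moments nu).
Hypotheses (emu : mu.-integrable setT (EFin \o (fun x => expR (s0 * `|x|))))
  (enu : nu.-integrable setT (EFin \o (fun x => expR (s0 * `|x|)))).
Hypothesis eq_moments : forall k, moment mu k = moment nu k.

Lemma horner_integral (la : probability mR R) (q : {poly R}) : finite_moments la ->
  \int[la]_x q.[x] = \sum_(i < size q) q`_i * moment la i.
Proof.
move=> fla; have ci i : la.-integrable setT (EFin \o (fun x : mR => q`_i * x ^+ i)).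
  have -> : EFin \o (fun x : mR => q`_i * x ^+ i) = (fun x => (q`_i)%:E * (x ^+ i)%:E)%E.
    by apply/funext => x; rewrite /= EFinM.
  exact: integrableZl (fla i).
under eq_Rintegral do rewrite horner_coef -(big_mkord xpredT (fun i => q`_i * _ ^+ i)).
have [_ ->] := Rintegral_sum (index_iota 0 (size q)) ci.
rewrite big_mkord; apply: eq_bigr => i _.
by rewrite RintegralZl //; exact: fla.
Qed.

(** Testing against all polynomials, and not only against 1, makes the class stable under
    multiplication by a sine, whose Taylor polynomials are absorbed into [q]. *)
Definition indistinct (f : mR -> R) := [/\ measurable_fun setT f,
  exists M, forall x, `|f x| <= M &
  forall q : {poly R}, \int[mu]_x (q.[x] * f x) = \int[nu]_x (q.[x] * f x)].

Lemma indistinct_integrable (la : probability mR R) (f : mR -> R) (M : R) (q : {poly R}) :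
  la.-integrable setT (EFin \o (fun x => expR (s0 * `|x|))) ->
  measurable_fun setT f -> (forall x, `|f x| <= M) ->
  la.-integrable setT (EFin \o (fun x : mR => q.[x] * f x)).
Proof.
move=> ela mf fM; have [K K0 HK] := horner_le_expR q s00.
apply: (@le_integrableR _ _ _ la _ (fun x => K * M * expR (s0 * `|x|))).
- by apply: measurable_funM => //; exact: measurable_horner.
- by move=> x; rewrite normrM mulrAC ler_pM.
have -> : EFin \o (fun x : mR => K * M * expR (s0 * `|x|)) =
    (fun x => (K * M)%:E * (expR (s0 * `|x|))%:E)%E.
  by apply/funext => x; rewrite /= EFinM.
exact: integrableZl.
Qed.

Lemma indistinct_cst c : indistinct (fun=> c).
Proof.
split; [exact: measurable_cst | by exists `|c| |] => q.
have E (la : probability mR R) : finite_moments la ->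
    \int[la]_x (q.[x] * c) = c * \int[la]_x q.[x].
  move=> fla; under eq_Rintegral do rewrite mulrC -hornerZ.
  rewrite !horner_integral // mulr_sumr.
  have [->|c0] := eqVneq c 0.
    by rewrite scale0r size_poly0 big_ord0 big1 // => i _; rewrite mul0r.
  rewrite size_scale //; apply: eq_bigr => i _; by rewrite coefZ mulrA.
rewrite !E // !horner_integral //; congr (_ * _).
by apply: eq_bigr => i _; rewrite eq_moments.
Qed.

Lemma indistinctD f g : indistinct f -> indistinct g -> indistinct (fun x => f x + g x).
Proof.
move=> [mf [Mf fM] Hf] [mg [Mg gM] Hg]; split.
- exact: measurable_funD.
- by exists (Mf + Mg) => x; apply: le_trans (ler_normD _ _) _; exact: lerD.
move=> q; under eq_Rintegral do rewrite mulrDr.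
under [RHS]eq_Rintegral do rewrite mulrDr.
by rewrite !RintegralD //; [rewrite Hf Hg | exact: indistinct_integrable enu mf fM |
  exact: indistinct_integrable enu mg gM | exact: indistinct_integrable emu mf fM |
  exact: indistinct_integrable emu mg gM].
Qed.

Lemma sin_poly_shift_le n (s a x : R) : 0 <= s -> s <= s0 / 2 ->
  `|(sin_poly R n \Po (s *: ('X - a%:P))).[x]| <=
    expR (s0 / 2 * `|a|) * expR (s0 / 2 * `|x|).
Proof.
move=> sge sle; rewrite horner_comp hornerZ hornerXsubC sin_polyE.
apply: le_trans (norm_series_sin_coeff _ _) _; rewrite -expRD ler_expR normrM.
rewrite -mulrDr ger0_norm // (addrC `|a|); apply: ler_pM => //.
exact: ler_normB.
Qed.

(* Expand the sine in its Taylor series: the partial sums are polynomials,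
   dominated by an exponential. *)
Lemma indistinct_sin f s a : 0 <= s -> s <= s0 / 2 -> indistinct f ->
  indistinct (fun x => f x * sin (s * (x - a))).
Proof.
move=> sge sle [mf [M fM] Hf]; split.
- apply: measurable_funM => //; apply: continuous_measurable_fun => x.
  apply: continuous_comp; last exact: continuous_sin.
  by apply: continuousM; [exact: cst_continuous | apply: continuousB => //; exact: cst_continuous].
- exists M => x; rewrite normrM -[leRHS]mulr1 ler_pM // ler_norml sin_geN1 sin_le1.
  by [].
(* One half of the exponent [s0] dominates [q], the other half the Taylor polynomials of the
   sine. *)
move=> q; have s20 : 0 < s0 / 2 by rewrite divr_gt0.
have [K K0 HK] := horner_le_expR q s20.
pose g (x : mR) := M * K * expR (s0 / 2 * `|a|) * expR (s0 * `|x|).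
have M0 : 0 <= M by apply: le_trans (fM 0).
have ig (la : probability mR R) : la.-integrable setT (EFin \o (fun x => expR (s0 * `|x|))) ->
    la.-integrable setT (EFin \o g).
  move=> ila; have -> : EFin \o g =
      (fun x => (M * K * expR (s0 / 2 * `|a|))%:E * (expR (s0 * `|x|))%:E)%E.
    by apply/funext => x; rewrite /= EFinM.
  exact: integrableZl.
pose f_ n (x : mR) := (q * (sin_poly R n \Po (s *: ('X - a%:P)))).[x] * f x.
have cv (la : probability mR R) : la.-integrable setT (EFin \o (fun x => expR (s0 * `|x|))) ->
    \int[la]_x f_ n x @[n --> \oo] --> \int[la]_x (q.[x] * (f x * sin (s * (x - a)))).
  move=> ila; apply: (@Rintegral_dct _ _ _ la f_ _ g).
  - by move=> n; apply: measurable_funM => //; exact: measurable_horner.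
  - move=> x; rewrite [f x * _]mulrC mulrA; apply: cvgMl.
    under eq_fun do rewrite hornerM.
    apply: cvgMr; under eq_fun do rewrite horner_comp hornerZ hornerXsubC.
    exact: cvg_sin_poly.
  - exact: ig.
  - move=> n x; rewrite /f_ /g hornerM !normrM.
    have -> : expR (s0 * `|x|) = expR (s0 / 2 * `|x|) * expR (s0 / 2 * `|x|).
      by rewrite -expRD -mulrDl -splitr.
    rewrite [leRHS](_ : _ = (K * expR (s0 / 2 * `|x|)) *
      (expR (s0 / 2 * `|a|) * expR (s0 / 2 * `|x|)) * M); last by ring.
    by rewrite !ler_pM // ?mulr_ge0 //; exact: sin_poly_shift_le.
have := cv _ emu; have -> : (fun n => \int[mu]_x f_ n x) = (fun n => \int[nu]_x f_ n x).
  by apply/funext => n; exact: Hf.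
by move=> /cvg_unique; apply => //; exact: cv.
Qed.

Lemma indistinct_poly_sin (p : {poly R}) s a : 0 <= s -> s <= s0 / 2 ->
  indistinct (fun x => p.[sin (s * (x - a))]).
Proof.
move=> sge sle; elim/poly_ind: p => [|p c IH].
  by under eq_fun do rewrite horner0; exact: indistinct_cst.
under eq_fun do rewrite hornerMXaddC.
by apply: indistinctD; [exact: indistinct_sin | exact: indistinct_cst].
Qed.

Lemma indistinct_integral f : indistinct f -> \int[mu]_x f x = \int[nu]_x f x.
Proof.
case=> _ _ /(_ 1); under eq_Rintegral do rewrite hornerC mul1r.
by under [X in _ = X -> _]eq_Rintegral do rewrite hornerC mul1r.
Qed.

(** Only limits are taken from here on, so the polynomial factor is dropped; the values in [0, 1]
    allow dominated convergence by 1. *)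
Definition equal_integral (f : mR -> R) := [/\ measurable_fun setT f,
  forall x, 0 <= f x <= 1 & \int[mu]_x f x = \int[nu]_x f x].

Lemma equal_integral_cvg (f_ : nat -> mR -> R) f : (forall n, equal_integral (f_ n)) ->
  (forall x, f_ n x @[n --> \oo] --> f x) -> equal_integral f.
Proof.
move=> Hf fcv.
have mf : measurable_fun setT f.
  by apply: (measurable_fun_cvg (h := f_)) => [n|x _]; [case: (Hf n) | exact: fcv].
have f01 x : 0 <= f x <= 1.
  apply/andP; split.
    by apply: (cvgr_to_ge (fcv x)); apply: nearW => n; have [_ /(_ x)/andP[]] := Hf n.
  by apply: (cvgr_to_le (fcv x)); apply: nearW => n; have [_ /(_ x)/andP[]] := Hf n.
split => //.
have cv (la : probability mR R) : \int[la]_x f_ n x @[n --> \oo] --> \int[la]_x f x.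
  apply: (@Rintegral_dct _ _ _ la f_ f (fun=> 1)) => //.
  - by move=> n; case: (Hf n).
  - by apply: (@bounded_integrable _ _ _ la _ 1) => // x; rewrite normr1.
  - by move=> n x; have [_ /(_ x)/andP[h0 h1] _] := Hf n; rewrite ger0_norm.
have := cv mu; have -> : (fun n => \int[mu]_x f_ n x) = (fun n => \int[nu]_x f_ n x).
  by apply/funext => n; case: (Hf n).
by move=> /cvg_unique; apply => //; exact: cv.
Qed.

(** Three limits in a row give the indicator of a half-line: large exponents turn polynomials in a
    sine into a periodic step, a period tending to infinity leaves one jump, and moving the jump
    corrects the value there. *)
Lemma determinate_eq B : measurable B -> nu B = mu B.
Proof.
apply: probability_rays_unique => a0.
have [c [c01 cc]] := power_step_half R.
have E1 n s a : 0 <= s -> s <= s0 / 2 ->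
    equal_integral (fun x => power_step n ((1 - sin (s * (x - a))) / 2)).
  move=> sge sle.
  pose p : {poly R} := (1 - ((2^-1)%:P * (1 - 'X)) ^+ n) ^+ (2 ^ n).
  have pE : (fun x => power_step n ((1 - sin (s * (x - a))) / 2)) =
      (fun x : mR => p.[sin (s * (x - a))]).
    by apply/funext => x; rewrite /p /power_step !(hornerE, horner_exp) mulrC.
  rewrite pE; have H := indistinct_poly_sin p a sge sle; split.
  - by case: H.
  - move=> x; rewrite -[p.[_]]/((fun x => p.[sin (s * (x - a))]) x) -pE.
    apply: power_step_bounds.
    by have := sin_geN1 (s * (x - a)); have := sin_le1 (s * (x - a)); lra.
  - exact: indistinct_integral.
have E2 s a : 0 <= s -> s <= s0 / 2 ->
    equal_integral (fun x => half_step c (sin (s * (x - a)))).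
  move=> sge sle; apply: (equal_integral_cvg (fun n => E1 n s a sge sle)) => x.
  by apply: power_step_cvg => //; rewrite sin_geN1 sin_le1.
have E3 a : equal_integral (fun x => half_step c (x - a)).
  have sn (n : nat) : 0 <= s0 / 2 / n.+1%:R <= s0 / 2.
    rewrite divr_ge0 ?divr_ge0 ?(ltW s00) //= ler_pdivrMr // ler_peMr ?divr_ge0 ?(ltW s00) //.
    by rewrite ler1n.
  have H n := E2 (s0 / 2 / n.+1%:R) a (proj1 (andP (sn n))) (proj2 (andP (sn n))).
  apply: (equal_integral_cvg H) => x.
  by apply: half_step_sin_cvg; rewrite divr_gt0.
have E4 : equal_integral (fun x => (0 < x - a0)%R%:R).
  have H n := E3 (a0 + n.+1%:R^-1); apply: (equal_integral_cvg H) => x.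
  under eq_fun do rewrite opprD addrA.
  exact: half_step_shift_cvg.
have E5 (la : probability mR R) : (\int[la]_x (0 < x - a0)%R%:R)%:E = la `]a0, +oo[%classic.
  rewrite /Rintegral fineK.
    rewrite (eq_integral (fun x : mR => (\1_(`]a0, +oo[%classic : set mR) x)%:E)).
      by rewrite integral_indic // setIT.
    move=> x _; congr EFin; rewrite indicE; congr (nat_of_bool _)%:R.
    by apply/idP/idP; rewrite inE /= in_itv /= andbT subr_gt0.
  apply: integrable_fin_num => //.
  by case: E4 => m4 b4 _; apply: (@bounded_integrable _ _ _ la _ 1) => // x;
    have /andP[h0 h1] := b4 x; rewrite ger0_norm.
by rewrite -!E5; case: E4 => _ _ ->.
Qed.

End Determinacy.

Lemma moment_determinacy (R : realType) (mu nu : probability (measurableTypeR R) R) (B C : R) :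
  finite_moments mu -> finite_moments nu -> 0 <= B -> 0 <= C ->
  (forall k, moment mu k <= B * C ^+ k * k`!%:R) ->
  (forall k, moment nu k = moment mu k) ->
  forall D, measurable D -> nu D = mu D.
Proof.
move=> fmu fnu B0 C0 HB E.
have C1 : 0 < C + 1 by rewrite ltr_wpDl.
(* [C + 1] and not [C], which may be 0. *)
have s0 : 0 < (2 * (C + 1))^-1 by rewrite invr_gt0 mulr_gt0.
have sC : (2 * (C + 1))^-1 * C <= 2^-1.
  rewrite mulrC ler_pdivrMr ?mulr_gt0 // mulrA mulVf // mul1r; lra.
have HB' k : moment nu k <= B * C ^+ k * k`!%:R by rewrite E.
apply: (@determinate_eq R mu nu (2 * (C + 1))^-1) => //.
- exact: (exp_integrable fmu B0 C0 (ltW s0) sC).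
- exact: (exp_integrable fnu B0 C0 (ltW s0) sC).
Qed.

(** * Polynomial approximation *)

Section Weierstrass.
Variable R : realType.
Implicit Types (f : R -> R) (K eps : R).

(** Only [x] is confined to the segment; the near-covering form of compactness gives one delta for
    all [y], inside it or not. *)
Lemma unif_continuous_segment f K eps : continuous f -> 0 < eps ->
  exists2 delta, 0 < delta &
    forall x y, `|x| <= K -> `|y - x| < delta -> `|f y - f x| <= eps.
Proof.
move=> cf e0.
have cK : compact `[- K, K]%classic by exact: segment_compact.
have := (@compact_near_coveringP R `[- K, K]%classic).1 cK nat \oo
  (fun n x => forall y, `|y - x| < n.+1%:R^-1 -> `|f y - f x| <= eps).
case.
- move=> x _.
  have e2 : 0 < eps / 2 by rewrite divr_gt0.
  have /cvgr_dist_lt /(_ _ e2) /nbhs_ballP[d /= d0 Hd] := cf x.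
  have d2 : 0 < d / 2 by rewrite divr_gt0.
  exists (ball x (d / 2), [set n | n.+1%:R^-1 < d / 2]).
    split; first exact: nbhsx_ballx.
    have : \forall n \near \oo, n.+1%:R^-1 < d / 2 :> R.
      by move: d2; apply: cvgr_lt; exact: cvg_harmonic.
    by [].
  move=> [x' n] [/= bx nd] y yx.
  have h1 : `|f x - f x'| < eps / 2.
    by apply: Hd; apply: le_ball bx; rewrite ler_pdivrMr // ler_peMr ?ler1n // ltW.
  have h2 : `|f x - f y| < eps / 2.
    apply: Hd; rewrite /ball /= distrC in bx *.
    rewrite (_ : x - y = (x - x') + (x' - y)); last by ring.
    apply: le_lt_trans (ler_normD _ _) _; rewrite (splitr d); apply: ltrD.
      by rewrite distrC.
    by rewrite distrC (lt_trans yx).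
  rewrite (_ : f y - f x' = (f x - f x') - (f x - f y)); last by ring.
  apply: le_trans (ler_normB _ _) _; rewrite (splitr eps).
  by apply: lerD; apply: ltW.
move=> n _ /(_ n (leqnn n)) H; exists n.+1%:R^-1; first by rewrite invr_gt0.
by move=> x y xK; apply: H; rewrite /= in_itv /= -ler_norml.
Qed.

Lemma bounded_segment f K : continuous f -> exists2 M, 0 <= M & forall x, `|x| <= K -> `|f x| <= M.
Proof.
move=> cf; have : compact (f @` `[- K, K]%classic).
  by apply: continuous_compact; [exact: continuous_subspaceT | exact: segment_compact].
move=> /compact_bounded [M [_ HM]]; exists (`|M| + 1); first by rewrite addr_ge0.
move=> x xK; apply: (HM (`|M| + 1)); first by rewrite ltr_pwDr // ler_norm.
by exists x => //; rewrite /= in_itv /= -ler_norml.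
Qed.

(* The Bernstein polynomial of phi at n, through its recursion in n. *)
Fixpoint bernstein (phi : nat -> R) (n : nat) : {poly R} :=
  if n is n'.+1 then
    (1 - 'X) * bernstein phi n' + 'X * bernstein (phi \o succn) n'
  else (phi 0%N)%:P.

(** The bound is the mean of A + D (N - a)^2 for N binomial with parameters n and x: variance plus
    squared bias. The induction conditions on one trial, a success replacing a by a - 1. *)
Lemma bernstein_dist (phi : nat -> R) n c a A D x : 0 <= x <= 1 ->
  (forall i, `|phi i - c| <= A + D * (i%:R - a) ^+ 2) ->
  `|(bernstein phi n).[x] - c| <= A + D * (n%:R * (x * (1 - x)) + (n%:R * x - a) ^+ 2).
Proof.
move=> x01; elim: n phi a => [|n IH] phi a H /=.
  by rewrite hornerC !mul0r !add0r; have := H 0%N; rewrite add0r.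
have /andP[x0 x1] := x01.
have H1 := IH phi a H.
have H2 : `|(bernstein (phi \o succn) n).[x] - c| <=
    A + D * (n%:R * (x * (1 - x)) + (n%:R * x - (a - 1)) ^+ 2).
  apply: IH => i /=; apply: le_trans (H i.+1) _.
  by rewrite le_eqVlt; apply/orP; left; apply/eqP; rewrite -natr1; ring.
rewrite hornerD !hornerM hornerD hornerN hornerX -polyC1 hornerC.
rewrite (_ : _ - c = (1 - x) * ((bernstein phi n).[x] - c) +
  x * ((bernstein (phi \o succn) n).[x] - c)); last by ring.
apply: le_trans (ler_normD _ _) _; rewrite !normrM (ger0_norm x0) ger0_norm ?subr_ge0 //.
apply: le_trans (lerD (ler_wpM2l _ H1) (ler_wpM2l x0 H2)) _; first by rewrite subr_ge0.
by rewrite le_eqVlt; apply/orP; left; apply/eqP; rewrite -natr1; ring.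
Qed.

Lemma weierstrass f K eps : continuous f -> 0 < K -> 0 < eps ->
  exists p : {poly R}, forall x, `|x| <= K -> `|p.[x] - f x| <= eps.
Proof.
move=> cf K0 e0; have e2 : 0 < eps / 2 by rewrite divr_gt0.
have [d d0 Hd] := unif_continuous_segment K cf e2.
have [M M0 HM] := bounded_segment K cf.
(* [-K, K] is carried to [0, 1]. The truncation at 1 extends the estimate to all nonnegative
   arguments, as [bernstein_dist] asks for it at every index. *)
pose g t := f (K * (2 * Num.min t 1 - 1)).
have dK : 0 < d / (2 * K) by rewrite divr_gt0 // mulr_gt0.
(* As in Chebyshev's inequality: where t and x are at least d/(2K) apart, the oscillation 2M is at
   most D (t - x)^2. *)
pose D := 2 * M / (d / (2 * K)) ^+ 2.
have D0 : 0 <= D by rewrite /D divr_ge0 ?sqr_ge0 // mulr_ge0.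
have Hg t x : 0 <= x <= 1 -> 0 <= t -> `|g t - g x| <= eps / 2 + D * (t - x) ^+ 2.
  move=> /andP[x0 x1] t0.
  have bK s : 0 <= s -> `|K * (2 * Num.min s 1 - 1)| <= K.
    move=> s0; rewrite normrM (gtr0_norm K0) ler_piMr ?(ltW K0) // ler_norml.
    have : 0 <= Num.min s 1 by rewrite le_min s0 ler01.
    have : Num.min s 1 <= 1 by rewrite ge_min lexx orbT.
    by move=> h1 h2; apply/andP; split; lra.
  have mtx : `|Num.min t 1 - Num.min x 1| <= `|t - x|.
    rewrite (min_l x1); case: (leP t 1) => t1 //.
    by rewrite ger0_norm ?subr_ge0 // ger0_norm ?lerD2r ?(ltW t1) // subr_ge0 (le_trans x1) // ltW.
  have [tx|tx] := ltP `|t - x| (d / (2 * K)).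
    apply: le_trans (Hd _ _ (bK x x0) _) _; last by rewrite lerDl mulr_ge0 ?sqr_ge0.
    rewrite -mulrBr (_ : 2 * _ - 1 - _ = 2 * (Num.min t 1 - Num.min x 1)); last by ring.
    rewrite mulrA normrM ger0_norm ?mulr_ge0 ?(ltW K0) //.
    rewrite [ltLHS]mulrC (mulrC K 2) -ltr_pdivlMr ?mulr_gt0 //; exact: le_lt_trans mtx tx.
  apply: le_trans (_ : 2 * M <= _).
    apply: le_trans (ler_normB _ _) _; rewrite mulr_natl mulr2n.
    by apply: lerD; apply: HM; exact: bK.
  apply: le_trans (_ : D * (t - x) ^+ 2 <= _); last by rewrite lerDr ltW.
  rewrite /D mulrAC ler_pdivlMr ?exprn_gt0 // ler_wpM2l ?mulr_ge0 //.
  by rewrite -(real_normK (num_real (t - x))) lerXn2r // nnegrE ?(ltW dK).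
pose n := (Num.truncn (D / (eps / 2))).+1.
have n0 : 0 < n%:R :> R by rewrite ltr0n.
have Dn : D <= eps / 2 * n%:R.
  by rewrite mulrC -ler_pdivrMr // ltW // truncnS_gt.
pose B := bernstein (fun i => g (i%:R / n%:R)) n.
exists (B \Po ((2 * K)^-1 *: ('X + K%:P))) => x xK.
rewrite horner_comp (_ : (_ *: _).[x] = (2 * K)^-1 * (x + K)); last first.
  by rewrite hornerZ hornerD hornerX hornerC.
set y := _ * (x + K).
have /andP[xK1 xK2] : - K <= x <= K by rewrite -ler_norml.
have y01 : 0 <= y <= 1.
  rewrite /y mulrC divr_ge0 ?mulr_ge0 ?(ltW K0) //=; last by lra.
  by rewrite ler_pdivrMr ?mulr_gt0 //; lra.
have /andP[y0 y1] := y01.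
have -> : f x = g y.
  rewrite /g (min_l y1) /y; congr f; field; by rewrite gt_eqF.
have H i : `|g (i%:R / n%:R) - g y| <= eps / 2 + D / n%:R ^+ 2 * (i%:R - n%:R * y) ^+ 2.
  apply: le_trans (Hg _ _ y01 _) _; first by rewrite divr_ge0.
  rewrite le_eqVlt; apply/orP; left; apply/eqP; field; by rewrite gt_eqF.
apply: le_trans (bernstein_dist n y01 H) _.
rewrite subrr expr0n /= addr0 {2}(splitr eps) lerD2l.
have -> : D / n%:R ^+ 2 * (n%:R * (y * (1 - y))) = D * (y * (1 - y)) / n%:R.
  by field; rewrite gt_eqF.
rewrite ler_pdivrMr //; apply: le_trans Dn; rewrite ler_piMr //.
by rewrite mulr_ile1 // ?subr_ge0 // gerBl.
Qed.

(** Serves measurability: a linear statistic of the spectrum becomes a pointwise limit of polynomial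
    ones. *)
Lemma weierstrass_seq f : continuous f ->
  exists p : nat -> {poly R}, forall x, (p n).[x] @[n --> \oo] --> f x.
Proof.
move=> cf.
have H (n : nat) : exists p : {poly R}, forall x, `|x| <= n.+1%:R -> `|p.[x] - f x| <= n.+1%:R^-1.
  by apply: weierstrass => //; rewrite invr_gt0.
have [p Hp] := choice H.
exists p => x; apply/cvgrPdist_le => e e0.
have E : \forall n \near \oo, n.+1%:R^-1 < e :> R.
  by move: e0; apply: cvgr_lt; exact: cvg_harmonic.
near=> n; rewrite distrC; apply: le_trans (Hp n x _) _.
  have : (Num.truncn `|x| <= n)%N by near: n; exact: nbhs_infty_ge.
  move=> h; apply: ltW; apply: lt_le_trans (truncnS_gt _) _.
  by rewrite ler_nat ltnS.
by apply: ltW; near: n.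
Unshelve. all: by end_near. Qed.

End Weierstrass.

(** * Limits of empirical measures with convergent moments *)

Section CdfProbability.
Variables (R : realType) (F : R -> R).
Hypotheses (ndF : nondecreasing F) (rcF : right_continuous F).
Hypotheses (F0 : F x @[x --> -oo] --> (0 : R)) (F1 : F x @[x --> +oo] --> (1 : R)).

#[local] HB.instance Definition _ := isCumulative.Build R _ R F ndF rcF.
#[local] HB.instance Definition _ := isCumulativeBounded.Build R 0 1 F F0 F1.

Lemma cdf_probability : exists P : probability (measurableTypeR R) R,
  forall x, P `]-oo, x]%classic = (F x)%:E.
Proof.
exists (lebesgue_stieltjes_measure F) => x.
pose idTR : measurableTypeR R -> R := idfun.
exact: (@cdf_lebesgue_stieltjes_id R F x).
Qed.

End CdfProbability.

Section UltraLimits.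
Variables (R : realType) (U : set_system nat).
Hypothesis FU : UltraFilter U.

(** Compactness gives a cluster point; an ultrafilter contains each set or its complement, so it
    converges to it. *)
Lemma ultra_bounded_cvg (u : nat -> R) (M : R) : (forall n, `|u n| <= M) ->
  exists l : R, u n @[n --> U] --> l.
Proof.
move=> uM; have cM : compact `[- M, M]%classic by exact: segment_compact.
have UM : (u @ U) `[- M, M]%classic.
  have : \forall n \near U, `[- M, M]%classic (u n).
    by apply: nearW => n; rewrite /= in_itv /= -ler_norml.
  by [].
have [l [_ cl]] := cM (u @ U) _ UM.
exists l; apply/cvgrPdist_lt => e e0.
have [//|H] := in_ultra_setVsetC [set n | `|l - u n| < e] FU.
have [x [/= xe xb]] := cl [set x | ~ `|l - x| < e] (ball l e) H (nbhsx_ballx _ _ e0).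
by case: xe.
Qed.

Lemma ultra_lim (u : nat -> R) (M : R) : (forall n, `|u n| <= M) ->
  u n @[n --> U] --> lim (u n @[n --> U]).
Proof. by move=> /ultra_bounded_cvg cv; exact/cvg_ex. Qed.

End UltraLimits.

Section Averages.
Variable R : realType.
Implicit Types (s : seq R) (f g : R -> R).

Definition avg s f : R := (\sum_(x <- s) f x) / (size s)%:R.

Lemma avgD s f g : avg s (fun x => f x + g x) = avg s f + avg s g.
Proof. by rewrite /avg big_split mulrDl. Qed.

Lemma avgZ s c f : avg s (fun x => c * f x) = c * avg s f.
Proof. by rewrite /avg -mulr_sumr mulrA. Qed.

Lemma avgN s f : avg s (fun x => - f x) = - avg s f.
Proof. by rewrite /avg sumrN mulNr. Qed.

Lemma avgB s f g : avg s (fun x => f x - g x) = avg s f - avg s g.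
Proof. by rewrite avgD avgN. Qed.

Lemma avg_sum s (I : Type) (r : seq I) (F : I -> R -> R) :
  avg s (fun x => \sum_(i <- r) F i x) = \sum_(i <- r) avg s (F i).
Proof. by rewrite /avg exchange_big mulr_suml. Qed.

Lemma le_avg s f g : (forall x, f x <= g x) -> avg s f <= avg s g.
Proof. by move=> fg; rewrite ler_wpM2r ?invr_ge0 // ler_sum. Qed.

Lemma avg_cst s c : s != [::] -> avg s (fun=> c) = c.
Proof.
move=> s0; rewrite /avg big_const_seq iter_addr_0 count_predT -[X in X / _]mulr_natr mulfK //.
by rewrite pnatr_eq0 size_eq0.
Qed.

Lemma norm_avg s f : `|avg s f| <= avg s (fun x => `|f x|).
Proof.
rewrite /avg normrM normfV normr_nat ler_wpM2r ?invr_ge0 //.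
exact: ler_norm_sum.
Qed.

End Averages.

Section StepApproximation.
Variable R : realType.
Implicit Types (f : R -> R) (x : nat -> R) (y : R).

(** Written with indicators of half-lines, so that its averages and integral are expressed through
    distribution functions. *)
Definition step_sum f x n y : R :=
  \sum_(0 <= k < n) f (x k) * ((y <= x k.+1)%R%:R - (y <= x k)%R%:R).

Lemma step_sum_dist f x n y e M : (forall k, x k <= x k.+1) ->
  (forall k, (k < n)%N -> x k < y -> y <= x k.+1 -> `|f y - f (x k)| <= e) ->
  0 <= e -> `|f y| <= M ->
  `|f y - step_sum f x n y| <= e + M * (y <= x 0%N)%R%:R + M * (1 - (y <= x n)%R%:R).
Proof.
move=> xS H e0 yM; have M0 : 0 <= M by apply: le_trans yM.
have xnd : nondecreasing_seq x by apply/nondecreasing_seqP.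
have out0 j : y <= x 0%N \/ x j < y -> step_sum f x j y = 0.
  move=> yx; rewrite /step_sum big_nat; apply: big1 => k /= kj.
  case: yx => yx.
    by rewrite !(le_trans yx) ?subrr ?mulr0 //; apply: xnd.
  have h i : (i <= j)%N -> (y <= x i) = false.
    by move=> ij; apply/negbTE; rewrite -ltNge; apply: le_lt_trans yx; exact: xnd.
  by rewrite !h ?subrr ?mulr0 // ltnW.
case: (leP y (x 0%N)) => y0.
  rewrite out0 ?subr0 ?mulr1; last by left.
  by rewrite (le_trans y0 (xnd 0%N n (leq0n n))) subrr mulr0 addr0 (le_trans yM) // lerDr.
case: (leP y (x n)) => yn; last first.
  rewrite out0 ?subr0 ?mulr1 ?mulr0 ?addr0; last by right.
  by rewrite (le_trans yM) // lerDr.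
rewrite subrr !mulr0 !addr0.
elim: n H yn => [|n IH] H yn; first by rewrite leNgt y0 in yn.
case: (leP y (x n)) => yxn.
  have -> : step_sum f x n.+1 y = step_sum f x n y.
    by rewrite /step_sum big_nat_recr //= yn yxn subrr mulr0 addr0.
  by apply: IH => // k kn; apply: H; rewrite ltnS ltnW.
rewrite /step_sum big_nat_recr //= -/(step_sum f x n y) out0; last by right.
by rewrite add0r yn [y <= x n]leNgt yxn /= subr0 mulr1; exact: H.
Qed.

End StepApproximation.

Section MomentLimit.
Variables (R : realType) (S : nat -> seq R) (m : nat -> R) (U : set_system nat).
Local Notation mR := (measurableTypeR R).
Hypothesis FU : UltraFilter U.
Hypothesis Uoo : \oo `<=` U.
Hypothesis S0 : forall j, S j != [::].
Hypothesis Sm : forall k, avg (S j) (fun x => x ^+ k) @[j --> \oo] --> m k.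

Let ule (x : R) (y : R) : R := (y <= x)%R%:R.
Let A j x := avg (S j) (ule x).
Let H x : R := lim (A j x @[j --> U]).
(** [H], a pointwise limit of distribution functions, need not be right continuous; [F] is its right
    regularisation. *)
Let F x := inf [set H y | y in [set y | x < y]].

Let ule01 x y : 0 <= ule x y <= 1.
Proof. by rewrite /ule; case: (y <= x); rewrite ?lexx ?ler01. Qed.

Let A01 j x : 0 <= A j x <= 1.
Proof.
apply/andP; split.
  by rewrite -(avg_cst 0 (S0 j)); apply: le_avg => y; have /andP[] := ule01 x y.
by rewrite -(avg_cst 1 (S0 j)); apply: le_avg => y; have /andP[] := ule01 x y.
Qed.

Let AH x : A j x @[j --> U] --> H x.
Proof.
apply: (ultra_lim FU (M := 1)) => j; have /andP[h0 h1] := A01 j x.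
by rewrite ger0_norm.
Qed.

Let cvgU (u : nat -> R) (l : R) : u j @[j --> \oo] --> l -> u j @[j --> U] --> l.
Proof. by move=> ul; apply: cvg_trans ul; exact: cvg_app. Qed.

Let H01 x : 0 <= H x <= 1.
Proof.
apply/andP; split.
  by apply: (cvgr_to_ge (@AH x)); apply: nearW => j; have /andP[] := A01 j x.
by apply: (cvgr_to_le (@AH x)); apply: nearW => j; have /andP[] := A01 j x.
Qed.

Let ndH x y : x <= y -> H x <= H y.
Proof.
move=> xy; apply: ler_cvg_to (@AH x) (@AH y) _; apply: nearW => j.
by apply: le_avg => z; rewrite /ule ler_nat; case: (leP z x) => // zx; rewrite (le_trans zx xy).
Qed.

Let hasF x : has_inf [set H y | y in [set y | x < y]].
Proof.
split; first by exists (H (x + 1)); exists (x + 1) => //=; rewrite ltrDl.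
by exists 0 => _ [y _ <-]; have /andP[] := H01 y.
Qed.

Let F_le x y : x < y -> F x <= H y.
Proof. by move=> xy; apply: ge_inf; [case: (hasF x) | exists y]. Qed.

Let le_F x c : (forall y, x < y -> c <= H y) -> c <= F x.
Proof.
move=> Hc; apply: lb_le_inf; first by case: (hasF x).
by move=> _ [y /= xy <-]; exact: Hc.
Qed.

Let HF x : H x <= F x.
Proof. by apply: le_F => y xy; apply: ndH; exact: ltW. Qed.

Let ndF : nondecreasing F.
Proof. by move=> x y xy; apply: le_F => z yz; apply: F_le; exact: le_lt_trans yz. Qed.

Let rcF : right_continuous F.
Proof.
move=> x; apply/cvgrPdist_le => e e0.
have [_ [y /= xy <-] Hy] := inf_adherent e0 (hasF x).
near=> z; have xz : x < z by [].
have zy : z < y by near: z; exact: nbhs_right_lt.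
rewrite ler0_norm ?subr_le0 ?ndF ?(ltW xz) // opprB lerBlDl.
exact: le_trans (F_le zy) (ltW Hy).
Unshelve. all: by end_near. Qed.

Let F01 x : 0 <= F x <= 1.
Proof.
have /andP[h0 h1] := H01 x; have /andP[h2 h3] := H01 (x + 1).
rewrite (le_trans h0 (HF x)) /=; apply: le_trans h3; apply: F_le; by rewrite ltrDl.
Qed.

(** Chebyshev's inequality: the second moments converge, so no mass escapes to infinity. *)
Let tail (K : R) : 0 < K -> H (- K) <= m 2 / K ^+ 2 /\ 1 - H K <= m 2 / K ^+ 2.
Proof.
move=> K0; have K2 : 0 < K ^+ 2 by rewrite exprn_gt0.
have cv : avg (S j) (fun x => x ^+ 2) / K ^+ 2 @[j --> U] --> m 2 / K ^+ 2.
  by apply: cvgMl; apply: cvgU; exact: Sm.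
have bd y : `|y| >= K -> 1 <= (K ^+ 2)^-1 * y ^+ 2.
  move=> Ky; rewrite mulrC ler_pdivlMr // mul1r -(real_normK (num_real y)).
  by rewrite lerXn2r // nnegrE ltW.
split.
  apply: ler_cvg_to (@AH _) cv _; apply: nearW => j.
  rewrite mulrC -avgZ; apply: le_avg => y; rewrite /ule.
  case: (leP y (- K)) => yK /=; last by rewrite mulr_ge0 ?invr_ge0 ?sqr_ge0.
  by apply: bd; rewrite ler_normr lerNr yK orbT.
have cv1 : 1 - A j K @[j --> U] --> 1 - H K by apply: cvgB => //; exact: cvg_cst.
apply: ler_cvg_to cv1 cv _; apply: nearW => j.
rewrite mulrC -avgZ lerBlDr -avgD -(avg_cst 1 (S0 j)); apply: le_avg => y.
rewrite /ule; case: (leP y K) => yK /=.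
  by rewrite lerDr mulr_ge0 ?invr_ge0 ?sqr_ge0.
by rewrite addr0; apply: bd; rewrite ler_normr (ltW yK).
Qed.

Let m2_ge0 : 0 <= m 2.
Proof.
apply: (cvgr_to_ge (cvgU (Sm (k := 2)))); apply: nearW => j.
by rewrite -(avg_cst 0 (S0 j)); apply: le_avg => y; rewrite sqr_ge0.
Qed.

Let tail_eps e : 0 < e -> exists2 K, 0 < K & m 2 / K ^+ 2 <= e.
Proof.
move=> e0; exists (m 2 / e + 1); first by rewrite ltr_wpDl // divr_ge0 // ltW.
have q0 : 0 <= m 2 / e by rewrite divr_ge0 // ltW.
rewrite ler_pdivrMr ?exprn_gt0 ?ltr_wpDl // mulrC -ler_pdivrMr //.
rewrite expr2; have : 0 <= m 2 / e * (m 2 / e) by rewrite mulr_ge0.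
by lra.
Qed.

Let F_tail e : 0 < e -> exists2 K, 0 < K & F (- K) <= e /\ 1 - F K <= e.
Proof.
move=> e0; have [K K0 HK] := tail_eps e0; exists (K + 1); first by rewrite addr_gt0.
have [t1 t2] := tail K0; split.
  by apply: le_trans (F_le _) (le_trans t1 HK); rewrite ltrN2 ltrDl.
apply: le_trans HK; apply: le_trans t2; rewrite lerD2l lerN2.
by apply: le_trans (HF _); apply: ndH; rewrite lerDl.
Qed.

Let F_ninfty : F x @[x --> -oo] --> (0 : R).
Proof.
apply/cvgrPdist_le => e e0; have [K K0 [HK _]] := F_tail e0.
near=> x; have /andP[h0 _] := F01 x; rewrite sub0r normrN ger0_norm //.
by apply: le_trans HK; apply: ndF; near: x; apply: nbhs_ninfty_le; exact: num_real.
Unshelve. all: by end_near. Qed.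

Let F_pinfty : F x @[x --> +oo] --> (1 : R).
Proof.
apply/cvgrPdist_le => e e0; have [K K0 [_ HK]] := F_tail e0.
near=> x; have /andP[_ h0] := F01 x; rewrite ger0_norm ?subr_ge0 //.
apply: le_trans HK; rewrite lerD2l lerN2; apply: ndF; near: x; apply: nbhs_pinfty_ge; exact: num_real.
Unshelve. all: by end_near. Qed.

(* H cannot jump by more than eta at too many points. *)
Let good_point (a b eta : R) : a < b -> 0 < eta -> exists x, [/\ a < x, x < b & F x - H x <= eta].
Proof.
move=> ab eta0; apply: contrapT => Hno.
have jump x : a < x -> x < b -> H x + eta <= F x.
  move=> ax xb; rewrite leNgt; apply/negP => lt; apply: Hno; exists x; split => //.
  by rewrite lerBlDl ltW.
(* If [F] exceeded [H] by [eta] everywhere in the interval, each move to the right would raise [H]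
   by [eta], eventually above 1. *)
have step n : exists2 x, a < x < b & n%:R * eta <= H x.
  elim: n => [|n [x /andP[ax xb] Hx]].
    exists ((a + b) / 2); first by rewrite !midf_lt.
    by rewrite mul0r; have /andP[] := H01 ((a + b) / 2).
  have xy : x < (x + b) / 2 < b by rewrite !midf_lt.
  have /andP[xy1 xy2] := xy.
  exists ((x + b) / 2); first by rewrite xy2 (lt_trans ax).
  rewrite -natr1 mulrDl mul1r; apply: le_trans (F_le xy1).
  by apply: le_trans (jump x ax xb); rewrite lerD2r.
have [x _] := step (Num.truncn eta^-1).+1.
have /andP[_ h1] := H01 x; rewrite leNgt => /negP; apply.
apply: le_lt_trans h1 _.
by rewrite -ltr_pdivrMr // div1r truncnS_gt.
Qed.

(** Helly's selection along an ultrafilter. The averages of a step function converge to a sum over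
    [H], while its integral is a sum over [F]; hence subdivision points where the two nearly
    agree. *)
Lemma ultra_limit_law : exists mu : probability mR R,
  forall f, continuous f -> bounded_fun f ->
    avg (S j) f @[j --> U] --> \int[mu]_x f x.
Proof.
have [mu muF] := cdf_probability ndF rcF F_ninfty F_pinfty.
exists mu => f cf [M0 [_ HM0]].
pose M := `|M0| + 1; have M1 : 0 < M by rewrite ltr_wpDl.
have fM y : `|f y| <= M by apply: HM0 => //; rewrite ltr_pwDr // ler_norm.
have mule x : measurable_fun setT (ule x : mR -> R).
  rewrite (_ : ule x = \1_(`]-oo, x]%classic)); first exact: measurable_indic.
  apply/funext => y; rewrite indicE /ule; congr (nat_of_bool _)%:R.
  by apply/idP/idP; rewrite inE /= in_itv.
have iule x : mu.-integrable setT (EFin \o (ule x : mR -> R)).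
  apply: (@bounded_integrable _ _ _ mu _ 1) => // y.
  by have /andP[h0 h1] := ule01 x y; rewrite ger0_norm.
have Iule x : \int[mu]_y (ule x y) = F x.
  rewrite /Rintegral -[RHS]/(fine (F x)%:E) -muF; congr fine.
  rewrite (eq_integral (fun y : mR => (\1_(`]-oo, x]%classic : set mR) y)%:E)).
    by rewrite integral_indic // setIT.
  move=> y _; congr EFin; rewrite indicE /ule; congr (nat_of_bool _)%:R.
  by apply/idP/idP; rewrite inE /= in_itv.
have mf : measurable_fun setT (f : mR -> R) by exact: continuous_measurable_fun.
have if_ : mu.-integrable setT (EFin \o f) by exact: (@bounded_integrable _ _ _ mu _ M).
apply/cvgrPdist_le => e e0.
have D0 : 0 < 3 + 8 * M by rewrite addr_gt0 ?mulr_gt0.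
(* The errors, in units of [e1]: 1 + 2M for the integral, 2M between [F] and [H], 1 for the limit
   along U, 1 + 4M for the averages. *)
pose e1 := e / (3 + 8 * M); have e10 : 0 < e1 by rewrite divr_gt0.
have [K K0 [FK1 FK2]] := F_tail e10.
have [d d0 Hd] := unif_continuous_segment (K + 2) cf e10.
(* Consecutive points lie in adjacent cells of length [h], hence within 2h <= d of each other. *)
pose h := Num.min (d / 2) 1.
have h0 : 0 < h by rewrite lt_min ltr01 divr_gt0.
have hd : h <= d / 2 by rewrite ge_min lexx.
have h1 : h <= 1 by rewrite ge_min lexx orbT.
pose n := (Num.truncn ((2 * K + 1) / h)).+1.
have nh1 : 2 * K + 1 <= n%:R * h by rewrite -ler_pdivrMr // ltW // truncnS_gt.
have nh2 : n%:R * h <= 2 * K + 1 + h.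
  rewrite /n -natr1 mulrDl mul1r lerD2r -ler_pdivlMr // truncn_le // divr_ge0 ?(ltW h0) //.
  by rewrite addr_ge0 // mulr_ge0 // ltW.
(* Each of the n increments is off by at most 2 eta, so that together they cost at most 2 M e1. *)
pose eta := e1 / n.+1%:R; have eta0 : 0 < eta by rewrite divr_gt0.
have Hx (k : nat) : exists x, [/\ - K - 1 + k%:R * h < x, x < - K - 1 + k.+1%:R * h & F x - H x <= eta].
  by apply: good_point => //; rewrite ltrD2l ltr_pM2r // ltr_nat.
have [x Hxk] := choice Hx.
have xS k : x k <= x k.+1.
  have [_ a1 _] := Hxk k; have [a2 _ _] := Hxk k.+1.
  exact: ltW (lt_trans a1 a2).
have x0K : x 0%N <= - K by have [_ a1 _] := Hxk 0%N; lra.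
have xnK : K < x n by have [a1 _ _] := Hxk n; lra.
have xK k : (k < n)%N -> `|x k| <= K + 2.
  move=> kn; have [a1 a2 _] := Hxk k.
  have : k.+1%:R * h <= n%:R * h by rewrite ler_pM2r // ler_nat.
  have : 0 <= k%:R * h by rewrite mulr_ge0 // ltW.
  by move=> b1 b2; rewrite ler_norml; apply/andP; split; lra.
have xd k y : (k < n)%N -> x k < y -> y <= x k.+1 -> `|f y - f (x k)| <= e1.
  move=> kn xy yx; apply: Hd; first exact: xK.
  have [a1 _ _] := Hxk k; have [_ a2 _] := Hxk k.+1.
  rewrite gtr0_norm ?subr_gt0 //; move: a1 a2; rewrite -!natr1 !mulrDl !mul1r.
  by move=> a1 a2; lra.
have Hs y := step_sum_dist xS (fun k kn => xd k y kn) (ltW e10) (fM y).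
pose L := \sum_(0 <= k < n) f (x k) * (H (x k.+1) - H (x k)).
pose I := \sum_(0 <= k < n) f (x k) * (F (x k.+1) - F (x k)).
pose bd y := e1 + M * ule (x 0%N) y + M * (1 - ule (x n) y).
have avg_step j : avg (S j) (step_sum f x n) =
    \sum_(0 <= k < n) f (x k) * (A j (x k.+1) - A j (x k)).
  rewrite avg_sum; apply: eq_bigr => k _; rewrite avgZ; congr (_ * _).
  by rewrite avgB.
have avg_bd j : avg (S j) bd = e1 + M * A j (x 0%N) + M * (1 - A j (x n)).
  by rewrite /bd !avgD !avgZ avgB !avg_cst.
have cvL : avg (S j) (step_sum f x n) @[j --> U] --> L.
  under eq_fun do rewrite avg_step.
  apply: cvg_big => [|k _]; first exact: add_continuous.
  apply: cvgMr; apply: cvgB; exact: AH.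
have IL : `|I - L| <= 2 * M * e1.
  rewrite /I /L -sumrB; apply: le_trans (ler_norm_sum _ _ _) _.
  apply: le_trans (_ : \sum_(0 <= k < n) M * (2 * eta) <= _).
    apply: ler_sum => k _; rewrite -mulrBr normrM ler_pM //.
    have [_ _ b1] := Hxk k; have [_ _ b2] := Hxk k.+1.
    have := HF (x k); have := HF (x k.+1) => b3 b4.
    by rewrite ler_norml; apply/andP; split; lra.
  rewrite sumr_const_nat subn0 -[leLHS]mulr_natr.
  have : eta * n%:R <= e1 by rewrite /eta mulrAC ler_pdivrMr // ler_pM2l // ler_nat.
  move=> /(ler_wpM2l (ltW M1)) {}H2; apply: le_trans (_ : 2 * (M * (eta * n%:R)) <= _).
    by rewrite le_eqVlt; apply/orP; left; apply/eqP; ring.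
  by rewrite -[leRHS]mulrA ler_pM2l.
have iB g : measurable_fun setT (g : mR -> R) -> (forall y, `|g y| <= 1) ->
    mu.-integrable setT (EFin \o g).
  by move=> mg g1; exact: (@bounded_integrable _ _ _ mu _ 1).
have iD k : mu.-integrable setT (EFin \o (fun y => ule (x k.+1) y - ule (x k) y)).
  apply: iB => [|y]; first exact: measurable_funB.
  have /andP[b1 b2] := ule01 (x k.+1) y; have /andP[b3 b4] := ule01 (x k) y.
  by rewrite ler_norml; apply/andP; split; lra.
have iZ c (g : mR -> R) : mu.-integrable setT (EFin \o g) ->
    mu.-integrable setT (EFin \o (fun y => c * g y)).
  move=> ig; have -> : EFin \o (fun y => c * g y) = (fun y => c%:E * (g y)%:E)%E.
    by apply/funext => y; rewrite /= EFinM.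
  exact: integrableZl.
have [istep int_step'] := Rintegral_sum (index_iota 0 n) (fun k => iZ (f (x k)) _ (iD k)).
have int_step : \int[mu]_y step_sum f x n y = I.
  rewrite [LHS]int_step'; apply: eq_bigr => k _; rewrite RintegralZl //.
  by rewrite RintegralB // !Iule.
have int1 c : \int[mu]_y c = c.
  by rewrite Rintegral_cst // fine_probability_setT mulr1.
have icst c : mu.-integrable setT (EFin \o (fun=> c : R)).
  by apply: (@bounded_integrable _ _ _ mu _ `|c|).
have i1u z : mu.-integrable setT (EFin \o (fun y => 1 - ule z y)).
  apply: iB => [|y]; first exact: measurable_funB.
  by have /andP[b1 b2] := ule01 z y; rewrite ler_norml; apply/andP; split; lra.
have ibd1 : mu.-integrable setT (EFin \o (fun y => e1 + M * ule (x 0%N) y)).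
  exact: (integrableD measurableT (icst e1) (iZ M _ (iule (x 0%N)))).
have ibd : mu.-integrable setT (EFin \o bd).
  exact: (integrableD measurableT ibd1 (iZ M _ (i1u (x n)))).
have int_bd : \int[mu]_y bd y = e1 + M * F (x 0%N) + M * (1 - F (x n)).
  rewrite /bd RintegralD //; last exact: iZ.
  rewrite RintegralD //; last exact: iZ.
  rewrite !RintegralZl // RintegralB //.
  by rewrite !int1 !Iule.
have F0e : F (x 0%N) <= e1 by apply: le_trans FK1; exact: ndF.
have Fne : 1 - F (x n) <= e1 by apply: le_trans FK2; rewrite lerD2l lerN2 ndF // ltW.
have Hne : 1 - H (x n) <= e1 by apply: le_trans FK2; rewrite lerD2l lerN2 F_le.
have fI : `|\int[mu]_y f y - I| <= e1 + 2 * M * e1.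
  rewrite -int_step -RintegralB //.
  have iDf := integrableB measurableT if_ istep.
  apply: le_trans (le_normr_Rintegral _ _) _ => //.
  apply: le_trans (_ : \int[mu]_y bd y <= _).
    by apply: le_Rintegral => //; exact: (integrable_norm iDf).
  rewrite int_bd -addrA lerD2l; have := ler_wpM2l (ltW M1) F0e.
  by have := ler_wpM2l (ltW M1) Fne; lra.
near=> j.
have a1 : `|avg (S j) f - avg (S j) (step_sum f x n)| <= avg (S j) bd.
  by rewrite -avgB; apply: le_trans (norm_avg _ _) _; exact: le_avg.
have a2 : `|L - avg (S j) (step_sum f x n)| <= e1.
  by near: j; apply: cvgr_dist_le cvL _ _.
have a3 : `|H (x 0%N) - A j (x 0%N)| <= e1.
  by near: j; apply: cvgr_dist_le (@AH (x 0%N)) _ _.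
have a4 : `|H (x n) - A j (x n)| <= e1.
  by near: j; apply: cvgr_dist_le (@AH (x n)) _ _.
have H0e := le_trans (HF (x 0%N)) F0e.
have a5 : avg (S j) bd <= e1 + 4 * (M * e1).
  rewrite avg_bd; move: a3 a4; rewrite !ler_norml => /andP[b1 b2] /andP[b3 b4].
  have /(ler_wpM2l (ltW M1)) c1 : A j (x 0%N) <= 2 * e1 by lra.
  have /(ler_wpM2l (ltW M1)) c2 : 1 - A j (x n) <= 2 * e1 by lra.
  by lra.
have -> : e = 3 * e1 + 8 * (M * e1) by rewrite mulrA -mulrDl mulrC divfK // gt_eqF.
rewrite (_ : _ - avg _ _ = (\int[mu]_y f y - I) + (I - L) +
  ((L - avg (S j) (step_sum f x n)) - (avg (S j) f - avg (S j) (step_sum f x n)))); last by ring.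
apply: le_trans (ler_normD _ _) _; have := ler_normD (\int[mu]_y f y - I) (I - L).
have := ler_normB (L - avg (S j) (step_sum f x n)) (avg (S j) f - avg (S j) (step_sum f x n)).
move: fI IL a1 a2 a5; rewrite -!mulrA.
by move: (M * e1) => q; lra.
Unshelve. all: by end_near. Qed.

End MomentLimit.

(** * Truncation of moments *)

Section Damping.
Variable R : realType.
Implicit Types t y : R.

(** A bounded continuous substitute for y. Its bound t and its error y^2 / (2t) both come from 2 t
    |y| <= t^2 + y^2. *)
Definition damp t y : R := y * (t ^+ 2 / (t ^+ 2 + y ^+ 2)).

Let den_gt0 t y : 0 < t -> 0 < t ^+ 2 + y ^+ 2.
Proof. by move=> t0; rewrite ltr_pwDl ?exprn_gt0 ?sqr_ge0. Qed.

Let den_ge t y : 2 * (t * `|y|) <= t ^+ 2 + y ^+ 2.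
Proof.
rewrite -(real_normK (num_real y)); have := sqr_ge0 (t - `|y|).
by rewrite sqrrB mulr_natl; lra.
Qed.

Let ratio01 t y : 0 < t -> 0 <= t ^+ 2 / (t ^+ 2 + y ^+ 2) <= 1.
Proof.
move=> t0; apply/andP; split; first by rewrite divr_ge0 ?sqr_ge0 // ltW // den_gt0.
by rewrite ler_pdivrMr ?den_gt0 // mul1r lerDl sqr_ge0.
Qed.

Lemma damp_le t y : 0 < t -> `|damp t y| <= `|y|.
Proof.
move=> t0; have /andP[r0 r1] := ratio01 y t0.
by rewrite normrM (ger0_norm r0) ler_piMr.
Qed.

Lemma damp_bounded t y : 0 < t -> `|damp t y| <= t.
Proof.
move=> t0; have /andP[r0 r1] := ratio01 y t0.
rewrite /damp normrM (ger0_norm r0) mulrA ler_pdivrMr ?den_gt0 //.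
rewrite [t ^+ 2 in leLHS]expr2 mulrCA ler_pM2l // mulrC.
have := den_ge t y; have : 0 <= t * `|y| by rewrite mulr_ge0 // ltW.
by lra.
Qed.

Lemma damp_dist t y : 0 < t -> `|y - damp t y| <= y ^+ 2 / (2 * t).
Proof.
move=> t0; have d0 := den_gt0 y t0.
have -> : y - damp t y = y ^+ 2 * y / (t ^+ 2 + y ^+ 2).
  by rewrite /damp; field; rewrite gt_eqF.
rewrite normrM normfV normrM (ger0_norm (sqr_ge0 y)) (gtr0_norm d0).
rewrite -mulrA ler_wpM2l ?sqr_ge0 // ler_pdivrMr // ler_pdivlMl ?mulr_gt0 //.
by rewrite -mulrA; exact: den_ge.
Qed.

Lemma damp_ge0 t y : 0 < t -> 0 <= y -> 0 <= damp t y.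
Proof. by move=> t0 y0; have /andP[r0 r1] := ratio01 y t0; rewrite mulr_ge0. Qed.

Lemma damp_cvg y : damp n.+1%:R y @[n --> \oo] --> y.
Proof.
apply/cvgrPdist_le => e e0.
have cv : y ^+ 2 * n.+1%:R^-1 @[n --> \oo] --> (y ^+ 2 * 0 : R).
  by apply: cvgMr; exact: cvg_harmonic.
rewrite mulr0 in cv.
have E : \forall n \near \oo, y ^+ 2 * n.+1%:R^-1 < e by move: e0; apply: cvgr_lt.
apply: filterS E => n En; apply: le_trans (damp_dist _ _) _ => //.
apply: le_trans (ltW En); rewrite ler_wpM2l ?sqr_ge0 // lef_pV2 ?posrE ?mulr_gt0 //.
by rewrite ler_peMl // ler1n.
Qed.

Lemma damp_continuous t k : 0 < t -> continuous (fun x : R => damp t (x ^+ k)).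
Proof.
move=> t0 x; rewrite /damp; apply: cvgM; first exact: exprn_continuous.
apply: cvgM; first exact: cvg_cst.
apply: cvgV; first by rewrite gt_eqF // den_gt0.
apply: cvgD; first exact: cvg_cst.
rewrite -exprM; under eq_fun do rewrite -exprM.
exact: exprn_continuous.
Qed.

End Damping.

Section UltraMoments.
Variables (R : realType) (S : nat -> seq R) (m : nat -> R) (U : set_system nat).
Local Notation mR := (measurableTypeR R).
Hypothesis FU : UltraFilter U.
Hypothesis Uoo : \oo `<=` U.
Hypothesis S0 : forall j, S j != [::].
Hypothesis Sm : forall k, avg (S j) (fun x => x ^+ k) @[j --> \oo] --> m k.
Variable mu : probability mR R.
Hypothesis mu_lim : forall f, continuous f -> bounded_fun f ->
    avg (S j) f @[j --> U] --> \int[mu]_x f x.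

Let cvgU (u : nat -> R) (l : R) : u j @[j --> \oo] --> l -> u j @[j --> U] --> l.
Proof. by move=> ul; apply: cvg_trans ul; exact: cvg_app. Qed.

Let mdamp (n k : nat) : measurable_fun setT (fun x : mR => damp n.+1%:R (x ^+ k)).
Proof. by apply: continuous_measurable_fun; exact: damp_continuous. Qed.

Let idamp (n k : nat) : mu.-integrable setT (EFin \o (fun x : mR => damp n.+1%:R (x ^+ k))).
Proof.
by apply: (@bounded_integrable _ _ _ mu _ n.+1%:R) => // x; exact: damp_bounded.
Qed.

Let damp_lim (n k : nat) : avg (S j) (fun x => damp n.+1%:R (x ^+ k)) @[j --> U] -->
  \int[mu]_x damp n.+1%:R (x ^+ k).
Proof.
apply: mu_lim; first exact: damp_continuous.
exists n.+1%:R; split; first exact: num_real.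
by move=> M nM x _; apply: le_trans (damp_bounded _ _) (ltW nM).
Qed.

(** The convergence along U is known for bounded functions only; Fatou's lemma then lets the level
    of truncation grow. *)
Let sqr_moment k : (\int[mu]_x (x ^+ k ^+ 2)%:E <= (m (k * 2))%:E)%E.
Proof.
apply: (@fatou_bound _ _ _ mu (fun n x => damp n.+1%:R (x ^+ (k * 2)))) => //.
- by move=> n x; apply: damp_ge0 => //; rewrite exprM sqr_ge0.
- by move=> x; rewrite -exprM; exact: damp_cvg.
move=> n; rewrite -[leLHS]fineK; last exact: (integrable_fin_num measurableT (idamp n (k * 2))).
rewrite lee_fin; apply: ler_cvg_to (damp_lim (n := n) (k := k * 2)) (cvgU (Sm (k := k * 2))) _.
apply: nearW => j; apply: le_avg => x; apply: le_trans (ler_norm _) _.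
apply: le_trans (damp_le _ _) _ => //.
by rewrite ger0_norm // exprM sqr_ge0.
Qed.

Lemma ultra_limit_finite_moments : finite_moments mu.
Proof.
move=> k; have i2 : mu.-integrable setT (EFin \o (fun x : mR => (x ^+ k) ^+ 2)).
  apply/integrableP; split.
    by apply/measurable_EFinP; apply: measurable_funX; exact: exprn_measurable.
  apply: le_lt_trans (ltry (m (k * 2))); apply: le_trans (sqr_moment k).
  rewrite le_eqVlt; apply/orP; left; apply/eqP; apply: eq_integral => x _.
  by rewrite /= ger0_norm ?sqr_ge0.
apply: (@le_integrableR _ _ _ mu _ (fun x => 1 + (x ^+ k) ^+ 2)).
- exact: exprn_measurable.
- move=> x; rewrite -(real_normK (num_real (x ^+ k))).
  have := sqr_ge0 (`|x ^+ k| - 2^-1); rewrite sqrrB.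
  by move: (`|x ^+ k|) => q; lra.
have i1 : mu.-integrable setT (EFin \o (fun=> 1 : R)).
  by apply: (@bounded_integrable _ _ _ mu _ `|1|).
exact: (integrableD measurableT i1 i2).
Qed.

(** The moment of order 2k bounds the truncation error on x^k uniformly in j, which allows the
    limits in j and in the truncation to be exchanged. *)
Lemma ultra_limit_moment k : moment mu k = m k.
Proof.
have fm := ultra_limit_finite_moments.
have cv : \int[mu]_x damp n.+1%:R (x ^+ k) @[n --> \oo] --> \int[mu]_x (x ^+ k).
  apply: (@Rintegral_dct _ _ _ mu (fun n x => damp n.+1%:R (x ^+ k)) _ (fun x => `|x ^+ k|)) => //.
  - by move=> x; exact: damp_cvg.
  - exact: (integrable_norm (fm k)).
  - by move=> n x; exact: damp_le.
have bd n : `|m k - \int[mu]_x damp n.+1%:R (x ^+ k)| <= m (k * 2) * n.+1%:R^-1.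
  have c1 : `|avg (S j) (fun x => x ^+ k) - avg (S j) (fun x => damp n.+1%:R (x ^+ k))| @[j --> U]
      --> `|m k - \int[mu]_x damp n.+1%:R (x ^+ k)|.
    by apply: cvg_norm; apply: cvgB; [apply: cvgU; exact: Sm | exact: damp_lim].
  have c2 : avg (S j) (fun x => x ^+ (k * 2)) * n.+1%:R^-1 @[j --> U] --> m (k * 2) * n.+1%:R^-1.
    by apply: cvgMl; apply: cvgU; exact: Sm.
  apply: ler_cvg_to c1 c2 _; apply: nearW => j.
  rewrite -avgB mulrC -avgZ; apply: le_trans (norm_avg _ _) _; apply: le_avg => x.
  apply: le_trans (damp_dist _ _) _ => //; rewrite mulrC exprM ler_wpM2r ?sqr_ge0 //.
  by rewrite lef_pV2 ?posrE ?mulr_gt0 // ler_peMl // ler1n.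
have cv2 : \int[mu]_x damp n.+1%:R (x ^+ k) @[n --> \oo] --> m k.
  apply/cvgrPdist_le => e e0.
  have c : m (k * 2) * n.+1%:R^-1 @[n --> \oo] --> m (k * 2) * 0.
    by apply: cvgMr; exact: cvg_harmonic.
  rewrite mulr0 in c.
  have E : \forall n \near \oo, m (k * 2) * n.+1%:R^-1 < e by move: e0; apply: cvgr_lt.
  by apply: filterS E => n En; apply: le_trans (bd n) (ltW En).
by rewrite /moment; apply: (cvg_unique _ cv cv2).
Qed.

End UltraMoments.

Section MomentMethod.
Variables (R : realType) (m : nat -> R) (B C : R).
Local Notation mR := (measurableTypeR R).
Hypotheses (B0 : 0 <= B) (C0 : 0 <= C).
Hypothesis growth : forall k, m k <= B * C ^+ k * k`!%:R.

(** A condition on a finite list, which keeps the limiting argument free of probability. *)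
Definition moments_close (K : nat) (delta : R) (s : seq R) : Prop :=
  s != [::] /\ forall k, (k <= K)%N -> `|avg s (fun x => x ^+ k) - m k| <= delta.

Lemma moments_close_cvg (S : nat -> seq R) : (forall j, moments_close j j.+1%:R^-1 (S j)) ->
  forall k, avg (S j) (fun x => x ^+ k) @[j --> \oo] --> m k.
Proof.
move=> H k; apply/cvgrPdist_le => e e0.
have E : \forall n \near \oo, n.+1%:R^-1 < e :> R.
  by move: e0; apply: cvgr_lt; exact: cvg_harmonic.
near=> j; rewrite distrC; have [_ Hj] := H j; apply: le_trans (Hj k _) _.
  by near: j; exact: nbhs_infty_ge.
by apply: ltW; near: j.
Unshelve. all: by end_near. Qed.

Lemma ultra_limit_exists (S : nat -> seq R) : (forall j, moments_close j j.+1%:R^-1 (S j)) ->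
  exists (U : set_system nat) (mu : probability mR R), [/\ UltraFilter U, \oo `<=` U,
    finite_moments mu, forall k, moment mu k = m k &
    forall f, continuous f -> bounded_fun f -> avg (S j) f @[j --> U] --> \int[mu]_x f x].
Proof.
move=> H; have Sm := moments_close_cvg H.
have S0 j : S j != [::] by case: (H j).
have [U [FU Uoo]] := @ultraFilterLemma nat \oo _.
have [mu mulim] := ultra_limit_law FU Uoo S0 Sm.
exists U, mu; split => //.
  exact: (ultra_limit_finite_moments FU Uoo Sm mulim).
exact: (ultra_limit_moment FU Uoo Sm mulim).
Qed.

(** For each j, take a list whose moments of order at most j are right up to 1/(j+1), and pass to a
    limit along an ultrafilter. *)
Lemma moment_law_exists : (forall K delta, 0 < delta -> exists s, moments_close K delta s) ->
  exists mu : probability mR R, finite_moments mu /\ forall k, moment mu k = m k.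
Proof.
move=> H; have H' (j : nat) : exists s, moments_close j j.+1%:R^-1 s by apply: H; rewrite invr_gt0.
have [S HS] := choice H'.
have [U [mu [_ _ fm mm _]]] := ultra_limit_exists HS.
by exists mu.
Qed.

(* Otherwise a sequence of counterexamples has, along an ultrafilter, a limit
   law with the same moments, hence equal to mu. *)
Lemma moment_method (mu : probability mR R) : finite_moments mu -> (forall k, moment mu k = m k) ->
  forall f eps, continuous f -> bounded_fun f -> 0 < eps ->
  exists K delta, 0 < delta /\
    forall s, moments_close K delta s -> `|avg s f - \int[mu]_x f x| <= eps.
Proof.
move=> fm mm f eps cf bf e0; apply: contrapT => Hno.
have H' (j : nat) : exists s, moments_close j j.+1%:R^-1 s /\ eps < `|avg s f - \int[mu]_x f x|.
  apply: contrapT => Hs; apply: Hno; exists j, j.+1%:R^-1; split; first by rewrite invr_gt0.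
  by move=> s cs; rewrite leNgt; apply/negP => lt; apply: Hs; exists s.
have [S HS] := choice H'.
have [U [nu [FU Uoo fn mn nulim]]] := ultra_limit_exists (fun j => proj1 (HS j)).
have Hg k : moment mu k <= B * C ^+ k * k`!%:R by rewrite mm.
have E k : moment nu k = moment mu k by rewrite mm mn.
have eqm := moment_determinacy fm fn B0 C0 Hg E.
have intE : \int[nu]_x f x = \int[mu]_x f x.
  by rewrite /Rintegral; congr fine; apply: eq_measure_integral => A mA _; exact: eqm.
have := nulim f cf bf; rewrite intE => /cvgrPdist_lt /(_ eps e0) near_small.
have [j Hj] := filter_ex near_small.
by have [_] := HS j; rewrite distrC ltNge (ltW Hj).
Qed.

End MomentMethod.

(** * The spectrum of a symmetric matrix *)

Section Spectrum.
Variable R : realType.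

Lemma char_poly_similar (F : fieldType) n (P D : 'M[F]_n) : P \in unitmx ->
  char_poly (invmx P *m D *m P) = char_poly D.
Proof.
move=> Pu; rewrite /char_poly.
have -> : char_poly_mx (invmx P *m D *m P) =
    map_mx polyC (invmx P) *m char_poly_mx D *m map_mx polyC P.
  rewrite /char_poly_mx !map_mxM mulmxBr mulmxBl; congr (_ - _).
  by rewrite scalar_mxC -mulmxA -map_mxM mulVmx // map_mx1 mulmx1.
rewrite !det_mulmx mulrC mulrA -det_mulmx -map_mxM mulmxV // map_mx1 det1 mul1r.
by [].
Qed.

Lemma exprmx_similar (F : fieldType) n (P D : 'M[F]_n) k : P \in unitmx ->
  (invmx P *m D *m P) ^+ k = invmx P *m D ^+ k *m P.
Proof.
move=> Pu; elim: k => [|k IH]; first by rewrite !expr0 mulmx1 mulVmx.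
rewrite !exprS IH -!mulmxE !mulmxA; congr (_ *m _ *m _).
by rewrite -[_ *m P *m invmx P]mulmxA mulmxV // mulmx1.
Qed.

Lemma exprmx_diag (F : comNzRingType) n (d : 'rV[F]_n) k :
  diag_mx d ^+ k = diag_mx (map_mx (fun x => x ^+ k) d).
Proof.
elim: k => [|k IH].
  by rewrite expr0; apply/matrixP => i j; rewrite !mxE expr0.
rewrite exprS IH -mulmxE mulmx_diag; congr diag_mx.
by apply/rowP => i; rewrite !mxE exprS.
Qed.

(** The spectral theorem is applied over the complex numbers; the eigenvalues being real, the
    factorisation descends to R by injectivity of the embedding. *)
Lemma symmetric_char_poly n (W : 'M[R]_n) : W^T = W ->
  exists r : 'rV[R]_n, char_poly W = \prod_i ('X - (r 0 i)%:P) /\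
    forall k, \tr (W ^+ k) = \sum_i r 0 i ^+ k.
Proof.
move=> sW; pose f := real_complex R; pose A := map_mx f W.
have realA : A \is a realmx.
  apply/mxOverP => i j; rewrite mxE; apply/CrealP.
  by rewrite /f; apply/eqP; rewrite eq_complex /= oppr0 !eqxx.
have hA : A \is hermsymmx.
  apply: realsym_hermsym realA; apply/is_hermitianmxP.
  by rewrite expr0 scale1r; apply/matrixP => i j; rewrite !mxE /= -[in LHS]sW mxE.
have dreal := hermitian_spectral_diag_real hA.
have /hermitian_normalmx /orthomx_spectralP AE := hA.
set P := spectralmx A in AE; set d := spectral_diag A in AE dreal.
have Pu : P \in unitmx := spectral_unit A.
pose r := map_mx (@complex.Re R) d.
have dr : d = map_mx f r.
  apply/rowP => i; rewrite !mxE; have /mxOverP /(_ 0 i) := dreal.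
  by move=> /Creal_ReP H; rewrite /f complexRe H.
exists r; split.
  apply: (map_poly_inj f); rewrite map_char_poly -/A AE char_poly_similar //.
  rewrite char_poly_trig ?diag_mx_is_trig // rmorph_prod; apply: eq_bigr => i _.
  by rewrite rmorphB /= map_polyX map_polyC /= dr !mxE eqxx mulr1n.
move=> k; apply: (@complexI R); rewrite -/f.
have -> : f (\tr (W ^+ k)) = \tr (A ^+ k).
  rewrite /f /A /f -(trace_map_mx (real_complex R)); congr (\tr _); elim: k => [|k IH].
    by rewrite !expr0 map_mx1.
  by rewrite !exprS -!mulmxE map_mxM IH.
rewrite AE exprmx_similar // mxtrace_mulC mulmxA mulmxV // mul1mx exprmx_diag mxtrace_diag.
rewrite /f (rmorph_sum (real_complex R)); apply: eq_bigr => i _.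
by rewrite !mxE dr !mxE rmorphXn.
Qed.

Lemma mup_prod_XsubC (s : seq R) x : mup x (\prod_(y <- s) ('X - y%:P)) = count_mem x s.
Proof.
elim: s => [|y s IH]; first by rewrite big_nil mupNroot // root1.
rewrite big_cons mupM ?polyXsubC_eq0 ?monic_neq0 ?monic_prod_XsubC //.
by rewrite IH -['X - y%:P]expr1 mup_XsubCX /= eq_sym; case: eqP.
Qed.

Lemma perm_spectrum n (W : 'M[R]_n) (s : seq R) :
  char_poly W = \prod_(y <- s) ('X - y%:P) -> perm_eq (spectrum W) s.
Proof.
move=> E; rewrite /spectrum E; set p := \prod_(y <- s) _.
have p0 : p != 0 by rewrite monic_neq0 // monic_prod_XsubC.
have ur : uniq (rootsR p) by exact: uniq_roots.
have mr x : (x \in rootsR p) = (x \in s).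
  by have /(_ x) := roots_on_rootsR p0; rewrite in_itv /= root_prod_XsubC => ->.
apply: perm_trans (perm_count_undup s).
under eq_map do rewrite mup_prod_XsubC.
by apply: perm_flatten; apply: perm_map; apply: uniq_perm; rewrite ?undup_uniq // => x;
  rewrite mem_undup mr.
Qed.

Lemma spectrum_trace n (W : 'M[R]_n) : W^T = W ->
  size (spectrum W) = n /\ forall k, \sum_(x <- spectrum W) x ^+ k = \tr (W ^+ k).
Proof.
move=> /symmetric_char_poly[r [cr tr]].
have pe : perm_eq (spectrum W) [seq r 0 i | i <- index_enum 'I_n].
  by apply: perm_spectrum; rewrite big_map.
split; first by rewrite (perm_size pe) size_map -[RHS](card_ord n) cardE enumT.
by move=> k; rewrite (perm_big _ pe) big_map tr.
Qed.

Lemma spectral_measure_integral_ge0 n (W : 'M[R]_n) (g : R -> R) : (forall x, 0 <= g x) ->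
  measurable_fun setT (g : measurableTypeR R -> R) ->
  (\int[spectral_measure W]_x (g x)%:E = (n%:R^-1 * \sum_(x <- spectrum W) g x)%:E)%E.
Proof.
move=> g0 mg; have mg' : measurable_fun setT (EFin \o g : measurableTypeR R -> \bar R).
  exact/measurable_EFinP.
rewrite ge0_integral_mscale //; last by move=> x _; rewrite lee_fin.
rewrite ge0_integral_measure_sum //; last by move=> x _; rewrite lee_fin.
rewrite EFinM; congr (_ * _)%E; rewrite (big_nth 0) big_mkord -sumEFin.
by apply: eq_bigr => i _; rewrite integral_dirac // diracT mul1e.
Qed.

Lemma spectral_measure_integral n (W : 'M[R]_n) (f : R -> R) : W^T = W ->
  measurable_fun setT (f : measurableTypeR R -> R) ->
  \int[spectral_measure W]_x f x = avg (spectrum W) f.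
Proof.
move=> sW mf; have [sz _] := spectrum_trace sW.
rewrite /Rintegral integralE.
rewrite (funerpos f) (funerneg f) !spectral_measure_integral_ge0; last 4 first.
- exact: funrneg_ge0.
- exact: measurable_funrneg.
- exact: funrpos_ge0.
- exact: measurable_funrpos.
rewrite -EFinB /= -mulrBr -sumrB /avg sz mulrC; congr (_ / _); apply: eq_bigr => x _.
by rewrite -[in RHS](funrposBneg f).
Qed.

End Spectrum.

Import HBNNSimple.

(** * Moments of products of independent variables *)

Section Independence.
Context (d : measure_display) (T : measurableType d) (R : realType) (Pr : probability T R).
Local Notation mR := (measurableTypeR R).

(** The hypothesis on indicators extends to simple functions by linearity. Fatou's lemma then makes
    the product integrable, after which dominated convergence gives the equality. *)
Lemma indep_factor_ge0 (Z : T -> R) (Y : T -> mR) (K : R) (f : mR -> R) :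
  measurable_fun setT Y -> (forall w, 0 <= Z w) -> Pr.-integrable setT (EFin \o Z) ->
  (forall B : set mR, measurable B ->
     \int[Pr]_w (Z w * \1_B (Y w)) = K * \int[Pr]_w \1_B (Y w)) ->
  0 <= K -> (forall y, 0 <= f y) -> measurable_fun setT f ->
  Pr.-integrable setT (EFin \o (f \o Y)) ->
  Pr.-integrable setT (EFin \o (fun w => Z w * f (Y w))) /\
  \int[Pr]_w (Z w * f (Y w)) = K * \int[Pr]_w f (Y w).
Proof.
move=> mY Z0 iZ HB K0 f0 mf if_.
have mZ : measurable_fun setT Z by apply/measurable_EFinP; exact: (measurable_int _ iZ).
have mfE : measurable_fun setT (EFin \o f) by exact/measurable_EFinP.
pose phi n := nnsfun_approx measurableT mfE n.
have phi_cvg (y : mR) : phi n y @[n --> \oo] --> f y.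
  have : (phi n y)%:E @[n --> \oo] --> (f y)%:E.
    by apply: cvg_nnsfun_approx => // z _; rewrite lee_fin.
  by move/fine_cvg.
have phi_le n (y : mR) : phi n y <= f y.
  have nd : nondecreasing_seq (phi ^~ y).
    by move=> i j ij; have /lefP := nd_nnsfun_approx measurableT mfE ij; apply.
  by have := nondecreasing_cvgn_le nd (cvgP _ (phi_cvg y)) n; rewrite (cvg_lim _ (phi_cvg y)).
have phi0 n (y : mR) : 0 <= phi n y by [].
have mphi n : measurable_fun setT (phi n : mR -> R) by exact: measurable_funP.
have mind (B : set mR) : measurable B -> measurable_fun setT (fun w => \1_B (Y w) : R).
  by move=> mB; apply: measurableT_comp => //; exact: measurable_indic.
have iind (B : set mR) : measurable B -> Pr.-integrable setT (EFin \o (fun w => \1_B (Y w) : R)).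
  move=> mB; apply: (@bounded_integrable _ _ _ Pr _ 1); first exact: mind.
  by move=> w; rewrite indicE; case: (_ \in _); rewrite ?normr1 // normr0.
have iZind (B : set mR) : measurable B -> Pr.-integrable setT (EFin \o (fun w => Z w * \1_B (Y w))).
  move=> mB; apply: (@le_integrableR _ _ _ Pr _ Z) => //.
    by apply: measurable_funM => //; exact: mind.
  by move=> w; rewrite normrM (ger0_norm (Z0 w)) ler_piMr // indicE; case: (_ \in _);
    rewrite ?normr1 // normr0.
have iZl c (g : T -> R) : Pr.-integrable setT (EFin \o g) ->
    Pr.-integrable setT (EFin \o (fun w => c * g w)).
  move=> ig; have -> : EFin \o (fun w => c * g w) = (fun w => c%:E * (g w)%:E)%E.
    by apply/funext => w; rewrite /= EFinM.
  exact: integrableZl.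
have simple n : \int[Pr]_w (Z w * phi n (Y w)) = K * \int[Pr]_w phi n (Y w).
  pose s := fset_set (phi n @` setT).
  have pE y := fimfunEord (phi n) y; rewrite -/s in pE.
  have mpre y : measurable (phi n @^-1` [set y] : set mR) by exact: measurable_sfunP.
  under eq_Rintegral do rewrite pE mulr_sumr.
  under [in RHS]eq_Rintegral do rewrite pE.
  rewrite (@eq_Rintegral _ _ _ Pr setT (fun w => \sum_(i < #|`s|) s`_i * (Z w * \1_(phi n @^-1` [set s`_i]) (Y w)))).
    rewrite (Rintegral_sum _ (fun i : 'I_#|`s| => iZl s`_i _ (iZind _ (mpre s`_i)))).2.
    rewrite (Rintegral_sum _ (fun i : 'I_#|`s| => iZl s`_i _ (iind _ (mpre s`_i)))).2 mulr_sumr.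
    apply: eq_bigr => i _; rewrite !RintegralZl //; [|exact: iind|exact: iZind].
    by rewrite HB // mulrCA.
  by move=> w _; apply: eq_bigr => i _; rewrite mulrCA.
have mZphi n : measurable_fun setT (fun w => Z w * phi n (Y w)).
  by apply: measurable_funM => //; exact: measurableT_comp.
have mphiY n : measurable_fun setT (fun w => phi n (Y w)) by exact: measurableT_comp.
have cvZ w : Z w * phi n (Y w) @[n --> \oo] --> Z w * f (Y w) by apply: cvgMr; exact: phi_cvg.
have iphi n : Pr.-integrable setT (EFin \o (fun w => phi n (Y w))).
  by apply: (@le_integrableR _ _ _ Pr _ (f \o Y)) => // w; rewrite ger0_norm.
have mZf : measurable_fun setT (fun w => Z w * f (Y w)).
  by apply: measurable_funM => //; exact: measurableT_comp.
have bound : (\int[Pr]_w (Z w * f (Y w))%:E <= (K * \int[Pr]_w f (Y w))%:E)%E.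
  apply: (@fatou_bound _ _ _ Pr (fun n w => Z w * phi n (Y w))) => //.
    by move=> n w; rewrite mulr_ge0.
  move=> n.
  have [i1 i2] : Pr.-integrable setT (EFin \o (fun w => Z w * phi n (Y w))) /\ True.
    split => //; pose s := fset_set (phi n @` setT).
    have pE y := fimfunEord (phi n) y; rewrite -/s in pE.
    have mpre y : measurable (phi n @^-1` [set y] : set mR) by exact: measurable_sfunP.
    rewrite (_ : (fun w => _) = (fun w => \sum_(i < #|`s|) s`_i * (Z w * \1_(phi n @^-1` [set s`_i]) (Y w)))).
      exact: (Rintegral_sum _ (fun i : 'I_#|`s| => iZl s`_i _ (iZind _ (mpre s`_i)))).1.
    by apply/funext => w; rewrite pE mulr_sumr; apply: eq_bigr => i _; rewrite mulrCA.
  rewrite -[leLHS]fineK; last exact: (integrable_fin_num measurableT i1).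
  by rewrite lee_fin [leLHS]simple ler_wpM2l //; apply: le_Rintegral.
have iZf : Pr.-integrable setT (EFin \o (fun w => Z w * f (Y w))).
  apply/integrableP; split; first exact/measurable_EFinP.
  apply: le_lt_trans (ltry (K * \int[Pr]_w f (Y w))); apply: le_trans bound.
  rewrite le_eqVlt; apply/orP; left; apply/eqP; apply: eq_integral => w _.
  by rewrite /= ger0_norm // mulr_ge0.
split => //.
have c1 : \int[Pr]_w (Z w * phi n (Y w)) @[n --> \oo] --> \int[Pr]_w (Z w * f (Y w)).
  apply: (@Rintegral_dct _ _ _ Pr _ _ (fun w => Z w * f (Y w))) => // n w.
  by rewrite normrM !ger0_norm // ler_wpM2l.
have c2 : K * \int[Pr]_w phi n (Y w) @[n --> \oo] --> K * \int[Pr]_w f (Y w).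
  apply: cvgMr; apply: (@Rintegral_dct _ _ _ Pr (fun n w => phi n (Y w)) _ (f \o Y)) => // n w.
  by rewrite ger0_norm //=.
rewrite (_ : (fun n => \int[Pr]_w (Z w * phi n (Y w))) = (fun n => K * \int[Pr]_w phi n (Y w))) in c1.
  exact: cvg_unique c1 c2.
by apply/funext => n; exact: simple.
Qed.

End Independence.

Section IndependentProducts.
Context (d : measure_display) (T : measurableType d) (R : realType) (Pr : probability T R).
Local Notation mR := (measurableTypeR R).
Variables (I : finType) (X : I -> {RV Pr >-> mR}).
Hypothesis indX : mutually_independent X.
Implicit Types (r s : seq I) (g : I -> mR -> R) (i j : I).

Let pr s g (w : T) : R := \prod_(i <- s) g i (X i w).
Let mean g i : R := \int[Pr]_w g i (X i w).
(** The functions are changed one index at a time: from indicators, where factorisation is the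
    definition of independence, to nonnegative and then to signed ones. *)
Let upd g i (f : mR -> R) j := if j == i then f else g j.

Definition factorizes s g := Pr.-integrable setT (EFin \o pr s g) /\
  \int[Pr]_w pr s g w = \prod_(i <- s) mean g i.

Let mX i : measurable_fun setT (X i : T -> mR). Proof. exact: measurable_funP. Qed.

Let pr_perm r s g : perm_eq r s -> pr r g = pr s g.
Proof. by move=> rs; apply/funext => w; apply: perm_big. Qed.

Let pr_upd s g i f : i \notin s -> pr (i :: s) (upd g i f) = (fun w => f (X i w) * pr s g w).
Proof.
move=> si; apply/funext => w; rewrite /pr big_cons /upd eqxx; congr (_ * _).
by apply: eq_big_seq => j js; case: eqP => // ji; rewrite -ji js in si.
Qed.

Let mean_upd s g i f : i \notin s ->
  \prod_(j <- i :: s) mean (upd g i f) j = (\int[Pr]_w f (X i w)) * \prod_(j <- s) mean g j.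
Proof.
move=> si; rewrite big_cons /mean /upd eqxx; congr (_ * _).
by apply: eq_big_seq => j js; case: eqP => // ji; rewrite -ji js in si.
Qed.

Let mean_indic i (B : set mR) : measurable B ->
  \int[Pr]_w \1_B (X i w) = fine (Pr (X i @^-1` B)).
Proof.
move=> mB; rewrite /Rintegral; congr fine.
rewrite (eq_integral (fun w => (\1_(X i @^-1` B) w)%:E)) => [|w _].
  by rewrite integral_indic ?setIT // -[X in measurable X]setTI; exact: mX.
by rewrite !indicE; congr (nat_of_bool _)%:R%:E; apply/idP/idP; rewrite !inE.
Qed.

Let factorizes_indic s g : uniq s ->
  (forall i, i \in s -> exists2 B : set mR, measurable B & g i = \1_B) -> factorizes s g.
Proof.
move=> us H.
have H' i : exists B : set mR, measurable B /\ (i \in s -> g i = \1_B).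
  case: (boolP (i \in s)) => [/H[B mB gB]|_]; first by exists B.
  by exists setT; split => //; exact: measurableT.
have [B HB] := choice H'.
have mB i : measurable (B i) by case: (HB i).
pose J := [set i in s]%SET.
pose S := \bigcap_(i in [set` J]) (X i @^-1` B i).
have mpre i : measurable (X i @^-1` B i) by rewrite -[X in measurable X]setTI; exact: mX.
have mS : measurable S by apply: fin_bigcap_measurable.
have prE : pr s g = \1_S.
  apply/funext => w; rewrite indicE; case: (pselect (S w)) => wS.
    rewrite mem_set //; apply: big1_seq => i /andP[_ si]; have [_ /(_ si) ->] := HB i.
    by rewrite indicE mem_set //; apply: (wS i); rewrite /= inE.
  have [i [si nB]] : exists i, i \in s /\ ~ B i (X i w).
    apply: contrapT => no; apply: wS => i; rewrite /= inE => si.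
    by apply: contrapT => nB; apply: no; exists i.
  rewrite [in RHS]memNset // /pr (big_rem i) //=; have [_ /(_ si) ->] := HB i.
  by rewrite indicE memNset ?mul0r.
split.
  apply: (@bounded_integrable _ _ _ Pr _ 1); rewrite prE; first exact: measurable_indic.
  by move=> w; rewrite indicE; case: (_ \in _); rewrite ?normr1 // normr0.
transitivity (fine (\prod_(i in J) Pr (X i @^-1` B i))%E).
  by rewrite prE /Rintegral integral_indic // setIT; congr fine; exact: indX.
have -> : (\prod_(i in J) Pr (X i @^-1` B i) = (\prod_(i in J) fine (Pr (X i @^-1` B i)))%:E)%E.
  rewrite -prodEFin; apply: eq_bigr => i _; rewrite fineK //.
  exact: fin_num_measure.
rewrite /= (eq_bigl (mem s)); last by move=> i; rewrite inE.
rewrite -big_uniq //; apply: eq_big_seq => i si; rewrite /mean.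
by have [_ /(_ si) ->] := HB i; rewrite mean_indic.
Qed.

(** The induction hypothesis for [i :: s], with an indicator put at [i], is what [indep_factor_ge0]
    needs to pass to a nonnegative function at [i]. *)
Let factorizes_ge0 r s g : uniq (r ++ s) ->
  (forall i, i \in r -> [/\ measurable_fun setT (g i), forall y, 0 <= g i y &
     Pr.-integrable setT (EFin \o (fun w => g i (X i w)))]) ->
  (forall i, i \in s -> exists2 B : set mR, measurable B & g i = \1_B) ->
  factorizes (r ++ s) g.
Proof.
elim: r s g => [|i r IH] s g; first by move=> us _; exact: factorizes_indic.
rewrite /= => /andP[irs urs] Hr Hs.
have Hr' j : j \in r -> [/\ measurable_fun setT (g j), forall y, 0 <= g j y &
     Pr.-integrable setT (EFin \o (fun w => g j (X j w)))].
  by move=> jr; apply: Hr; rewrite in_cons jr orbT.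
have [iZ EZ] := IH s g urs Hr' Hs.
have [mf f0 if_] := Hr i (mem_head i r).
have g0 j y : j \in r ++ s -> 0 <= g j y.
  rewrite mem_cat => /orP[/Hr'[_ + _]|/Hs[B _ ->]]; first by apply.
  by rewrite indicE.
have Z0 w : 0 <= pr (r ++ s) g w.
  by rewrite /pr big_seq; apply: prodr_ge0 => j; exact: g0.
have K0 : 0 <= \prod_(j <- r ++ s) mean g j.
  rewrite big_seq; apply: prodr_ge0 => j js; apply: Rintegral_ge0 => w _; exact: g0.
have perm1 : perm_eq (r ++ i :: s) (i :: r ++ s) by rewrite -[i :: s]cat1s perm_catCA.
have HB (B : set mR) : measurable B ->
     \int[Pr]_w (pr (r ++ s) g w * \1_B (X i w)) =
     (\prod_(j <- r ++ s) mean g j) * \int[Pr]_w \1_B (X i w).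
  move=> mB; have := IH (i :: s) (upd g i \1_B) _ _ _.
  case.
  - by rewrite (perm_uniq perm1) /= irs.
  - move=> j jr; have ji : j != i by apply: contraNneq irs => <-; rewrite mem_cat jr.
    by rewrite /upd (negbTE ji); exact: Hr'.
  - move=> j; rewrite in_cons /upd; case: eqP => /= [_ _|_]; first by exists B.
    exact: Hs.
  rewrite (pr_perm _ perm1) (perm_big _ perm1) pr_upd // mean_upd // => _ E.
  by rewrite [RHS]mulrC -E; apply: eq_Rintegral => w _; rewrite mulrC.
have [i1 i2] := indep_factor_ge0 (mX i) Z0 iZ HB K0 f0 mf if_.
have prE : pr (i :: r ++ s) g = (fun w => pr (r ++ s) g w * g i (X i w)).
  by apply/funext => w; rewrite /pr big_cons mulrC.
by split; rewrite prE // i2 big_cons mulrC.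
Qed.

(** One signed function is split into its positive and negative parts; for each of them the index
    moves from [r] to [s] and the induction hypothesis applies. *)
Let factorizes_signed r s g : uniq (r ++ s) ->
  (forall i, i \in r ++ s -> measurable_fun setT (g i) /\
     Pr.-integrable setT (EFin \o (fun w => g i (X i w)))) ->
  (forall i, i \in s -> forall y, 0 <= g i y) ->
  factorizes (r ++ s) g.
Proof.
elim: r s g => [|i r IH] s g.
  move=> us Hm H0; have := @factorizes_ge0 s [::] g; rewrite cats0; apply => //.
  by move=> i si; have [m1 m2] := Hm i si; split => // y; exact: H0.
rewrite /= => /andP[irs urs] Hm H0.
have perm1 : perm_eq (r ++ i :: s) (i :: r ++ s) by rewrite -[i :: s]cat1s perm_catCA.
have [mi ii] := Hm i (mem_head i _).
have part (f : mR -> R) : measurable_fun setT f -> (forall y, 0 <= f y) ->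
    Pr.-integrable setT (EFin \o (fun w => f (X i w))) ->
    Pr.-integrable setT (EFin \o (fun w => f (X i w) * pr (r ++ s) g w)) /\
    \int[Pr]_w (f (X i w) * pr (r ++ s) g w) =
      (\int[Pr]_w f (X i w)) * \prod_(j <- r ++ s) mean g j.
  move=> mf f0 if_; have := IH (i :: s) (upd g i f) _ _ _; case.
  - by rewrite (perm_uniq perm1) /= irs.
  - move=> j; rewrite (perm_mem perm1) in_cons /upd; case: eqP => /= [-> //|_ jrs].
    by apply: Hm; rewrite in_cons jrs orbT.
  - move=> j; rewrite in_cons /upd; case: eqP => [_ _ y|_ /= js y]; first exact: f0.
    exact: H0.
  by rewrite (pr_perm _ perm1) (perm_big _ perm1) pr_upd // mean_upd.
have le_part (f : mR -> R) : measurable_fun setT f -> (forall y, `|f y| <= `|g i y|) ->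
    Pr.-integrable setT (EFin \o (fun w => f (X i w))).
  move=> mf fg; apply: (@le_integrableR _ _ _ Pr _ (fun w => `|g i (X i w)|)) => //.
    exact: measurableT_comp.
  exact: (integrable_norm ii).
have mp : measurable_fun setT (g i)^\+ by exact: measurable_funrpos.
have mn : measurable_fun setT (g i)^\- by exact: measurable_funrneg.
have pn y : `|g i y| = (g i)^\+ y + (g i)^\- y by rewrite -[RHS]/(((g i)^\+ + (g i)^\-) y) funrposDneg.
have ip : Pr.-integrable setT (EFin \o (fun w => (g i)^\+ (X i w))).
  by apply: le_part => // y; rewrite ger0_norm ?funrpos_ge0 // pn lerDl funrneg_ge0.
have in_ : Pr.-integrable setT (EFin \o (fun w => (g i)^\- (X i w))).
  by apply: le_part => // y; rewrite ger0_norm ?funrneg_ge0 // pn lerDr funrpos_ge0.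
have [p1 p2] := part _ mp (funrpos_ge0 _) ip.
have [n1 n2] := part _ mn (funrneg_ge0 _) in_.
have gE y : g i y = (g i)^\+ y - (g i)^\- y by rewrite -[in LHS](funrposBneg (g i)).
have prE : pr (i :: r ++ s) g = (fun w => (g i)^\+ (X i w) * pr (r ++ s) g w -
    (g i)^\- (X i w) * pr (r ++ s) g w).
  by apply/funext => w; rewrite /pr big_cons gE mulrBl.
split; rewrite prE; first exact: (integrableB measurableT p1 n1).
rewrite RintegralB // p2 n2 -mulrBl big_cons; congr (_ * _).
by rewrite -RintegralB //; apply: eq_Rintegral => w _; rewrite -gE.
Qed.

Lemma independent_product g :
  (forall i, measurable_fun setT (g i)) ->
  (forall i, Pr.-integrable setT (EFin \o (fun w => g i (X i w)))) ->
  Pr.-integrable setT (EFin \o (fun w => \prod_i g i (X i w))) /\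
  \int[Pr]_w (\prod_i g i (X i w)) = \prod_i \int[Pr]_w g i (X i w).
Proof.
move=> mg ig; have := @factorizes_signed (index_enum I) [::] g.
rewrite cats0; apply; first exact: index_enum_uniq.
- by move=> i _; split.
- by [].
Qed.

Variable mu : probability mR R.
Hypothesis lawX : forall i, has_law (X i) mu.
Hypothesis fmu : finite_moments mu.

Lemma law_moment i k : Pr.-integrable setT (EFin \o (fun w => X i w ^+ k)) /\
  \int[Pr]_w (X i w ^+ k) = moment mu k.
Proof.
have eqm A : measurable A -> A `<=` setT -> distribution Pr (X i) A = mu A.
  by move=> mA _; exact: lawX.
have mk : measurable_fun setT (fun x : mR => (x ^+ k)%:E).
  by apply/measurable_EFinP; exact: exprn_measurable.
have iD : (distribution Pr (X i)).-integrable setT (fun x : mR => (x ^+ k)%:E).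
  apply/integrableP; split => //; have /integrableP[_] := fmu k.
  by rewrite (eq_measure_integral _ eqm).
have iX : Pr.-integrable setT (EFin \o (fun w => X i w ^+ k)).
  apply/integrableP; split.
    by apply/measurable_EFinP; apply: measurable_funX; exact: mX.
  have /integrableP[_] := iD; rewrite ge0_integral_pushforward //.
  exact: measurableT_comp.
split => //; rewrite /moment /Rintegral; congr fine.
rewrite -(eq_measure_integral _ eqm) integral_pushforward //.
Qed.

End IndependentProducts.

(** * Traces as sums over walks *)

Section TraceWalks.
Variable R : realType.

Lemma sum_tupleS (A : nmodType) (V : finType) q (F : q.+1.-tuple V -> A) :
  \sum_t F t = \sum_(a : V) \sum_(t : q.-tuple V) F [tuple of a :: t].
Proof.
rewrite pair_big /=; rewrite (reindex (fun p : V * q.-tuple V => [tuple of p.1 :: p.2])) //=.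
exists (fun t => (thead t, [tuple of behead t])) => [[a t] _|t _] /=.
  by congr pair; apply: val_inj.
by rewrite -tuple_eta.
Qed.

(** Two steps from x to a to b contribute M x a and M b a: in both, the index at even position comes
    first, as in [steps]. *)
Lemma exprmx_walks N (M : 'M[R]_N) k x y :
  ((M *m M^T) ^+ k) x y = \sum_(s : (k.*2).-tuple 'I_N)
     (last x s == y)%:R * \prod_(e <- steps false x s) M e.1 e.2.
Proof.
elim: k x => [|k IH] x.
  rewrite expr0 mxE (big_pred1 [tuple]) => [|t]; last by apply/esym/eqP; apply: tuple0.
  by rewrite big_nil mulr1.
rewrite exprS -mulmxE mxE doubleS !sum_tupleS.
under eq_bigr do rewrite mxE mulr_suml; rewrite exchange_big /=.
apply: eq_bigr => a _; rewrite sum_tupleS; apply: eq_bigr => b _.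
rewrite IH mulr_sumr; apply: eq_bigr => s _ /=.
by rewrite !big_cons mxE /=; ring.
Qed.

Lemma trace_walks N (M : 'M[R]_N) k :
  \tr ((M *m M^T) ^+ k) = \sum_(v : (k.*2).+1.-tuple 'I_N | closed_word v)
     \prod_(e <- links v) M e.1 e.2.
Proof.
rewrite big_mkcond sum_tupleS /mxtrace; apply: eq_bigr => x _.
rewrite exprmx_walks; apply: eq_bigr => s _ /=.
by case: eqP => _; rewrite ?mul1r ?mul0r.
Qed.

(* Embedding X in Z makes rows and columns vertices of one and the same graph. *)
Lemma trace_block n m (X : 'M[R]_(n, m)) k (Z : 'M[R]_(n + m) := block_mx 0 X 0 0) :
  (0 < k)%N -> \tr ((Z *m Z^T) ^+ k) = \tr ((X *m X^T) ^+ k).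
Proof.
have ZE : Z *m Z^T = block_mx (X *m X^T) 0 0 0.
  by rewrite /Z tr_block_mx mulmx_block !trmx0 !(mulmx0, mul0mx, addr0, add0r).
(* For k = 0 the two traces would be n + m and n. *)
case: k => // k _; suff -> : (Z *m Z^T) ^+ k.+1 = block_mx ((X *m X^T) ^+ k.+1) 0 0 0.
  by rewrite mxtrace_block mxtrace0 addr0.
elim: k => [|k IH]; first by rewrite !expr1 ZE.
by rewrite exprS IH ZE -mulmxE mulmx_block !(mulmx0, mul0mx, addr0, add0r) mulmxE -exprS.
Qed.

Lemma trace_scale n (c : R) (A : 'M[R]_n) k : \tr ((c *: A) ^+ k) = c ^+ k * \tr (A ^+ k).
Proof.
rewrite -mxtraceZ; congr (\tr _); elim: k => [|k IH]; first by rewrite !expr0 scale1r.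
by rewrite !exprS -!mulmxE IH -scalemxAl -scalemxAr scalerA.
Qed.

End TraceWalks.

Section WeightedLists.
Variable R : realType.

(* The expectation of the product, along the list s, of independent variables
   indexed by L, the moment of order c of each of them being M c. *)
Definition weight (L : eqType) (M : nat -> R) (s : seq L) : R :=
  \prod_(e <- undup s) M (count_mem e s).

Lemma weight_map (L L' : eqType) (f : L -> L') M (s : seq L) : injective f ->
  weight M (map f s) = weight M s.
Proof.
move=> fi; rewrite /weight undup_map_inj // big_map; apply: eq_bigr => e _.
by rewrite count_map; congr M; apply: eq_count => e' /=; rewrite (inj_eq fi).
Qed.

Lemma weight_fin (L : finType) M (s : seq L) : M 0%N = 1 ->
  weight M s = \prod_(e : L) M (count_mem e s).
Proof.
move=> M0; rewrite /weight big_uniq ?undup_uniq //= big_mkcond; apply: eq_bigr => e _.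
by rewrite mem_undup; case: ifPn => // /count_memPn ->.
Qed.

Lemma prod_count (L : finType) (X : L -> R) (s : seq L) :
  \prod_(e <- s) X e = \prod_(e : L) X e ^+ count_mem e s.
Proof.
elim: s => [|a s IH]; first by rewrite big_nil big1.
rewrite big_cons IH (bigD1 a) //= [in RHS](bigD1 a) //= eqxx exprS mulrA; congr (_ * _).
by apply: eq_bigr => e; rewrite eq_sym => /negbTE ->.
Qed.

Lemma weight_cat_disjoint (L : eqType) M (s s' : seq L) : ~~ has (mem s) s' ->
  weight M (s ++ s') = weight M s * weight M s'.
Proof.
move=> dis; have pu : perm_eq (undup (s ++ s')) (undup s ++ undup s').
  apply: uniq_perm; rewrite ?undup_uniq // ?cat_uniq ?undup_uniq ?andbT /=.
    apply: contra dis => /hasP[e]; rewrite mem_undup => es' /=; rewrite mem_undup => es.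
    by apply/hasP; exists e.
  by move=> e; rewrite mem_undup !mem_cat !mem_undup.
rewrite /weight (perm_big _ pu) big_cat /=; congr (_ * _); apply: eq_big_seq => e;
  rewrite mem_undup => es; rewrite count_cat.
  rewrite (_ : count_mem e s' = 0%N) ?addn0 //; apply/count_memPn.
  by apply: contra dis => es'; apply/hasP; exists e.
rewrite (_ : count_mem e s = 0%N) //; apply/count_memPn.
by apply: contra dis => es'; apply/hasP; exists e.
Qed.

End WeightedLists.

Lemma moment0 (R : realType) (mu : probability (measurableTypeR R) R) : moment mu 0 = 1.
Proof.
rewrite /moment; under eq_Rintegral do rewrite expr0.
by rewrite Rintegral_cst //= mul1r fine_probability_setT.
Qed.

Section BlockMoments.
Context (R : realType) (d : measure_display) (T : measurableType d) (Pr : probability T R).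
Variables (n m : nat) (X : 'I_n * 'I_m -> {RV Pr >-> measurableTypeR R}).
Variable mu : probability (measurableTypeR R) R.
Hypotheses (indX : mutually_independent X) (lawX : forall i, has_law (X i) mu).
Hypothesis fmu : finite_moments mu.
Local Notation V := 'I_(n + m).

Definition row_column (e : V * V) : bool := (e.1 < n)%N && (n <= e.2)%N.

Let emb (p : 'I_n * 'I_m) : V * V := (lshift m p.1, rshift n p.2).
Let Z w : 'M[R]_(n + m) := block_mx 0 (random_matrix X w) 0 0.

Let emb_inj : injective emb.
Proof.
case=> i j [i' j']; rewrite /emb /= => -[ii /eqP]; rewrite eqn_add2l => /eqP jj.
by congr pair; exact: val_inj.
Qed.

Let Z_emb w p : Z w (emb p).1 (emb p).2 = X p w.
Proof. by rewrite /Z block_mxEur mxE -surjective_pairing. Qed.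

Let Z_out w e : ~~ row_column e -> Z w e.1 e.2 = 0.
Proof.
case: e => x y; rewrite /row_column /= => H.
case: (split_ordP x) H => i ->; case: (split_ordP y) => j -> H.
- by rewrite /Z block_mxEul mxE.
- by move: H; rewrite /= leq_addr.
- by rewrite /Z block_mxEdl mxE.
- by rewrite /Z block_mxEdr mxE.
Qed.

Let row_columnP s : all row_column s -> exists r, s = map emb r.
Proof.
elim: s => [|[x y] s IH]; first by exists [::].
rewrite /= => /andP[/andP[/= xn ny] /IH[r ->]].
case: (split_ordP x) xn => i -> /= xn; last by lia.
case: (split_ordP y) ny => j -> /= ny; first by have := ltn_ord j; lia.
by exists ((i, j) :: r).
Qed.

Lemma block_product s :
  Pr.-integrable setT (EFin \o (fun w => \prod_(e <- s) Z w e.1 e.2)) /\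
  \int[Pr]_w \prod_(e <- s) Z w e.1 e.2 = (all row_column s)%:R * weight (moment mu) s.
Proof.
case: (boolP (all row_column s)) => [/row_columnP[r sE]|/allPn[e es ne]]; last first.
  have E : (fun w => \prod_(e <- s) Z w e.1 e.2) = cst 0.
    by apply/funext => w; rewrite (big_rem e) //= Z_out ?mul0r.
  rewrite E mul0r; split; last by rewrite Rintegral_cst ?mul0r.
  by apply: (@bounded_integrable _ _ _ Pr _ 0) => // w; rewrite normr0.
have E : (fun w => \prod_(e <- s) Z w e.1 e.2) =
    (fun w => \prod_p X p w ^+ count_mem p r).
  apply/funext => w; rewrite sE big_map -prod_count; apply: eq_bigr => p _.
  exact: Z_emb.
have [i1 i2] := independent_product indX (g := fun p y => y ^+ count_mem p r)
  (fun p => measurable_funX _ (@measurable_id _ _ _)) (fun p => (law_moment lawX fmu p _).1).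
rewrite E; split => //; rewrite mul1r i2 sE weight_map // weight_fin ?moment0 //.
by apply: eq_bigr => p _; rewrite (law_moment lawX fmu p _).2.
Qed.

Let trace_expand k w : (0 < k)%N ->
  \tr ((random_matrix X w *m (random_matrix X w)^T) ^+ k) =
  \sum_(v : (k.*2).+1.-tuple V | closed_word v) \prod_(e <- links v) Z w e.1 e.2.
Proof. by move=> k0; rewrite -trace_block // trace_walks. Qed.

Lemma trace_mean k (f := fun w => \tr ((random_matrix X w *m (random_matrix X w)^T) ^+ k)) :
  (0 < k)%N -> Pr.-integrable setT (EFin \o f) /\
  \int[Pr]_w f w = \sum_(v : (k.*2).+1.-tuple V | closed_word v)
     (all row_column (links v))%:R * weight (moment mu) (links v).
Proof.
move=> k0; have -> : f = fun w =>
  \sum_(v : (k.*2).+1.-tuple V | closed_word v) \prod_(e <- links v) Z w e.1 e.2.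
  by apply/funext => w; exact: trace_expand.
rewrite -big_filter; have [i1 i2] := Rintegral_sum
  [seq v : (k.*2).+1.-tuple V <- index_enum _ | closed_word v] (fun v => (block_product (links v)).1).
split.
  by apply: etrans i1; congr (integrable _ _ _); apply/funext => w /=; rewrite big_filter.
under eq_Rintegral do rewrite -big_filter.
by rewrite i2; apply: eq_bigr => v _; exact: (block_product _).2.
Qed.

Lemma trace_mean_square k (f := fun w => \tr ((random_matrix X w *m (random_matrix X w)^T) ^+ k)) :
  (0 < k)%N -> Pr.-integrable setT (EFin \o (fun w => f w ^+ 2)) /\
  \int[Pr]_w (f w ^+ 2) =
  \sum_(v : (k.*2).+1.-tuple V | closed_word v) \sum_(v' : (k.*2).+1.-tuple V | closed_word v')
     (all row_column (links v ++ links v'))%:R * weight (moment mu) (links v ++ links v').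
Proof.
move=> k0; pose S := [seq v : (k.*2).+1.-tuple V <- index_enum _ | closed_word v].
have -> : (fun w => f w ^+ 2) = fun w =>
  \sum_(v <- S) \sum_(v' <- S) \prod_(e <- links v ++ links v') Z w e.1 e.2.
  apply/funext => w; have -> : f w = \sum_(v <- S) \prod_(e <- links v) Z w e.1 e.2.
    by rewrite /f trace_expand // big_filter.
  rewrite expr2 big_distrlr /=.
  by apply: eq_bigr => v _; apply: eq_bigr => v' _; rewrite big_cat.
have I1 := fun v : (k.*2).+1.-tuple V =>
  Rintegral_sum S (fun v' => (block_product (links v ++ links v')).1).
have [i1 i2] := Rintegral_sum S (fun v => (I1 v).1).
split => //; rewrite i2 big_filter; apply: eq_bigr => v _.
by rewrite (I1 v).2 big_filter; apply: eq_bigr => v' _; exact: (block_product _).2.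
Qed.

End BlockMoments.

(** * Covariances of the empirical moments *)

Section WeightBounds.
Variable R : realType.

Lemma sum_count (L : eqType) (s : seq L) : (\sum_(e <- undup s) count_mem e s)%N = size s.
Proof. by rewrite -[RHS]sumn_count_undup sumnE big_map. Qed.

Lemma weight_scale (L : eqType) (M : nat -> R) r (s : seq L) :
  weight (fun c => M c * r ^+ c) s = weight M s * r ^+ size s.
Proof. by rewrite /weight big_split /= prodrXr sum_count. Qed.

Lemma weight_mull (L : eqType) (M : nat -> R) x (s : seq L) :
  weight (fun c => x * M c) s = x ^+ size (undup s) * weight M s.
Proof. by rewrite /weight big_split /= big_const_seq count_predT iter_mulr_1. Qed.

Lemma weight_bound (L : eqType) (M : nat -> R) (H : R) K (s : seq L) : 1 <= H ->
  (size s <= K)%N -> (forall c, (0 < c <= K)%N -> `|M c| <= H) -> `|weight M s| <= H ^+ K.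
Proof.
move=> H1 sK MH; rewrite /weight normr_prod.
apply: (@le_trans _ _ (\prod_(e <- undup s) H)).
  rewrite !big_seq; apply: ler_prod => e; rewrite mem_undup => es.
  rewrite normr_ge0 MH // -has_count has_pred1 es /=.
  exact: leq_trans (count_size _ _) sK.
rewrite big_const_seq count_predT iter_mulr_1; apply: ler_weXn2l => //.
exact: leq_trans (size_undup _) sK.
Qed.

(** Each added letter is one of at most q + |s| earlier ones, or new, with at most |V| choices and a
    factor x. For x = 1/n and |V| = n + m the right-hand side stays bounded as n grows. *)
Lemma sum_letters_le (V : finType) q (x : R) (s : seq V) : 0 <= x ->
  \sum_(u : q.-tuple V) x ^+ size (undup (u ++ s)) <=
  x ^+ size (undup s) * ((q + size s)%:R + #|V|%:R * x) ^+ q.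
Proof.
move=> x0; elim: q => [|q IH].
  by rewrite (big_pred1 [tuple]) ?expr0 ?mulr1 // => t; apply/esym/eqP; apply: tuple0.
pose y := (q + size s)%:R + #|V|%:R * x.
have y0 : 0 <= y by rewrite addr_ge0 ?ler0n ?mulr_ge0 ?ler0n.
have yy' : y <= (q.+1 + size s)%:R + #|V|%:R * x by rewrite lerD2r ler_nat leq_add2r.
rewrite sum_tupleS exchange_big /=.
apply: (@le_trans _ _ (\sum_(u : q.-tuple V) x ^+ size (undup (u ++ s)) * y)).
  apply: ler_sum => u _.
  rewrite (eq_bigr (fun a => x ^+ size (undup (u ++ s)) * x ^+ (a \notin u ++ s))); last first.
    by move=> a _; rewrite -exprD addnC; case: (a \in u ++ s).
  rewrite -mulr_sumr ler_wpM2l ?exprn_ge0 //.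
  rewrite (bigID (fun a => a \in u ++ s)) /=; apply: lerD.
    rewrite (eq_bigr (fun=> 1)) => [|a ->]; last by rewrite expr0.
    rewrite sumr_const ler_nat; apply: leq_trans (card_size _) _.
    by rewrite size_cat size_tuple.
  rewrite (eq_bigr (fun=> x)) => [|a ->]; last by rewrite expr1.
  by rewrite sumr_const -[leLHS]mulr_natl ler_wpM2r // ler_nat max_card.
rewrite -mulr_suml; apply: le_trans (ler_wpM2r y0 IH) _.
rewrite -mulrA ler_wpM2l ?exprn_ge0 // -/y -exprSr.
by rewrite lerXn2r // nnegrE (le_trans y0).
Qed.

End WeightBounds.

Section SharedEdge.
Variable L : eqType.
Implicit Types (x y : L) (s w : seq L) (b : bool) (e : L * L) (es S : seq L).

(** The steps from [e] on keep their order and those before it follow backwards, so that each one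
    meets its predecessors. *)
Lemma attached_through b x s e S : e \in steps b x s -> e.1 \in S -> e.2 \in S ->
  exists2 es, es =i steps b x s & attached S es.
Proof.
elim: s b x => [|y s IH] b x //=; rewrite in_cons; case/predU1P=> [-> e1 e2|es e1 e2].
  exists ((if b then (y, x) else (x, y)) :: steps (~~ b) y s) => //=; rewrite e1 /=.
  apply: attached_sub (attached_steps (~~ b) y s) => z; rewrite mem_seq1 => /eqP ->.
  by case: b {e1 e2}; rewrite /= !inE eqxx ?orbT.
have [es' E at'] := IH _ _ es e1 e2; exists (rcons es' (if b then (y, x) else (x, y))).
  by move=> z; rewrite mem_rcons !in_cons E.
rewrite -cats1 attached_cat at' /= andbT.
have yS : y \in ends es' ++ S.
  have := ends_steps (~~ b) y s y; rewrite mem_head.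
  suff -> : (y \in ends es' ++ S) = (y \in ends (steps (~~ b) y s)) || (y \in S).
    case: s es {IH E} => // z s _ _; rewrite mem_ends /=.
    by case: b; rewrite /= eqxx ?orbT.
  by rewrite mem_cat !mem_ends; congr (_ || _); apply: eq_has_r.
by case: b {IH es E}; rewrite /= yS ?orbT.
Qed.

(* The union of two walks sharing an edge is connected. *)
Lemma size_letters_cat v v' e : e \in links v -> e \in links v' ->
  (size (undup (v ++ v')) <= (size (undup (links v ++ links v'))).+1)%N.
Proof.
case: v => // x s; case: v' => // x' s' ev ev'.
pose S := ends (links (x :: s)) ++ [:: x].
have [e1 e2] : e.1 \in S /\ e.2 \in S.
  by split; rewrite mem_cat mem_ends; apply/orP; left; apply/hasP; exists e; rewrite ?eqxx ?orbT.
have [es E at'] := attached_through ev' e1 e2.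
have at2 : attached [:: x] (links (x :: s) ++ es) by rewrite attached_cat attached_steps.
have := attached_count at2 (E0 := [::]); rewrite cats0 addn0 add1n => H.
rewrite (@size_undup_eq_mem _ (links (x :: s) ++ links (x' :: s')) (links (x :: s) ++ es)); last first.
  by move=> z; rewrite !mem_cat E.
apply: leq_trans (H _) => //; apply: size_undup_sub => z.
have nx' : has (fun e => (x' == e.1) || (x' == e.2)) (links (x' :: s')).
  by case: s' ev' {E} => // y s'' _; rewrite /= eqxx.
rewrite mem_cat -(ends_steps false x s z) -(ends_steps false x' s' z) mem_cat mem_seq1.
rewrite !mem_ends has_cat (eq_has_r E) => /orP[/orP[]->|/orP[/eqP ->|->]]; rewrite ?orbT //.
by rewrite [X in _ || X || _]nx' !orbT.
Qed.

End SharedEdge.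

Section Covariance.
Variables (R : realType) (n m k : nat) (h : nat -> R) (H : R).
Local Notation V := 'I_(n + m).
Local Notation walk := ((k.*2).+1.-tuple V).
Local Notation q := (k.*2).+1.
Hypotheses (n0 : (0 < n)%N) (H1 : 1 <= H).
Hypothesis hH : forall c, (0 < c <= k.*2 + k.*2)%N -> `|h c| <= H.
Let z : R := n%:R^-1.
Let nu c := z * h c.
Let wt (s : seq (V * V)) : R := (all (@row_column n m) s)%:R * weight nu s.

Let z0 : 0 <= z. Proof. by rewrite invr_ge0 ler0n. Qed.
Let z1 : z <= 1. Proof. by rewrite invf_le1 ?ltr0n // ler1n. Qed.

Let size_l (v : walk) : size (links v) = k.*2.
Proof. by rewrite size_links size_tuple. Qed.

(* Walks without a common edge are independent; a common edge costs a vertex,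
   that is, a factor z = 1/n. *)
Let covariance_term (v v' : walk) :
  z ^+ 2 * `|wt (links v ++ links v') - wt (links v) * wt (links v')|
   <= 2 * H ^+ (k.*2 + k.*2) * z * z ^+ size (undup (v' ++ v)).
Proof.
rewrite {1}/wt all_cat.
rewrite (_ : wt (links v) * wt (links v') =
   (all (@row_column n m) (links v) && all (@row_column n m) (links v'))%:R *
   (weight nu (links v) * weight nu (links v'))); last first.
  by rewrite /wt mulrACA; congr (_ * _); do 2!case: (all _ _); rewrite ?mulr0 ?mulr1.
rewrite -mulrBr normrM; set b := (_ && _).
have b1 : `|b%:R : R| <= 1 by case: b; rewrite ?normr1 // normr0.
have H0 : 0 <= H by rewrite (le_trans _ H1).
case: (boolP (has (mem (links v)) (links v'))) => [/hasP[e ev' ev]|dis]; last first.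
  by rewrite weight_cat_disjoint // subrr normr0 !mulr0 !mulr_ge0 // exprn_ge0.
have sz : (size (undup (v' ++ v)) <= (size (undup (links v ++ links v'))).+1)%N.
  rewrite (@size_undup_eq_mem _ (v' ++ v) (v ++ v')); first exact: size_letters_cat ev ev'.
  by move=> y; rewrite !mem_cat orbC.
have nub s K : (size s <= K)%N -> (K <= k.*2 + k.*2)%N ->
    `|weight nu s| <= z ^+ size (undup s) * H ^+ K.
  move=> sK KK; rewrite weight_mull normrM ger0_norm ?exprn_ge0 //.
  rewrite ler_wpM2l ?exprn_ge0 //; apply: weight_bound => // c /andP[c0 cK].
  by apply: hH; rewrite c0 (leq_trans cK).
(* The two traces give z^2 and the links at least the number of letters minus one: after one z per
   letter, one more is left. *)
have zp a : (size (undup (v' ++ v)) <= a.+1)%N ->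
    z ^+ 2 * z ^+ a <= z * z ^+ size (undup (v' ++ v)).
  by move=> Ha; rewrite -exprD -exprS; apply: ler_wiXn2l => //; lia.
apply: (@le_trans _ _ (z ^+ 2 * (`|weight nu (links v ++ links v')| +
                                 `|weight nu (links v)| * `|weight nu (links v')|))).
  rewrite ler_wpM2l ?exprn_ge0 // -[leRHS]mul1r; apply: ler_pM => //.
  by rewrite -normrM; exact: ler_normB.
have -> : 2 * H ^+ (k.*2 + k.*2) * z * z ^+ size (undup (v' ++ v)) =
    H ^+ (k.*2 + k.*2) * (z * z ^+ size (undup (v' ++ v))) +
    H ^+ (k.*2 + k.*2) * (z * z ^+ size (undup (v' ++ v))).
  by rewrite -mulrDl -mulr2n -[in RHS]mulr_natl !mulrA.
have z20 : 0 <= z ^+ 2 by rewrite exprn_ge0.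
have K0 K : 0 <= H ^+ K by rewrite exprn_ge0.
have n1 : `|weight nu (links v ++ links v')| <=
    z ^+ size (undup (links v ++ links v')) * H ^+ (k.*2 + k.*2).
  by apply: nub; rewrite ?size_cat ?size_l.
have n2 (u : walk) : `|weight nu (links u)| <= z ^+ size (undup (links u)) * H ^+ k.*2.
  by apply: nub; rewrite ?size_l ?leq_addr.
rewrite mulrDr; apply: lerD.
  by apply: le_trans (ler_wpM2l z20 n1) _; rewrite [leLHS]mulrA [leRHS]mulrC ler_wpM2r ?zp.
apply: le_trans (ler_wpM2l z20 (ler_pM (normr_ge0 _) (normr_ge0 _) (n2 v) (n2 v'))) _.
have -> a b' : z ^+ a * H ^+ k.*2 * (z ^+ b' * H ^+ k.*2) = z ^+ (a + b') * H ^+ (k.*2 + k.*2).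
  by rewrite mulrACA -!exprD.
rewrite [leLHS]mulrA [leRHS]mulrC ler_wpM2r ?zp //.
by apply: leq_trans sz _; rewrite ltnS undup_cat size_cat leq_add2r size_filter count_size.
Qed.

(** [sum_letters_le] is used twice, for the second walk given the first and then for the first; the
    factor 1/n in front survives. *)
Lemma covariance_bound : z ^+ 2 *
  `|\sum_(v : walk | closed_word v) \sum_(v' : walk | closed_word v') wt (links v ++ links v')
    - (\sum_(v : walk | closed_word v) wt (links v)) ^+ 2|
   <= 2 * H ^+ (k.*2 + k.*2) * z * ((q + q)%:R + (n + m)%:R * z) ^+ (q + q).
Proof.
rewrite [X in _ - X]expr2 big_distrlr /= -sumrB.
have C0 : 0 <= 2 * H ^+ (k.*2 + k.*2) * z.
  by rewrite !mulr_ge0 // exprn_ge0 // (le_trans _ H1).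
apply: (@le_trans _ _ (2 * H ^+ (k.*2 + k.*2) * z *
   (\sum_(v : walk) \sum_(v' : walk) z ^+ size (undup (v' ++ v))))).
  rewrite -[z ^+ 2]ger0_norm ?exprn_ge0 // -normrM !mulr_sumr.
  apply: le_trans (ler_norm_sum _ _ _) _; rewrite big_mkcond; apply: ler_sum => v _.
  have B0 (v' : walk) : 0 <= 2 * H ^+ (k.*2 + k.*2) * z * z ^+ size (undup (v' ++ v)).
    by rewrite mulr_ge0 // exprn_ge0.
  rewrite !mulr_sumr; case: ifP => _; last by apply: sumr_ge0.
  rewrite -sumrB mulr_sumr.
  apply: le_trans (ler_norm_sum _ _ _) _; rewrite big_mkcond; apply: ler_sum => v' _.
  by case: ifP => _ //; rewrite normrM ger0_norm ?exprn_ge0 //; exact: covariance_term.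
rewrite ler_wpM2l //.
apply: (@le_trans _ _ (\sum_(v : walk) z ^+ size (undup (v ++ [::])) *
    ((q + q)%:R + (n + m)%:R * z) ^+ q)).
  apply: ler_sum => v _; rewrite cats0.
  by apply: le_trans (sum_letters_le _ _ z0) _; rewrite size_tuple card_ord.
have y0 : 0 <= (q + q)%:R + (n + m)%:R * z by rewrite addr_ge0 ?mulr_ge0.
rewrite -mulr_suml exprD; apply: ler_wpM2r; rewrite ?exprn_ge0 //.
apply: le_trans (sum_letters_le _ _ z0) _; rewrite /= expr0 mul1r card_ord addn0.
by rewrite lerXn2r ?nnegrE ?addr_ge0 ?mulr_ge0 // lerD2r ler_nat leq_addr.
Qed.

End Covariance.

(** * Means of the empirical moments *)

Section Patterns.

(** For a fixed injection, relabelling is a bijection from the words using all labels to the tuples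
    whose letters form its image. *)
Lemma card_patterns (V : finType) p q (f : {ffun 'I_p -> V}) (A : nmodType) (G : q.-tuple V -> A) :
  injective f ->
  \sum_(w : q.-tuple 'I_p | size (undup w) == p) G (map_tuple f w) =
  \sum_(v : q.-tuple V | (size (undup v) == p) && (f \in ffun_on (mem v))) G v.
Proof.
move=> fi; pose P (v : q.-tuple V) := (size (undup v) == p) && (f \in ffun_on (mem v)).
have PE (w : q.-tuple 'I_p) : P (map_tuple f w) = (size (undup w) == p).
  rewrite /P /= undup_map_inj // size_map; case: eqP => //= sw.
  apply/ffun_onP => i; suff : i \in undup w by rewrite mem_undup => /(map_f f).
  have [||_ ->] := @uniq_min_size _ (undup w) (enum 'I_p) (undup_uniq w).
  - by move=> j; rewrite mem_enum.
  - by rewrite sw size_enum_ord.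
  by rewrite mem_enum.
rewrite (partition_big (map_tuple f) P) => [|w]; last by rewrite PE.
apply: eq_bigr => v /andP[/eqP sv /ffun_onP fv].
have [w wv] : exists w, map_tuple f w = v.
  have ex j : exists i, f i == tnth v j.
    have us : uniq (codom f) by rewrite /codom /image_mem map_inj_uniq ?enum_uniq.
    have [||_ E] := @uniq_min_size _ (codom f) (undup v) us.
    - by move=> y /codomP[i ->]; rewrite mem_undup; exact: fv.
    - by rewrite size_codom card_ord sv.
    have : tnth v j \in codom f by rewrite E mem_undup mem_tnth.
    by case/codomP => i ->; exists i.
  exists (mktuple (fun j => xchoose (ex j))).
  by apply: eq_from_tnth => j; rewrite tnth_map tnth_mktuple; exact/eqP/(xchooseP (ex j)).
rewrite (big_pred1 w) ?wv // => w'; rewrite -PE -wv.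
have mi : injective (@map_tuple q _ _ f).
  by move=> w1 w2 [] /(inj_map fi) /val_inj.
rewrite (inj_eq mi) andb_idl // => /eqP ->; rewrite wv /P sv eqxx.
exact/ffun_onP.
Qed.

(* Each v is the image of a word w using all the labels of 'I_p by an injection
   f of the labels, in exactly p! ways. *)
Lemma sum_patterns (R : numFieldType) (V : finType) q (G : q.-tuple V -> R) :
  \sum_v G v = \sum_(p < q.+1) p`!%:R^-1 *
    \sum_(w : q.-tuple 'I_p | size (undup w) == p)
      \sum_(f : {ffun 'I_p -> V} | injectiveb f) G (map_tuple f w).
Proof.
have le_q (v : q.-tuple V) : (size (undup v) < q.+1)%N.
  by rewrite ltnS (leq_trans (size_undup _)) ?size_tuple.
rewrite (partition_big (fun v => Ordinal (le_q v)) predT) //=; apply: eq_bigr => p _.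
rewrite exchange_big /=.
under [in RHS]eq_bigr => f /fintype.injectiveP fi do rewrite (card_patterns G fi).
rewrite (exchange_big_dep (fun v : q.-tuple V => size (undup v) == p)) /=; last by move=> ? ? _ /andP[].
rewrite mulr_sumr; apply: eq_big => [v|v /eqP sv]; first by rewrite -val_eqE.
have {}sv : size (undup v) = p by rewrite -sv.
rewrite (eq_bigl (mem [set f : {ffun 'I_p -> V} in ffun_on (mem v) | injectiveb f]%SET)).
  rewrite sumr_const card_inj_ffuns_on card_ord.
  have -> : #|mem v| = p by rewrite -sv; apply: eq_card_trans (card_uniqP (undup_uniq v)) _ => y;
    rewrite mem_undup.
  by rewrite ffactnn -[G v *+ _]mulr_natl mulrA mulVf ?mul1r // pnatr_eq0 -lt0n fact_gt0.
by move=> f; rewrite !inE sv eqxx /= andbC.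
Qed.

(** A union bound over pairs of indices with equal values, one of the two values being determined by
    the other. *)
Lemma card_noninjective (V : finType) p :
  (#|[pred f : {ffun 'I_p -> V} | ~~ injectiveb f]| <= p ^ 2 * #|V| ^ p.-1)%N.
Proof.
case: p => [|p].
  rewrite eq_card0 // => f; rewrite !inE; apply/negbTE; rewrite negbK.
  by apply/fintype.injectiveP; case.
pose B (ij : 'I_p.+1 * 'I_p.+1) : {set {ffun 'I_p.+1 -> V}} :=
  [set f : {ffun 'I_p.+1 -> V} | (ij.1 != ij.2) && (f ij.1 == f ij.2)]%SET.
have -> : (p.+1 ^ 2 * #|V| ^ p.+1.-1 = \sum_(ij : 'I_p.+1 * 'I_p.+1) #|V| ^ p)%N.
  by rewrite sum_nat_const card_prod card_ord mulnn.
apply: (@leq_trans (\sum_(ij : 'I_p.+1 * 'I_p.+1) #|B ij|)%N).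
  rewrite -sum1_card; under [leqRHS]eq_bigr do rewrite -sum1_card big_mkcond.
  rewrite exchange_big /= big_mkcond; apply: leq_sum => f _; rewrite inE.
  case: ifPn => // /injectivePn[i [j ij fij]].
  by rewrite (bigD1 (i, j)) //= inE /= ij fij eqxx.
apply: leq_sum => -[i j] _; case: (eqVneq i j) => [<-|ij].
  by rewrite eq_card0 // => f; rewrite !inE eqxx.
pose r (f : {ffun 'I_p.+1 -> V}) := [ffun k : 'I_p => f (lift j k)].
have -> : (#|V| ^ p)%N = #|{ffun 'I_p -> V}| by rewrite card_ffun card_ord.
apply: (@leq_card_in _ _ r) => f g; rewrite !inE /= ij => /eqP fij /eqP gij rfg.
have E k : k != j -> f k = g k.
  rewrite eq_sym => /unlift_some[k' -> _].
  by have := congr1 (fun h : {ffun 'I_p -> V} => h k') rfg; rewrite !ffunE.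
by apply/ffunP => k; case: (eqVneq k j) => [->|/E //]; rewrite -fij -gij E.
Qed.

(** Up to an error of lower order in |V|, letters may be placed independently of each other. *)
Lemma card_injective_family (V : finType) p (F : 'I_p -> pred V)
    (N := #|[pred f : {ffun 'I_p -> V} | injectiveb f && [forall i, F i (f i)]]|) :
  (N <= \prod_i #|F i| <= N + p ^ 2 * #|V| ^ p.-1)%N.
Proof.
have E : (\prod_i #|F i| = #|family F|)%N.
  by rewrite card_family foldrE /image_mem big_map enumT.
have FE f : (f \in family F) = [forall i, F i (f i)] by [].
rewrite E; apply/andP; split.
  by apply: subset_leq_card; apply/fintype.subsetP => f; rewrite !inE => /andP[].
apply: leq_trans (leq_add (leqnn N) (card_noninjective V p)).
rewrite -(cardID (fun f : {ffun 'I_p -> V} => injectiveb f)) leq_add //; apply: subset_leq_card;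
  apply/fintype.subsetP => f; rewrite !inE; first by rewrite andbC.
by case/andP.
Qed.

End Patterns.

Section PatternTerms.
Variable R : realType.

(* Along a walk carrying a nonzero product, even positions are rows and odd
   positions are columns of the random matrix. *)
Definition role (n m p : nat) (w : seq 'I_p) (i : 'I_p) : pred 'I_(n + m) :=
  [pred x : 'I_(n + m) | ((i \in unzip1 (links w)) ==> (x < n)%N) &&
                         ((i \in unzip2 (links w)) ==> (n <= x)%N)].

Definition placements n m p (w : seq 'I_p) : nat :=
  #|[pred f : {ffun 'I_p -> 'I_(n + m)} | injectiveb f && [forall i, role w i (f i)]]|.

Lemma row_column_links n m p (w : seq 'I_p) (f : {ffun 'I_p -> 'I_(n + m)}) :
  all (@row_column n m) (links (map f w)) = [forall i, role w i (f i)].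
Proof.
rewrite links_map all_map; apply/allP/forallP => [H i|H e ew].
  rewrite /role /=; apply/andP; split; apply/implyP => /mapP[e /H /andP[/= ? ?] ->] //.
have /andP[/implyP H1 _] := H e.1; have /andP[_ /implyP H2] := H e.2.
by rewrite /row_column /= H1 ?H2 //; apply: map_f.
Qed.

(** A walk is a word on its p distinct letters together with an injective placement of them; one
    factor 1/n comes from the normalised trace and one from each distinct link. *)
Lemma mean_patterns n m k (h : nat -> R) (z := n%:R^-1 : R) (q := (k.*2).+1) :
  z * (\sum_(v : (k.*2).+1.-tuple 'I_(n + m) | closed_word v)
     (all (@row_column n m) (links v))%:R * weight (fun c => z * h c) (links v)) =
  \sum_(p < q.+1) p`!%:R^-1 * \sum_(w : q.-tuple 'I_p | (size (undup w) == p) && closed_word w)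
     (placements n m w)%:R * z ^+ (size (undup (links w))).+1 * weight h (links w).
Proof.
rewrite mulr_sumr big_mkcond sum_patterns; apply: eq_bigr => p _; congr (_ * _).
rewrite [RHS]big_mkcondr; apply: eq_bigr => w _.
under eq_bigr => f fi.
  rewrite (closed_word_map _ (fintype.injectiveP _ fi)) row_column_links links_map.
  rewrite weight_map; last first.
    by move=> [a b] [a' b'] [/(fintype.injectiveP _ fi) -> /(fintype.injectiveP _ fi) ->].
  over.
case: ifP => _; last by rewrite big1.
rewrite -mulr_sumr -mulr_suml weight_mull exprS -!mulrA mulrCA; congr (_ * _).
rewrite -natr_sum /placements -sum1_card big_mkcondr; congr (_%:R); apply: eq_bigr => f _.
Qed.

Lemma cvg_prod_seq (I : eqType) (r : seq I) (f : I -> nat -> R) (l : I -> R) :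
  (forall i, i \in r -> f i n @[n --> \oo] --> l i) ->
  \prod_(i <- r) f i n @[n --> \oo] --> \prod_(i <- r) l i.
Proof.
elim: r => [|i r IH] H.
  by under eq_fun do rewrite big_nil; rewrite big_nil; exact: cvg_cst.
under eq_fun do rewrite big_cons; rewrite big_cons.
apply: cvgM; first by apply: H; rewrite mem_head.
by apply: IH => j jr; apply: H; rewrite in_cons jr orbT.
Qed.

Lemma cvg_sum_cond (I : Type) (r : seq I) (P : pred I) (f : I -> nat -> R) (l : I -> R) :
  (forall i, P i -> f i n @[n --> \oo] --> l i) ->
  \sum_(i <- r | P i) f i n @[n --> \oo] --> \sum_(i <- r | P i) l i.
Proof.
move=> H; elim: r => [|i r IH].
  by under eq_fun do rewrite big_nil; rewrite big_nil; exact: cvg_cst.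
under eq_fun do rewrite big_cons; rewrite big_cons.
by case: ifP => // Pi; apply: cvgD => //; exact: H.
Qed.

Variables (m : nat -> nat) (alpha : R).
Hypothesis m_alpha : (m n)%:R / n%:R @[n --> \oo] --> alpha.

(** The number of vertices that may carry the letter, relative to n: 1 for a row, [alpha] for a
    column, 0 for a letter required to be both, 1 + [alpha] for a letter in no link. *)
Definition role_density p (w : seq 'I_p) (i : 'I_p) : R :=
  if i \in unzip1 (links w) then (i \notin unzip2 (links w))%:R
  else if i \in unzip2 (links w) then alpha else 1 + alpha.

Let inv_cvg0 : n%:R^-1 @[n --> \oo] --> (0 : R).
Proof. by rewrite -(cvg_shiftS _); exact: cvg_harmonic. Qed.

Let n1 : (n%:R / n%:R : R) @[n --> \oo] --> (1 : R).
Proof.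
apply: cvg_near_cst; near=> n; rewrite divff // pnatr_eq0 -lt0n.
by near: n; exact: nbhs_infty_gt.
Unshelve. all: by end_near.
Qed.

Lemma role_density_cvg p (w : seq 'I_p) (i : 'I_p) :
  #|@role n (m n) p w i|%:R * n%:R^-1 @[n --> \oo] --> role_density w i.
Proof.
have cardE n (Q1 Q2 : bool) : #|[pred x : 'I_(n + m n) | (Q1 ==> (x < n)%N) && (Q2 ==> (n <= x)%N)]| =
   if Q1 then (if Q2 then 0 else n)%N else (if Q2 then m n else (n + m n)%N).
  rewrite -sum1_card big_split_ord /=.
  under eq_bigl => j do rewrite inE /= ltn_ord leqNgt ltn_ord implybT /= implybF.
  under [X in (_ + X)%N]eq_bigl => j do rewrite inE /= leq_addr ltnNge leq_addr implybT andbT implybF.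
  case: Q1; case: Q2; by rewrite /= ?big_pred0_eq ?sum1_card ?card_ord ?addn0.
under eq_fun do rewrite cardE.
rewrite /role_density; case: (i \in unzip1 _); case: (i \in unzip2 _) => //=.
- by under eq_fun do rewrite mul0r; exact: cvg_cst.
- by under eq_fun do rewrite natrD mulrDl; exact: cvgD.
Qed.

Lemma cvg_pow (f : nat -> R) (l : R) j :
  f n @[n --> \oo] --> l -> f n ^+ j @[n --> \oo] --> l ^+ j.
Proof.
move=> fl; elim: j => [|j IH]; first by under eq_fun do rewrite expr0; rewrite expr0; exact: cvg_cst.
by under eq_fun do rewrite exprS; rewrite exprS; exact: cvgM.
Qed.

Let pow_cvg j : n%:R^-1 ^+ j @[n --> \oo] --> ((j == 0)%:R : R).
Proof. by have := @cvg_pow _ _ j inv_cvg0; rewrite expr0n. Qed.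

Lemma placements_cvg p (w : seq 'I_p) a : (p <= a)%N ->
  (placements n (m n) w)%:R * n%:R^-1 ^+ a @[n --> \oo] -->
  (p == a)%:R * \prod_i role_density w i.
Proof.
move=> pa; pose Q n : R := (\prod_i #|@role n (m n) p w i|)%:R.
have QN n : (placements n (m n) w)%:R <= Q n <=
    (placements n (m n) w)%:R + (p ^ 2)%:R * (n + m n)%:R ^+ p.-1.
  have := card_injective_family (@role n (m n) p w); rewrite card_ord.
  by rewrite -/(placements n (m n) w) /Q -natrX -natrM -natrD !ler_nat.
have Qcvg : Q n * n%:R^-1 ^+ a @[n --> \oo] --> (p == a)%:R * \prod_i role_density w i.
  have -> : (p == a) = (a - p == 0)%N by rewrite subn_eq0 eqn_leq pa.
  have -> : (fun n => Q n * n%:R^-1 ^+ a) = (fun n => n%:R^-1 ^+ (a - p) *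
      \prod_i (#|@role n (m n) p w i|%:R * n%:R^-1)).
    apply/funext => n; rewrite big_split /= prodr_const card_ord /Q natr_prod.
    by rewrite mulrCA -exprD subnK.
  apply: cvgM; first exact: pow_cvg.
  by apply: cvg_prod_seq => i _; exact: role_density_cvg.
pose e n : R := (p ^ 2)%:R * ((n + m n)%:R * n%:R^-1) ^+ p.-1 * n%:R^-1 ^+ (a - p.-1).
have ecvg : e n @[n --> \oo] --> (0 : R).
  (* For p = 0 the factor p^2 makes the error vanish, so the truncated [p.-1] does no harm. *)
  case: p w pa Q QN Qcvg @e => [|p] w pa Q QN Qcvg e.
    by rewrite /e; under eq_fun do rewrite !mul0r; exact: cvg_cst.
  have -> : 0 = (p.+1 ^ 2)%:R * (1 + alpha) ^+ p * (a - p == 0)%N%:R :> R.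
    by rewrite subn_eq0 leqNgt pa mulr0.
  apply: cvgM; last exact: pow_cvg.
  apply: cvgM; first exact: cvg_cst.
  apply: cvg_pow; under eq_fun do rewrite natrD mulrDl.
  exact: (cvgD n1 m_alpha).
have -> : (p == a)%:R * \prod_i role_density w i = (p == a)%:R * \prod_i role_density w i - 0.
  by rewrite subr0.
apply: (@squeeze_cvgr _ _ _ _ (fun n => Q n * n%:R^-1 ^+ a - e n) (fun n => Q n * n%:R^-1 ^+ a)).
- apply: nearW => n; have /andP[H1 H2] := QN n.
  have z0 j : 0 <= n%:R^-1 ^+ j :> R by rewrite exprn_ge0 ?invr_ge0.
  rewrite (ler_wpM2r (z0 a) H1) andbT lerBlDr; apply: le_trans (ler_wpM2r (z0 a) H2) _.
  rewrite mulrDl lerD2l /e exprMn -!mulrA -exprD subnKC //.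
  exact: leq_trans (leq_pred _) pa.
- exact: cvgB.
- by rewrite subr0.
Qed.

Lemma tree_word_density k a (w : word k a) : (0 < k)%N -> tree_word w ->
  \prod_i role_density w i = alpha ^+ odd_letters w.
Proof.
move=> k0 /and3P[cw /eqP sw /eqP lw].
have dis i : i \in unzip1 (links w) -> i \notin unzip2 (links w).
  case wE : (tval w) sw lw => [|x s] sw lw //.
  have [|t [rt ut _ pt _]] := @build_tree _ x s; first by rewrite sw lw.
  by apply: (disjoint_letters ut rt pt).
have dE i : role_density w i = if i \in unzip2 (links w) then alpha else 1.
  rewrite /role_density; case: ifPn => [/dis nw|i1]; first by rewrite nw (negbTE nw).
  case: ifPn => // i2; have : i \in ends (links w).
    rewrite mem_links; first exact: all_letters.
    by rewrite size_tuple ltnS double_gt0.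
  by rewrite mem_cat (negbTE i1) (negbTE i2).
rewrite (eq_bigr _ (fun i _ => dE i)) -big_mkcond /= prodr_const; congr (_ ^+ _).
rewrite /odd_letters; apply: eq_card_trans (card_uniqP (undup_uniq _)) _ => i.
by rewrite mem_undup.
Qed.

(** The 2k steps cannot cross more than k edges twice each. *)
Lemma multiplicity_one k a (w : word k a) : size (undup (links w)) = a -> (k < a)%N ->
  1%N \in multiplicities w.
Proof.
move=> lw ka; have : ~~ all (leq 2) (multiplicities w).
  apply/negP => H2; have : (2 * size (multiplicities w) <= sumn (multiplicities w))%N.
    elim: (multiplicities w) H2 => //= c s IH /andP[c2 /IH]; lia.
  by rewrite sumn_multiplicities /multiplicities size_map lw; lia.
case/allPn => c cw c2; have := allP (multiplicities_gt0 w) c cw.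
by case: c cw c2 => [|[|c]].
Qed.

(** Only words with p = a + 1 letters have a nonzero limit. Among them a = 0 is impossible as k > 0,
    and a > k is killed by [A 1 = 0], which leaves the range of [limit_moment]. *)
Lemma mean_limit k (h : nat -> nat -> R) (A : nat -> R) : (0 < k)%N -> A 1 = 0 ->
  (forall c, (0 < c)%N -> h n c @[n --> \oo] --> A c) ->
  n%:R^-1 * (\sum_(v : (k.*2).+1.-tuple 'I_(n + m n) | closed_word v)
     (all (@row_column n (m n)) (links v))%:R * weight (fun c => n%:R^-1 * h n c) (links v))
  @[n --> \oo] --> limit_moment A alpha k.
Proof.
move=> k0 A1 hA; under eq_fun do rewrite mean_patterns.
pose L p : R := p`!%:R^-1 * \sum_(w : (k.*2).+1.-tuple 'I_p | (size (undup w) == p) && closed_word w)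
   (p == (size (undup (links w))).+1)%:R * (\prod_i role_density w i) * weight A (links w).
have L0 : L 0 = 0.
  by rewrite /L big_pred0 ?mulr0 // => w; case: (tval w) (size_tuple w) => [|[]].
have LS a : L a.+1 = (a.+1)`!%:R^-1 * \sum_(w : word k a | tree_word w)
    alpha ^+ odd_letters w * \prod_(c <- multiplicities w) A c.
  rewrite /L; congr (_ * _); rewrite big_mkcond [RHS]big_mkcond; apply: eq_bigr => w _.
  have := @tree_word_density k a w k0; rewrite /tree_word eqSS [a == _]eq_sym andbC.
  case: (closed_word w); case: (_ == a.+1); case: (_ == a) => //=; rewrite ?mul0r // mul1r.
  by move=> ->; rewrite // /multiplicities big_map.
have L1 : L 1 = 0.
  rewrite LS big1 ?mulr0 // => w /and3P[_ _ /eqP/size0nil/undup_nil lw].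
  by have := size_links w; rewrite lw (size_tuple w) => /esym/eqP; rewrite double_eq0 eqn0Ngt k0.
have Lbig a : (k < a)%N -> L a.+1 = 0.
  move=> ka; rewrite LS big1 ?mulr0 // => w /and3P[_ _ /eqP lw].
  by rewrite (big_rem 1%N) /= ?A1 ?mul0r ?mulr0 //; exact: multiplicity_one lw ka.
have -> : limit_moment A alpha k = \sum_(p < (k.*2).+2) L p.
  rewrite (limit_momentE _ k0 A1) big_ord_recl L0 add0r.
  rewrite (eq_bigr (fun i : 'I_(k.*2).+1 => L i.+1)) //.
  rewrite -(big_mkord predT (fun a => L a.+1)) [RHS](big_cat_nat (n := 1)) //=.
  rewrite big_nat1 [X in _ = _ + X](big_cat_nat (n := k.+1)) //=; last by rewrite ltnS -addnn leq_addr.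
  rewrite [X in _ = _ + (_ + X)]big_nat_cond [X in _ = _ + (_ + X)]big1 => [|a /andP[/andP[ka _] _]]; last exact: Lbig.
  rewrite addr0 L1 add0r.
  by apply: eq_bigr => a _; rewrite LS.
apply: cvg_sum_cond => p _; apply: cvgM; first exact: cvg_cst.
apply: cvg_sum_cond => w /andP[/eqP sw _]; apply: cvgM; last first.
  apply: cvg_prod_seq => e; rewrite mem_undup => ew; apply: hA.
  by rewrite -has_count has_pred1.
apply: placements_cvg; rewrite -{1}sw; case wE : (tval w) (size_tuple w) => [|x s] // _.
exact: size_letters.
Qed.

End PatternTerms.

(** * Convergence of the spectral measures *)

(** Rewrites the real powers in the definition of A_c: it is the limit of n times the moment of
    order c of an entry divided by the square root of n M_2. *)
Lemma powR_normalisation (R : realType) (a b : R) c : 0 < a -> 0 < b ->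
  a `^ (c%:R / 2 - 1) * b `^ (c%:R / 2) = Num.sqrt (a * b) ^+ c / a.
Proof.
move=> a0 b0; have half x : 0 < x -> x `^ (c%:R / 2) = Num.sqrt x ^+ c.
  by move=> x0; rewrite -powR12_sqrt ?ltW // -powR_mulrn ?powR_ge0 // -powRrM mulrC.
have -> : a `^ (c%:R / 2 - 1) = a `^ (c%:R / 2) / a.
  rewrite powRD ?(gt_eqF a0) ?implybT // powRN powRr1 ?ltW //.
by rewrite !half // sqrtrM ?ltW // exprMn mulrAC.
Qed.

Section EmpiricalMoments.
Context (R : realType) (d : measure_display) (T : measurableType d) (Pr : probability T R).
Variables (n m : nat) (X : 'I_n * 'I_m -> {RV Pr >-> measurableTypeR R}).
Variable mu : probability (measurableTypeR R) R.
Hypotheses (indX : mutually_independent X) (lawX : forall i, has_law (X i) mu).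
Hypotheses (fmu : finite_moments mu) (n0 : (0 < n)%N) (mu2 : 0 < moment mu 2).
Let r : R := (Num.sqrt (n%:R * moment mu 2))^-1.
Let z : R := n%:R^-1.
Let h c : R := n%:R * (moment mu c * r ^+ c).

Definition gram_matrix w : 'M[R]_n :=
  let Xn := random_matrix X w in (n%:R * moment mu 2)^-1 *: (Xn *m Xn^T).

Lemma gram_matrix_sym w : (gram_matrix w)^T = gram_matrix w.
Proof. by rewrite /gram_matrix linearZ /= trmx_mul trmxK. Qed.

Definition empirical_moment k w : R := avg (spectrum (gram_matrix w)) (fun x => x ^+ k).

Let r2 : r ^+ 2 = (n%:R * moment mu 2)^-1.
Proof. by rewrite exprVn sqr_sqrtr // mulr_ge0 // ltW. Qed.

Let empirical_trace k w : empirical_moment k w =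
  z * r ^+ k.*2 * \tr ((random_matrix X w *m (random_matrix X w)^T) ^+ k).
Proof.
have [sz tr] := spectrum_trace (gram_matrix_sym w).
rewrite /empirical_moment /avg sz tr trace_scale -r2 -exprM mulnC muln2.
by rewrite mulrC mulrA.
Qed.

Let weight_h (V : eqType) (s : seq V) :
  weight (fun c => z * h c) s = weight (moment mu) s * r ^+ size s.
Proof.
rewrite -weight_scale; apply: eq_bigr => e _.
by rewrite /h mulrA mulVf ?mul1r // pnatr_eq0 -lt0n.
Qed.

Lemma empirical_mean k : (0 < k)%N ->
  Pr.-integrable setT (EFin \o empirical_moment k) /\
  \int[Pr]_w empirical_moment k w =
  z * (\sum_(v : (k.*2).+1.-tuple 'I_(n + m) | closed_word v)
     (all (@row_column n m) (links v))%:R * weight (fun c => z * h c) (links v)).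
Proof.
move=> k0; have [i1 i2] := trace_mean indX lawX fmu k0.
have -> : empirical_moment k = fun w => z * r ^+ k.*2 *
    \tr ((random_matrix X w *m (random_matrix X w)^T) ^+ k).
  by apply/funext => w; exact: empirical_trace.
split; first by apply: (integrableZl _ _ i1).
rewrite RintegralZl // i2 -mulrA; congr (_ * _); rewrite mulr_sumr; apply: eq_bigr => v _.
by rewrite weight_h size_links size_tuple mulrCA [r ^+ _ * _]mulrC.
Qed.

Lemma empirical_mean_square k : (0 < k)%N ->
  Pr.-integrable setT (EFin \o (fun w => empirical_moment k w ^+ 2)) /\
  \int[Pr]_w (empirical_moment k w ^+ 2) =
  z ^+ 2 * (\sum_(v : (k.*2).+1.-tuple 'I_(n + m) | closed_word v)
     \sum_(v' : (k.*2).+1.-tuple 'I_(n + m) | closed_word v')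
     (all (@row_column n m) (links v ++ links v'))%:R *
        weight (fun c => z * h c) (links v ++ links v')).
Proof.
move=> k0; have [i1 i2] := trace_mean_square indX lawX fmu k0.
have -> : (fun w => empirical_moment k w ^+ 2) = fun w => (z * r ^+ k.*2) ^+ 2 *
    \tr ((random_matrix X w *m (random_matrix X w)^T) ^+ k) ^+ 2.
  by apply/funext => w; rewrite empirical_trace exprMn.
split; first by apply: (integrableZl _ _ i1).
rewrite RintegralZl // i2 exprMn -mulrA; congr (_ * _); rewrite mulr_sumr; apply: eq_bigr => v _.
rewrite mulr_sumr; apply: eq_bigr => v' _; rewrite weight_h size_cat !size_links !size_tuple.
by rewrite mulrCA [_ ^+ 2 * _]mulrC -exprM muln2 /= addnn.
Qed.

End EmpiricalMoments.

Section SecondMoment.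
Context (d : measure_display) (T : measurableType d) (R : realType) (Pr : probability T R).

(** Variance plus squared bias, which are estimated separately. *)
Lemma Rintegral_square_diff (S : T -> R) (c : R) :
  Pr.-integrable setT (EFin \o S) -> Pr.-integrable setT (EFin \o (fun w => S w ^+ 2)) ->
  Pr.-integrable setT (EFin \o (fun w => (S w - c) ^+ 2)) /\
  \int[Pr]_w ((S w - c) ^+ 2) =
    \int[Pr]_w (S w ^+ 2) - (\int[Pr]_w S w) ^+ 2 + (\int[Pr]_w S w - c) ^+ 2.
Proof.
move=> iS iS2.
have ic (e : R) : Pr.-integrable setT (EFin \o (fun=> e) : T -> \bar R).
  by apply: (@bounded_integrable _ _ _ Pr _ `|e|) => //; exact: measurable_cst.
have iZ : Pr.-integrable setT (EFin \o (fun w => - (2 * c) * S w)) by apply: (integrableZl _ _ iS).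
have iD : Pr.-integrable setT (EFin \o (fun w => S w ^+ 2 + - (2 * c) * S w)).
  exact: (integrableD _ iS2 iZ).
have -> : (fun w => (S w - c) ^+ 2) = (fun w => (S w ^+ 2 + - (2 * c) * S w) + c ^+ 2).
  by apply/funext => w; ring.
split; first exact: (integrableD _ iD (ic _)).
rewrite RintegralD // RintegralD // RintegralZl // Rintegral_cst // fine_probability_setT.
by ring.
Qed.

(** Applied to the event of a large deviation, and also to the whole space, where it produces a
    favourable outcome. *)
Lemma markov_bound (E : set T) (D : T -> R) (c : R) : measurable E ->
  Pr.-integrable setT (EFin \o D) -> (forall w, 0 <= D w) -> (forall w, E w -> c <= D w) ->
  c * fine (Pr E) <= \int[Pr]_w D w.
Proof.
move=> mE iD D0 ED.
have iE : Pr.-integrable setT (EFin \o (\1_E : T -> R)).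
  apply: (@bounded_integrable _ _ _ Pr _ 1); first exact: measurable_indic.
  by move=> w; rewrite indicE; case: (_ \in _); rewrite ?normr1 // normr0.
have -> : fine (Pr E) = \int[Pr]_w \1_E w by rewrite /Rintegral integral_indic // setIT.
rewrite -RintegralZl //; apply: le_Rintegral => //; first exact: (integrableZl _ _ iE).
move=> w _; rewrite indicE; case: (boolP (w \in E)) => [/set_mem/ED|_]; first by rewrite mulr1.
by rewrite mulr0.
Qed.

End SecondMoment.

Section Ensemble.
Variables (R : realType) (alpha : R) (m : nat -> nat).
Variables (P : nat -> probability (measurableTypeR R) R) (A : nat -> R).
Context (d : nat -> measure_display) (T : forall n, measurableType (d n)).
Variables (Pr : forall n, probability (T n) R).
Variable X : forall n, 'I_n * 'I_(m n) -> {RV (Pr n) >-> measurableTypeR R}.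
Hypothesis m_alpha : (m n)%:R / n%:R @[n --> \oo] --> alpha.
Hypothesis lawP : forall n, (0 < n)%N ->
  [/\ finite_moments (P n), moment (P n) 1 = 0 & 0 < moment (P n) 2].
Hypothesis limA : forall k, (0 < k)%N ->
  moment (P n) k / (n%:R `^ (k%:R / 2 - 1) * moment (P n) 2 `^ (k%:R / 2)) @[n --> \oo] --> A k.
Hypothesis iid : forall n, (0 < n)%N ->
  mutually_independent (@X n) /\ forall i j, has_law (@X n (i, j)) (P n).

Let h n c : R := n%:R * (moment (P n) c * (Num.sqrt (n%:R * moment (P n) 2))^-1 ^+ c).
Let S n k : T n -> R := empirical_moment (@X n) (P n) k.
Let L k := limit_moment A alpha k.

Lemma first_ratio0 : A 1 = 0.
Proof.
apply: (cvg_unique (@Rhausdorff R) (@limA 1 isT)); apply: cvg_near_cst; near=> n.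
have n0 : (0 < n)%N by near: n; exact: nbhs_infty_gt.
by have [_ -> _] := lawP n0; rewrite mul0r.
Unshelve. all: by end_near.
Qed.

Let h_cvg c : (0 < c)%N -> h n c @[n --> \oo] --> A c.
Proof.
move=> c0; apply: cvg_trans (limA c0); apply: near_eq_cvg; near=> n.
have n0 : (0 < n)%N by near: n; exact: nbhs_infty_gt.
have [_ _ M2] := lawP n0.
by rewrite powR_normalisation ?ltr0n // /h invf_div exprVn; ring.
Unshelve. all: by end_near.
Qed.

Let h_bounded K : exists2 H : R, 1 <= H &
  \forall n \near \oo, forall c, (0 < c <= K)%N -> `|h n c| <= H.
Proof.
exists (1 + \sum_(c < K.+1) (`|A c| + 1)).
  by rewrite lerDl sumr_ge0 // => c _; rewrite addr_ge0.
have : \forall n \near \oo, forall c : 'I_K.+1, (0 < c)%N -> `|A c - h n c| <= 1.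
  apply: filter_forall => c; case: (posnP c) => [c0|c0]; first by apply: nearW.
  by have /cvgrPdist_le /(_ 1 ltr01) := h_cvg c0; apply: filterS.
apply: filterS => n H c /andP[c0 cK]; have cK' : (c < K.+1)%N by [].
rewrite (bigD1 (Ordinal cK')) //= addrCA -[leLHS]addr0; apply: lerD.
  rewrite -[h n c](subKr (A c)); apply: le_trans (ler_normB _ _) _; rewrite lerD2l.
  exact: (H (Ordinal cK')).
by rewrite addr_ge0 // sumr_ge0 // => i _; rewrite addr_ge0.
Qed.

Let iidP n (n0 : (0 < n)%N) : mutually_independent (@X n) /\ forall i, has_law (@X n i) (P n).
Proof. by have [H1 H2] := iid n0; split => // -[i j]. Qed.

Let mean_cvg k : (0 < k)%N -> \int[Pr n]_w S k w @[n --> \oo] --> L k.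
Proof.
move=> k0; have := mean_limit m_alpha k0 first_ratio0 (fun c => @h_cvg c).
apply: cvg_trans; apply: near_eq_cvg; near=> n.
have n0 : (0 < n)%N by near: n; exact: nbhs_infty_gt.
have [f _ M2] := lawP n0; have [H1 H2] := iidP n0.
by rewrite (empirical_mean H1 H2 f n0 M2 k0).2.
Unshelve. all: by end_near.
Qed.

Let variance_cvg k : (0 < k)%N ->
  \int[Pr n]_w (S k w ^+ 2) - (\int[Pr n]_w S k w) ^+ 2 @[n --> \oo] --> (0 : R).
Proof.
move=> k0; have [H H1 hH] := h_bounded (k.*2 + k.*2); apply: norm_cvg0.
pose q := (k.*2).+1; pose y n : R := (q + q)%:R + (n%:R / n%:R + (m n)%:R / n%:R).
have inv0 : n%:R^-1 @[n --> \oo] --> (0 : R) by rewrite -(cvg_shiftS _); exact: cvg_harmonic.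
have ycvg : 2 * H ^+ (k.*2 + k.*2) * n%:R^-1 * y n ^+ (q + q) @[n --> \oo] --> (0 : R).
  have -> : 0 = 2 * H ^+ (k.*2 + k.*2) * 0 * ((q + q)%:R + (1 + alpha)) ^+ (q + q) :> R.
    by rewrite mulr0 mul0r.
  apply: cvgM; first by apply: cvgM => //; exact: cvg_cst.
  apply: cvg_pow; apply: cvgD; first exact: cvg_cst.
  apply: cvgD m_alpha; apply: cvg_near_cst; near=> n; rewrite divff // pnatr_eq0 -lt0n.
  by near: n; exact: nbhs_infty_gt.
apply: (@squeeze_cvgr _ _ _ _ (cst 0) _ _ _ 0 (cvg_cst _) ycvg).
near=> n; rewrite normr_ge0 /=.
have n0 : (0 < n)%N by near: n; exact: nbhs_infty_gt.
have hn : forall c, (0 < c <= k.*2 + k.*2)%N -> `|h n c| <= H by near: n.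
have [f _ M2] := lawP n0; have [X1 X2] := iidP n0.
rewrite (empirical_mean X1 X2 f n0 M2 k0).2 (empirical_mean_square X1 X2 f n0 M2 k0).2.
have := @covariance_bound R n (m n) k (h n) H n0 H1 hn.
rewrite exprMn -mulrBr normrM ger0_norm ?exprn_ge0 ?invr_ge0 //.
by rewrite /y -mulrDl -natrD.
Unshelve. all: by end_near.
Qed.

Let square_deviation n k (n0 : (0 < n)%N) (k0 : (0 < k)%N) :
  (Pr n).-integrable setT (EFin \o (fun w => (S k w - L k) ^+ 2)) /\
  \int[Pr n]_w ((S k w - L k) ^+ 2) =
    \int[Pr n]_w (S k w ^+ 2) - (\int[Pr n]_w S k w) ^+ 2 + (\int[Pr n]_w S k w - L k) ^+ 2.
Proof.
have [f _ M2] := lawP n0; have [X1 X2] := iidP n0; apply: Rintegral_square_diff.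
  exact: (empirical_mean X1 X2 f n0 M2 k0).1.
exact: (empirical_mean_square X1 X2 f n0 M2 k0).1.
Qed.

Let deviation_cvg k : (0 < k)%N -> \int[Pr n]_w ((S k w - L k) ^+ 2) @[n --> \oo] --> (0 : R).
Proof.
move=> k0; have -> : 0 = 0 + (L k - L k) ^+ 2 :> R by rewrite subrr expr0n addr0.
apply: cvg_trans; last first.
  apply: cvgD (variance_cvg k0) _; apply: cvg_pow.
  by apply: cvgB (mean_cvg k0) _; exact: cvg_cst.
apply: near_eq_cvg; near=> n.
have n0 : (0 < n)%N by near: n; exact: nbhs_infty_gt.
by rewrite (square_deviation n0 k0).2.
Unshelve. all: by end_near.
Qed.

(** Its smallness forces all the moments of order 1 to K to be close at once. *)
Definition total_deviation K n (w : T n) : R := \sum_(k < K) (S k.+1 w - L k.+1) ^+ 2.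

Lemma total_deviation_integrable K n : (0 < n)%N ->
  (Pr n).-integrable setT (EFin \o @total_deviation K n).
Proof.
by move=> n0; apply: (Rintegral_sum _ _).1 => k; exact: (square_deviation n0 (ltn0Sn k)).1.
Qed.

Lemma total_deviation_cvg K : \int[Pr n]_w (total_deviation K w) @[n --> \oo] --> (0 : R).
Proof.
have -> : 0 = \sum_(k < K) 0 :> R by rewrite big1.
apply: cvg_trans; last by apply: cvg_sum_cond => k _; exact: (@deviation_cvg k.+1).
apply: near_eq_cvg; near=> n.
have n0 : (0 < n)%N by near: n; exact: nbhs_infty_gt.
by apply/esym; apply: (Rintegral_sum _ _).2 => k; exact: (square_deviation n0 (ltn0Sn k)).1.
Unshelve. all: by end_near.
Qed.

(** Order 0 is set apart: there [limit_moment] is an empty sum, while a law has mass 1. *)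
Definition limit_sequence k : R := if k is k'.+1 then L k else 1.

Lemma total_deviation_close K n (w : T n) delta : (0 < n)%N -> 0 <= delta ->
  total_deviation K w <= delta ^+ 2 ->
  moments_close limit_sequence K delta (spectrum (gram_matrix (@X n) (P n) w)).
Proof.
move=> n0 d0 tdel; have [sz _] := spectrum_trace (gram_matrix_sym (@X n) (P n) w).
split; first by rewrite -size_eq0 sz -lt0n.
case=> [_|k kK].
  rewrite (_ : avg _ _ = 1) /= ?subrr ?normr0 //.
  by rewrite (funext (@expr0 R)) avg_cst // -size_eq0 sz -lt0n.
rewrite -(ler_pXn2r (n := 2)) ?nnegrE // real_normK ?num_real //.
apply: le_trans tdel; rewrite /total_deviation (bigD1 (Ordinal kK)) //=.
by rewrite lerDl sumr_ge0 // => i _; rewrite sqr_ge0.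
Qed.

(** Probabilistic method: the mean deviation tends to 0, so for some n at least one outcome has a
    spectrum with moments as close as desired. *)
Lemma moment_law : exists mu : probability (measurableTypeR R) R,
  finite_moments mu /\ forall k, moment mu k = limit_sequence k.
Proof.
apply: moment_law_exists => K delta d0.
have e0 : 0 < delta ^+ 2 by rewrite exprn_gt0.
have /cvgrPdist_lt /(_ _ e0) H := total_deviation_cvg K.
have [n [n0 Dn]] : exists n, (0 < n)%N /\ \int[Pr n]_w (total_deviation K w) < delta ^+ 2.
  have : \forall n \near \oo, (0 < n)%N /\ \int[Pr n]_w (total_deviation K w) < delta ^+ 2.
    near=> n; split; first by near: n; exact: nbhs_infty_gt.
    apply: le_lt_trans (ler_norm _) _; rewrite -normrN -sub0r.
    by near: n.
  by case=> N _ /(_ N (leqnn N)) HN; exists N.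
have [w Dw] : exists w : T n, @total_deviation K n w <= delta ^+ 2.
  apply: contrapT => no; move: Dn; apply/negP; rewrite -leNgt.
  have D0 (w : T n) : 0 <= @total_deviation K n w by rewrite sumr_ge0 // => i _; rewrite sqr_ge0.
  have := markov_bound (c := delta ^+ 2) measurableT (total_deviation_integrable K n0) D0 _.
  rewrite fine_probability_setT mulr1; apply=> w _; rewrite leNgt; apply/negP => /ltW Dw.
  by apply: no; exists w.
by exists (spectrum (gram_matrix (@X n) (P n) w)); apply: total_deviation_close => //; exact: ltW.
Unshelve. all: by end_near.
Qed.

(** No measurability of individual eigenvalues is used: power sums are traces up to scaling,
    polynomials follow by linearity, and continuous functions as pointwise limits. *)
Lemma measurable_linear_statistic n (f : R -> R) : (0 < n)%N -> continuous f ->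
  measurable_fun setT (fun w => avg (spectrum (gram_matrix (@X n) (P n) w)) f).
Proof.
move=> n0 cf; have [p pf] := weierstrass_seq cf.
have [fP _ M2] := lawP n0; have [X1 X2] := iidP n0.
have mS k : measurable_fun setT (@S n k).
  case: k => [|k]; last first.
    exact/measurable_EFinP/measurable_int/(empirical_mean X1 X2 fP n0 M2 (ltn0Sn k)).1.
  rewrite (_ : @S n 0 = cst 1); first exact: measurable_cst.
  apply/funext => w; have [sz _] := spectrum_trace (gram_matrix_sym (@X n) (P n) w).
  by rewrite /S /empirical_moment (funext (@expr0 R)) avg_cst // -size_eq0 sz -lt0n.
apply: (measurable_fun_cvg
  (h := fun j w => avg (spectrum (gram_matrix (@X n) (P n) w)) (fun x => (p j).[x]))) => [j|w _].
  have -> : (fun w => avg (spectrum (gram_matrix (@X n) (P n) w)) (fun x => (p j).[x])) =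
      fun w => \sum_(i < size (p j)) (p j)`_i * @S n i w.
    apply/funext => w; under [fun x => _]funext => x do rewrite horner_coef.
    by rewrite avg_sum; apply: eq_bigr => i _; rewrite avgZ.
  apply: measurable_sum => i; apply: measurable_funM => //; exact: measurable_cst.
apply: cvgM; last exact: cvg_cst.
by apply: cvg_sum_cond => x _; exact: pf.
Qed.

(** A deviation above [eps] prevents the moments from being close, hence forces a total deviation
    above delta^2, whose probability is small by Markov's inequality. *)
Lemma spectral_convergence (mu : probability (measurableTypeR R) R) B C f eps :
  0 <= B -> 0 <= C -> (forall k, limit_sequence k <= B * C ^+ k * k`!%:R) ->
  finite_moments mu -> (forall k, moment mu k = limit_sequence k) ->
  0 < eps -> continuous f -> bounded_fun f ->
  Pr n [set w | eps < `| \int[spectral_measure (gram_matrix (@X n) (P n) w)]_x f x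
                         - \int[mu]_x f x | ] @[n --> \oo] --> 0%E.
Proof.
move=> B0 C0 growth fmu mmu e0 cf bf.
have [K [delta [d0 close]]] := moment_method B0 C0 growth fmu mmu cf bf e0.
have mf : measurable_fun setT (f : measurableTypeR R -> R).
  exact: continuous_measurable_fun.
pose E n := [set w | eps < `| \int[spectral_measure (gram_matrix (@X n) (P n) w)]_x f x
                         - \int[mu]_x f x | ].
have mE n : (0 < n)%N -> measurable (E n).
  move=> n0; rewrite /E.
  under eq_set do rewrite (spectral_measure_integral (gram_matrix_sym _ _ _) mf).
  have mg : measurable_fun setT (fun w =>
      `| avg (spectrum (gram_matrix (@X n) (P n) w)) f - \int[mu]_x f x |).
    apply: measurableT_comp => //; apply: measurable_funB; last exact: measurable_cst.
    exact: measurable_linear_statistic.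
  have := measurable_fun_ltr (@measurable_cst _ _ _ _ setT eps) mg measurableT (Y := [set true]) I.
  by rewrite setTI.
have d20 : 0 < delta ^+ 2 by rewrite exprn_gt0.
have D0 n (w : T n) : 0 <= @total_deviation K n w by rewrite sumr_ge0 // => i _; rewrite sqr_ge0.
have bound n : (0 < n)%N ->
    fine (Pr n (E n)) <= (delta ^+ 2)^-1 * \int[Pr n]_w (total_deviation K w).
  move=> n0; rewrite ler_pdivlMl //; apply: markov_bound (total_deviation_integrable K n0) _ _ => //.
    exact: mE.
  move=> w Ew; rewrite leNgt; apply/negP => /ltW Dw.
  have := close _ (total_deviation_close n0 (ltW d0) Dw).
  by rewrite leNgt -(spectral_measure_integral (gram_matrix_sym _ _ _) mf) => /negP; apply.
apply/fine_cvgP; split.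
  near=> n; have n0 : (0 < n)%N by near: n; exact: nbhs_infty_gt.
  by apply: fin_num_measure; exact: mE.
apply: (@squeeze_cvgr _ _ _ _ (cst 0) (fun n => (delta ^+ 2)^-1 * \int[Pr n]_w (total_deviation K w))).
- near=> n; have n0 : (0 < n)%N by near: n; exact: nbhs_infty_gt.
  by rewrite fine_ge0 //= bound.
- exact: cvg_cst.
- have -> : 0 = (delta ^+ 2)^-1 * 0 :> R by rewrite mulr0.
  by apply: cvgM; [exact: cvg_cst | exact: total_deviation_cvg].
Unshelve. all: by end_near.
Qed.

End Ensemble.

(** The finitely many ratios before the bound takes effect are added to the constant. Having C >= 1
    allows powers of it to be bounded by larger powers. *)
Lemma bigO_geometric (R : realType) (A : nat -> R) (gamma : R) : 0 < gamma ->
  A =O_\oo (fun k => gamma ^+ k) ->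
  exists2 C : R, 1 <= C & forall k, `|A k| <= C * gamma ^+ k.
Proof.
move=> g0 /eqO_exP[c [c0 [N _ HN]]].
pose B k : R := `|A k| / gamma ^+ k.
have B0 k : 0 <= B k by rewrite divr_ge0 // exprn_ge0 // ltW.
exists (1 + c + \sum_(k < N) B k).
  by rewrite -addrA lerDl addr_ge0 ?(ltW c0) // sumr_ge0.
move=> k; have gk : 0 < gamma ^+ k by rewrite exprn_gt0.
rewrite -ler_pdivrMr //; case: (leqP N k) => [/HN|kN].
  rewrite (gtr0_norm gk) -ler_pdivrMr // => H; apply: le_trans H _.
  by rewrite -addrA addrCA lerDl addr_ge0 // sumr_ge0.
by rewrite (bigD1 (Ordinal kN)) //= addrCA lerDl addr_ge0 ?sumr_ge0 // addr_ge0 // ltW.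
Qed.

Lemma eq_limit_moment (R : realType) (A A' : nat -> R) alpha k :
  (forall c, (0 < c)%N -> A c = A' c) -> limit_moment A alpha k = limit_moment A' alpha k.
Proof.
move=> AA'; rewrite /limit_moment; apply: eq_bigr => a _; apply: eq_bigr => l _.
congr (_ * _); apply: eq_bigr => b /and3P[_ /allP b2 _]; congr (_ * _).
apply: eq_bigr => i _; apply: AA'; apply: ltnW; apply: b2.
by apply: map_f; exact: mem_tnth.
Qed.

(* The argument B is the sequence A shifted by one, whence the predecessor. *)
Definition limit_law (R : realType) (B : nat -> R) (alpha : R) :
    probability (measurableTypeR R) R :=
  if pselect (exists mu : probability (measurableTypeR R) R, finite_moments mu /\
      forall k, (0 < k)%N -> moment mu k = limit_moment (fun c => B c.-1) alpha k)
    is left mu then sval (cid mu) else \d_(0 : measurableTypeR R).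

Theorem theorem1 (R : realType) :
  exists law : (nat -> R) -> R -> probability (measurableTypeR R) R,
  forall (alpha : R) (m : nat -> nat)
    (P : nat -> probability (measurableTypeR R) R) (A : nat -> R)
    (d : nat -> measure_display) (T : forall n, measurableType (d n))
    (Pr : forall n, probability (T n) R)
    (X : forall n, 'I_n * 'I_(m n) -> {RV (Pr n) >-> measurableTypeR R})
    (gamma : R),
  let W n (w : T n) : 'M[R]_n :=
    let Xn := random_matrix (X n) w in
    (n%:R * moment (P n) 2)^-1 *: (Xn *m Xn^T) in
  (* A_0 is irrelevant: only (A_k)_{k >= 1} is passed to [law] *)
  let mu := law (fun k => A k.+1) alpha in
  0 < alpha ->
  (forall n, (0 < n)%N -> (0 < m n)%N) ->
  (m n)%:R / n%:R @[n --> \oo] --> alpha ->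
  (forall n, (0 < n)%N ->
    [/\ finite_moments (P n), moment (P n) 1 = 0 & 0 < moment (P n) 2]) ->
  (forall k, (0 < k)%N ->
    moment (P n) k /
      (n%:R `^ (k%:R / 2 - 1) * moment (P n) 2 `^ (k%:R / 2)) @[n --> \oo]
      --> A k) ->
  (forall n, (0 < n)%N ->
    mutually_independent (X n) /\ forall i j, has_law (X n (i, j)) (P n)) ->
  0 < gamma ->
  A =O_\oo (fun k => gamma ^+ k) ->
  [/\ forall (eps : R) (f : R -> R), 0 < eps ->
        continuous f -> bounded_fun f ->
        Pr n [set w | eps < `| \int[spectral_measure (W n w)]_x f x
                               - \int[mu]_x f x | ] @[n --> \oo] --> 0%E,
      finite_moments mu,
      forall k, (0 < k)%N -> moment mu k = limit_moment A alpha k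
    & forall nu : probability (measurableTypeR R) R,
        finite_moments nu ->
        (forall k, (0 < k)%N -> moment nu k = moment mu k) ->
        forall B, measurable B -> nu B = mu B].
Proof.
exists (@limit_law R) => alpha m P A d T Pr X gamma W mu a0 m0 mal lawP limA iid g0 AO.
have A1 := first_ratio0 lawP limA.
have [C0 C01 AC] := bigO_geometric g0 AO.
have [C [Cpos growth]] := limit_moment_growth a0 g0 C01 A1 (fun c _ => AC c).
have seq_growth k : limit_sequence alpha A k <= 128 * C ^+ k * k`!%:R.
  case: k => [|k]; first by rewrite /= expr0 mulr1 fact0 mulr1 ler1n.
  exact: le_trans (ler_norm _) (growth k.+1 isT).
(* [limit_law] receives the shifted sequence, so its moments are written with [A c.-1.+1], equal to
   [A c] for c positive. *)
have AE k : limit_moment (fun c => A c.-1.+1) alpha k = limit_moment A alpha k.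
  by apply: eq_limit_moment => -[].
have [fmu mmu] : finite_moments mu /\ forall k, (0 < k)%N -> moment mu k = limit_moment A alpha k.
  (* The default Dirac mass is excluded: the given matrices provide a law with these moments. *)
  rewrite /mu /limit_law; case: pselect => [e|[]].
    by case: (cid e) => nu /= [H1 H2]; split => // k k0; rewrite H2 // AE.
  have [nu [H1 H2]] := moment_law mal lawP limA iid.
  by exists nu; split => // -[|k] // _; rewrite AE H2.
have mmu' k : moment mu k = limit_sequence alpha A k.
  by case: k => [|k]; [exact: moment0 | exact: mmu].
split => //.
  move=> eps f e0 cf bf.
  exact: (spectral_convergence mal lawP limA iid (ler0n _ 128) (ltW Cpos) seq_growth fmu mmu' e0 cf bf).
move=> nu fnu mnu; apply: (moment_determinacy fmu fnu (ler0n _ 128) (ltW Cpos)).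
  by move=> k; rewrite mmu'.
by case=> [|k]; [rewrite !moment0 | exact: mnu].
Qed.
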